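(* Consider the one-term model under the deterministic scheme along a sequence with $M+N\to\infty$, and assume: (A1) $\frac{m_0+n_0}{\ln\ln(MN)}\to\infty$ and $\frac{m_0^\dagger+n_0^\dagger}{\ln\ln(MN)}\to\infty$; (A2) $\bm E$ has i.i.d. standard normal entries; (A3) $$\lim \frac{2^{(M+N)/2}}{2^{(m_0+n_0)/2}+2^{(m_0^\dagger+n_0^\dagger)/2}}\cdot\frac{\lambda}{\sigma}\cdot\psi=\infty\quad\text{and}\quad \lim 2^{(M+N)/4}\cdot\frac{\lambda}{\sigma}\cdot\psi^2=\infty.$$ If $$\kappa\ge 2\ln 2\quad\text{and}\quad \kappa=o\left(\frac{2^{M+N}\ln(1+(\lambda/\sigma)^2\psi^2)}{2^{m_0+n_0}+2^{m_0^\dagger+n_0^\dagger}}\right),$$ then $$\min_{(m,n)\in\mathcal W}\mathbb E[\mathrm{IC}_\kappa(m,n)]-\mathbb E[\mathrm{IC}_\kappa(m_0,n_0)]\ge 2^{M+N}\ln[1+(\lambda/\sigma)^2\psi^2]\,(1+o(1)).$$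
   Context: Model: $\bm Y=\lambda\bm A\otimes\bm B+\sigma 2^{-(M+N)/2}\bm E$ ($2^M\times 2^N$), $\lambda>0,\sigma>0$, $\bm A$ is $2^{m_0}\times 2^{n_0}$, $\bm B$ is $2^{M-m_0}\times 2^{N-n_0}$, $\|\bm A\|_F=\|\bm B\|_F=1$; deterministic scheme means $\lambda,\bm A,\bm B$ non-random. $m_0^\dagger=M-m_0$, $n_0^\dagger=N-n_0$. All quantities, including $\kappa\ge0$, may depend on the index of the sequence; limits and $o(\cdot)$ are along it. For a sequence $a_k$, ''$a_k\ge o(1)$'' means $\max\{-a_k,0\}=o(1)$; the displayed inequality is understood in this sense. Vectorization $\mathrm{vec}$ stacks rows; rearrangement: for a $2^a\times 2^b$ matrix $\bm C$ and $0\le m\le a,0\le n\le b$, view $\bm C$ as a $2^m\times 2^n$ array of $2^{a-m}\times 2^{b-n}$ blocks $\bm C_{i,j}$; $\mathcal R_{m,n}[\bm C]$ is the $2^{m+n}\times 2^{a+b-m-n}$ matrix with rows $\mathrm{vec}(\bm C_{i,j})'$ in row-major order of $(i,j)$. Fit under configuration $(m,n)$: $\hat\lambda=\|\mathcal R_{m,n}[\bm Y]\|_S$, $\hat{\bm A}=\mathrm{vec}^{-1}(u_1)$, $\hat{\bm B}=\mathrm{vec}^{-1}(v_1)$ with $u_1,v_1$ leading singular vectors of $\mathcal R_{m,n}[\bm Y]$, and $\hat{\bm Y}^{(m,n)}=\hat\lambda\hat{\bm A}\otimes\hat{\bm B}$. Information criterion: $\mathrm{IC}_\kappa(m,n)=2^{M+N}\ln\|\bm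 Y-\hat{\bm Y}^{(m,n)}\|_F^2+\kappa(2^{m+n}+2^{M+N-m-n})$. Candidate set $\mathcal C=\{0,\dots,M\}\times\{0,\dots,N\}\setminus\{(0,0),(M,N)\}$; wrong configurations $\mathcal W=\mathcal C\setminus\{(m_0,n_0)\}$. Representation gap: $\phi=\max_{(m,n)\in\mathcal W}\|\mathcal R_{m,n}[\bm A\otimes\bm B]\|_S$, $\psi^2=1-\phi^2$, $\psi\ge 0$. *)

(* Defs.v *)
From HB Require Import structures.
From mathcomp Require Import all_boot all_order all_algebra.
From mathcomp Require Import all_classical all_reals all_analysis.
From Stdlib Require Import ClassicalEpsilon.
Set Implicit Arguments. Unset Strict Implicit. Unset Printing Implicit Defensive.
Import Order.TTheory GRing.Theory Num.Theory.
Import numFieldNormedType.Exports.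
Local Open Scope classical_set_scope.
Local Open Scope ring_scope.

(* Conventions.  A real "p x q matrix" is represented by a function
   C : nat -> nat -> R of which only the entries C i j with i < p, j < q
   matter (indices start at 0); a "vector of length p" is u : nat -> R with
   only u i, i < p, relevant.  The sizes are always passed explicitly. *)

Section Defs.
Variable R : realType.
Implicit Types (p q a b m n : nat) (C A B : nat -> nat -> R) (u v : nat -> R).

Definition frob2 p q C : R := \sum_(0 <= i < p) \sum_(0 <= j < q) C i j ^+ 2.

Definition vnorm2 p u : R := \sum_(0 <= i < p) u i ^+ 2.

Definition bilin p q C u v : R :=
  \sum_(0 <= i < p) \sum_(0 <= j < q) u i * C i j * v j.

Definition specnorm p q C : R :=
  sup [set x : R | exists u v, vnorm2 p u = 1 /\ vnorm2 q v = 1 /\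
                               x = bilin p q C u v].

Definition kron pB qB A B : nat -> nat -> R :=
  fun x y => A (x %/ pB)%N (y %/ qB)%N * B (x %% pB)%N (y %% qB)%N.

(* Rearrangement R_{m,n}[C] of a 2^a x 2^b matrix C: C is viewed as a
   2^m x 2^n array of 2^(a-m) x 2^(b-n) blocks C_{i,j}; row number
   i*2^n + j of the result (row-major order of (i,j)) is vec(C_{i,j})',
   where vec stacks rows. Result is 2^(m+n) x 2^(a+b-m-n). *)
Definition rearr a b m n C : nat -> nat -> R :=
  fun r c => C ((r %/ 2 ^ n) * 2 ^ (a - m) + c %/ 2 ^ (b - n))%N
               ((r %% 2 ^ n) * 2 ^ (b - n) + c %% 2 ^ (b - n))%N.

Definition unvec q u : nat -> nat -> R := fun i j => u (i * q + j)%N.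

Definition lead_sv p q C : (nat -> R) * (nat -> R) :=
  epsilon (inhabits ((fun _ => 0), (fun _ => 0)))
    (fun uv => vnorm2 p uv.1 = 1 /\ vnorm2 q uv.2 = 1 /\
               bilin p q C uv.1 uv.2 = specnorm p q C).

Definition fitY M N m n Y : nat -> nat -> R :=
  let RY := rearr M N m n Y in
  let P := (2 ^ (m + n))%N in let Q := (2 ^ (M + N - m - n))%N in
  let lam := specnorm P Q RY in
  let uv := lead_sv P Q RY in
  fun x y => lam * kron (2 ^ (M - m))%N (2 ^ (N - n))%N
               (unvec (2 ^ n)%N uv.1) (unvec (2 ^ (N - n))%N uv.2) x y.

Definition IC M N (kappa : R) m n Y : R :=
  (2 ^ (M + N))%:R *
    ln (frob2 (2 ^ M)%N (2 ^ N)%N (fun x y => Y x y - fitY M N m n Y x y))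
  + kappa * ((2 ^ (m + n))%N + (2 ^ (M + N - m - n))%N)%:R.

Definition candidate M N (mn : nat * nat) : bool :=
  [&& (mn.1 <= M)%N, (mn.2 <= N)%N, mn != (0, 0)%N & mn != (M, N)].
Definition wrong M N m0 n0 (mn : nat * nat) : bool :=
  candidate M N mn && (mn != (m0, n0)).

Definition phi_gap M N m0 n0 A B : R :=
  \big[Num.max/0]_(m < M.+1) \big[Num.max/0]_(n < N.+1 | wrong M N m0 n0 (m : nat, n : nat))
     specnorm (2 ^ (m + n))%N (2 ^ (M + N - m - n))%N
       (rearr M N m n (kron (2 ^ (M - m0))%N (2 ^ (N - n0))%N A B)).
Definition psi_gap M N m0 n0 A B : R :=
  Num.sqrt (1 - phi_gap M N m0 n0 A B ^+ 2).

End Defs.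

(* Main.v *)
Require Import Defs.
From HB Require Import structures.
From mathcomp Require Import all_boot all_order all_algebra.
From mathcomp Require Import all_classical all_reals all_analysis measurable_realfun.
From mathcomp Require Import ring lra zify.
From Stdlib Require Import ClassicalEpsilon.
Import Order.TTheory GRing.Theory Num.Theory.
Import numFieldNormedType.Exports.
Local Open Scope classical_set_scope.
Local Open Scope ring_scope.

(** Rescale by [sigma] and write [D = 2^(M+N)], [t = (lam/sigma)^2 psi^2],
    [L = ln (1 + t)].  Under a configuration [(m, n)] the residual [Z] is the
    squared distance of the rearranged data to the rank-one matrices.

    At the true configuration [Z <= |E|^2/D], so [E ln Z] is at most of order
    [D^(-1/2)].  At a wrong one the squared spectral norm of the rearranged data
    is at most [(lam/sigma)^2 phi^2 + min(p,q)^(-1)] up to cross terms and the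
    deviation of [|X' u|^2] from its mean, uniformly over unit vectors [u]; hence
    [Z] is at least [1 + t - min(p,q)^(-1)] up to a relative error whose mean
    square is of order [eta^2], [eta = D^(-1/2) + (lam/sigma) D^(-1/4)/(1 + t)].
    The uniform deviation is controlled by a net of the sphere and exact Gaussian
    moment generating functions.  The term [min(p,q)^(-1)] costs at most
    [2 ln 2 (p + q)] after multiplication by [D], which the penalty pays since
    [kappa >= 2 ln 2], and the divergence of [D^(1/4) (lam/sigma) psi^2] makes
    [eta] negligible with respect to [L].

    Passing from [Z] to [ln Z] needs [E (ln Z)^2] to be bounded near [Z = 0]: on
    each 2x2 block one of the quantities [a - b c / d] is, up to a constant, below
    the distance of the block to the rank-one matrices, and it has a bounded
    density because [a] is independent of [b, c, d].

    Measurability of the fit is never needed: [ln Z] is compared pointwise with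
    measurable functions, and the integral is monotone without measurability. *)

(** A limit in probability would not control expectations of logarithms, so every error is carried
    by an explicit nonnegative function [H] of bounded mean. The fit depends on the noise through an
    arbitrary choice of singular vectors; hence each [H] has to work for all unit vectors [u], [v]
    at once. A linear error [y] is traded for [eta + y ^+ 2 / eta], so that mean squares suffice,
    and these are all extracted from one exponential formula.

    Near [Z = 0] a single 2x2 block would lose a power of [ln D], because the residual is an average
    over [D] entries; averaging over all cyclically shifted blocks and applying Jensen gives a bound
    free of the dimensions. Since [ln 0 = 0] by convention, the majorants are made [+oo] wherever
    the residual vanishes.

    The threshold [2 ln 2] is the slope of the chord of [ln] between [1/2] and [1], where [1/2] is
    the largest possible value of [min(p,q)^(-1)]. *)

Lemma integral_monotone {d} {T : measurableType d} {R : realType}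
    (mu : {measure set T -> \bar R}) (f g : T -> \bar R) :
  (forall x, (f x <= g x)%E) -> (\int[mu]_x f x <= \int[mu]_x g x)%E.
Proof.
move=> fg; rewrite /integral !patch_setT; apply: leeB; apply: ereal_sup_le.
  move=> _ [h hf <-]; exists h => // x; apply: (le_trans (hf x)).
  by apply: (@funepos_le _ _ setT); rewrite ?inE.
move=> _ [h hf <-]; exists h => // x; apply: (le_trans (hf x)).
by apply: (@funeneg_le _ _ setT); rewrite ?inE.
Qed.

(** * Exact integrals against the standard normal law *)

Section standard_normal.
Context {R : realType}.

(** The Radon-Nikodym derivative of [normal_prob 0 1] coincides almost everywhere with the density,
    because both have the same integral over every measurable set. *)
Lemma normal_prob01_integral (f : R -> \bar R) :
  measurable_fun setT f -> (forall x, (0 <= f x)%E) ->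
  (\int[normal_prob 0 1]_x f x =
   \int[lebesgue_measure]_x (f x * (normal_pdf 0 1 x)%:E))%E.
Proof.
move=> mf f0.
have dom := @normal_prob_dominates R 0 1.
rewrite -(Radon_Nikodym_SigmaFinite.change_of_variables dom)//.
have mN : measurable_fun setT (fun x : R => (normal_pdf 0 1 x)%:E).
  by apply/measurable_EFinP; exact: measurable_normal_pdf.
have iRN := Radon_Nikodym_SigmaFinite.f_integrable dom.
apply: ae_eq_integral => //.
- by apply: emeasurable_funM => //; exact: measurable_int iRN.
- exact: emeasurable_funM.
- apply: ae_eqe_mul2l; apply: integral_ae_eq => // A _ mA.
  by rewrite -Radon_Nikodym_SigmaFinite.f_integral.
Qed.

Lemma normal_peak1_le : normal_peak 1 <= 2^-1 :> R.
Proof.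
have p2 := @pi_ge2 R.
have p0 : 0 < (pi : R) *+ 2 by rewrite mulr2n; lra.
rewrite /normal_peak expr1n mul1r lef_pV2 ?posrE ?sqrtr_gt0//.
rewrite -(@ler_pXn2r _ 2) ?nnegrE ?sqrtr_ge0//.
rewrite sqr_sqrtr; last exact: ltW.
by rewrite expr2; lra.
Qed.

(** The density is at most [2^-1] and the interval has length [2 * e]. Uniformity in the centre [t]
    later allows [t] to be any random variable independent of the coordinate. *)
Lemma normal_prob01_ball (t e : R) : 0 <= e ->
  (normal_prob 0 1 [set z : R | (`|z - t| <= e)%R] <= e%:E)%E.
Proof.
move=> e0; rewrite /normal_prob.
have -> : [set z : R | `|z - t| <= e] = `[t - e, t + e]%classic.
  by apply/seteqP; split => z /=; rewrite in_itv/= ler_distl.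
apply: (@le_trans _ _
  (\int[lebesgue_measure]_(x in `[(t - e)%R, (t + e)%R]) (2^-1)%:E))%E.
  apply: ge0_le_integral => //=.
  - by move=> x _; rewrite lee_fin normal_pdf_ge0.
  - apply/measurable_funTS/measurable_EFinP; exact: measurable_normal_pdf.
  - move=> x _; rewrite lee_fin; apply: le_trans normal_peak1_le.
    by apply: normal_pdf_ub; rewrite oner_neq0.
rewrite integral_cst//= lebesgue_measure_itv/= lte_fin.
case: ifPn => _; last by rewrite mule0 lee_fin.
rewrite -EFinB -EFinM lee_fin; lra.
Qed.

(* Completing the square turns the integrand into a multiple of a Gaussian
   density of variance [(1 - 2 th u^2)^-1]. *)
Lemma normal_prob01_exp_sqr (th c u : R) :
  0 < 1 - 2 * th * u ^+ 2 ->
  (\int[normal_prob 0 1]_z (expR (th * (c + u * z) ^+ 2))%:E =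
   ((Num.sqrt (1 - 2 * th * u ^+ 2))^-1 *
     expR (th / (1 - 2 * th * u ^+ 2) * c ^+ 2))%:E)%E.
Proof.
set k := 1 - _ => k0.
have mf : measurable_fun setT (fun z : R => (expR (th * (c + u * z) ^+ 2))%:E).
  apply/measurable_EFinP; apply: measurableT_comp => //.
  apply: measurable_funM => //; apply: measurable_funX.
  by apply: measurable_funD => //; exact: measurable_funM.
rewrite normal_prob01_integral//.
have sk0 : 0 < Num.sqrt k by rewrite sqrtr_gt0.
pose s := (Num.sqrt k)^-1; have s0 : 0 < s by rewrite invr_gt0.
have s2 : s ^+ 2 = k^-1 by rewrite exprVn sqr_sqrtr// ltW.
have sN0 : s != 0 by rewrite gt_eqF.
pose m := 2 * th * c * u / k.
have E z : expR (th * (c + u * z) ^+ 2) * normal_pdf 0 1 z =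
    s * expR (th / k * c ^+ 2) * normal_pdf m s z.
  rewrite !normal_pdfE ?oner_neq0// /normal_peak /normal_fun.
  have -> : Num.sqrt (s ^+ 2 * pi *+ 2) = s * Num.sqrt (pi *+ 2).
    by rewrite -mulrnAr sqrtrM ?sqr_ge0// sqrtr_sqr gtr0_norm.
  rewrite expr1n mul1r invfM; set P := (Num.sqrt (pi *+ 2))^-1.
  transitivity (P * (expR (th * (c + u * z) ^+ 2)
                     * expR (- (z - 0) ^+ 2 / (1 *+ 2)))); first by ring.
  transitivity (s * s^-1 * P * (expR (th / k * c ^+ 2)
                  * expR (- (z - m) ^+ 2 / (s ^+ 2 *+ 2)))); last by ring.
  rewrite divff// mul1r -!expRD; congr (_ * expR _).
  rewrite s2 subr0 /m; have kE : k = 1 - 2 * th * u ^+ 2 by [].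
  have kN0 : k != 0 by rewrite gt_eqF.
  field: kE.
  by rewrite kN0.
under eq_integral do rewrite -EFinM E EFinM.
rewrite ge0_integralZl//=.
- by rewrite integral_normal_pdf mule1.
- by apply/measurable_EFinP; exact: measurable_normal_pdf.
- by move=> x _; rewrite lee_fin normal_pdf_ge0.
- by rewrite lee_fin mulr_ge0 ?expR_ge0// ltW.
Qed.

End standard_normal.

(** * Independence, and integrating out a single coordinate *)

Section iid_normal_family.
Context {d : measure_display} {T : measurableType d} {R : realType}.
Context (P : probability T R) {I : finType} (X : I -> T -> R).

Definition iid_normal :=
  (forall i, measurable_fun setT (X i)) /\
  forall V : I -> set R, (forall i, measurable (V i)) ->
    P [set w | forall i, V i (X i w)] = (\prod_i normal_prob 0 1 (V i))%E.

(** A pi-system generating the sigma-algebra of all coordinates except [i]; [V i = setT] is what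
    removes coordinate [i]. The carrier stays [T], so a function of the other coordinates is a
    function on [T] measurable for a smaller sigma-algebra. *)
Definition cylinders_off (i : I) : set (set T) :=
  [set C | exists V : I -> set R, [/\ forall j, measurable (V j),
      V i = setT & C = [set w | forall j, V j (X j w)]]].

Local Notation off i := (g_sigma_algebraType (cylinders_off i)).

Lemma measurable_off i j : j != i ->
  measurable_fun setT (X j : off i -> R).
Proof.
move=> ji _ A mA; rewrite setTI; apply: sub_sigma_algebra.
exists (fun k => if k == j then A else setT); split.
- by move=> k; case: ifP.
- by rewrite eq_sym (negbTE ji).
- apply/seteqP; split => w /=.
    by move=> Aw k; case: eqP => // ->.
  by move=> /(_ j); rewrite eqxx.
Qed.

Hypothesis iidX : iid_normal.
Let mX := iidX.1.

Lemma iid_normal_measurable_cylinder V : (forall j, measurable (V j)) ->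
  measurable [set w | forall j, V j (X j w)].
Proof.
move=> mV; have -> : [set w | forall j, V j (X j w)] =
    \big[setI/setT]_j (X j @^-1` V j).
  rewrite -bigcap_seq; apply/seteqP; split => w /= H j; first by move=> _; exact: H.
  by apply: (H j); rewrite /= mem_index_enum.
apply: bigsetI_measurable => j _.
by rewrite -[X in measurable X]setTI; exact: mX.
Qed.

Lemma cylinders_off_measurable i : cylinders_off i `<=` measurable.
Proof.
by move=> _ [V [mV _ ->]]; exact: iid_normal_measurable_cylinder.
Qed.

Lemma measurable_id_off i : measurable_fun setT (id : T -> off i).
Proof.
move=> _ A mA; rewrite setTI preimage_id.
exact: (smallest_sub (@sigma_algebra_measurable _ T)
  (@cylinders_off_measurable i)) mA.
Qed.

Lemma setI_closed_cylinders_off i : setI_closed (cylinders_off i).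
Proof.
move=> _ _ [V [mV Vi ->]] [W [mW Wi ->]].
exists (fun j => V j `&` W j); split.
- by move=> j; exact: measurableI.
- by rewrite Vi Wi setTI.
- apply/seteqP; split => w /=; first by move=> [HV HW] j.
  by move=> H; split => j; case: (H j).
Qed.

(** For fixed [A] both sides are finite measures in [B] (a restriction of [P] and a multiple of [P])
    that agree on the cylinders, hence on the generated sigma-algebra. *)
Lemma iid_normal_indep_off i (A : set R) (B : set (off i)) :
  measurable A -> measurable B ->
  P (X i @^-1` A `&` B) = (normal_prob 0 1 A * P B)%E.
Proof.
move=> mA mB.
have mXA : measurable (X i @^-1` A).
  by rewrite -[X in measurable X]setTI; exact: mX.
have NA : normal_prob 0 1 A \is a fin_num by exact: fin_num_measure.
pose r : {nonneg R} := NngNum (fine_ge0 (measure_ge0 (normal_prob 0 1) A)).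
have rE : r%:num%:E = normal_prob 0 1 A by rewrite /= fineK.
rewrite setIC -rE.
rewrite -/(mrestr P mXA B) -/(mscale r P B).
apply: (@g_sigma_algebra_measure_unique _ _ _ (cylinders_off i)
  (@cylinders_off_measurable i) (fun=> setT)) => //.
- move=> _; exists (fun=> setT); split => //.
  by apply/seteqP; split.
- by rewrite bigcup_const//; exists 0%N.
- exact: setI_closed_cylinders_off.
- move=> _ [V [mV Vi ->]].
  change (P ([set w | forall j, V j (X j w)] `&` X i @^-1` A) =
    r%:num%:E * P [set w | forall j, V j (X j w)])%E.
  rewrite rE iidX.2//.
  have -> : [set w | forall j, V j (X j w)] `&` X i @^-1` A =
      [set w | forall j, (if j == i then A else V j) (X j w)].
    apply/seteqP; split => w /=.
      by move=> [HV HA] j; case: eqP => // ->.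
    move=> H; split; last by move: (H i); rewrite eqxx.
    by move=> j; move: (H j); case: eqP => // ->; rewrite Vi.
  rewrite (iidX.2 (fun j => if j == i then A else V j)); last by move=> j; case: ifP.
  rewrite (bigD1 i)//= eqxx [in RHS](bigD1 i)//= Vi probability_setT mul1e.
  by congr (_ * _)%E; apply: eq_bigr => j /negbTE ->.
- move=> _; change (P (setT `&` X i @^-1` A) < +oo)%E.
  by rewrite setTI (le_lt_trans (probability_le1 _ _))// ltry.
Qed.

(** By independence the law of [w |-> (X i w, w)] on the product with [off i] is a product measure,
    so Tonelli applies. The measurability of [h] over [off i] expresses that its second argument
    carries no information on coordinate [i]. *)
Lemma iid_normal_resample i (h : measurableTypeR R * off i -> \bar R) :
  measurable_fun setT h -> (forall x, (0 <= h x)%E) ->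
  (\int[P]_w h (X i w, w) =
   \int[P]_w \int[normal_prob 0 1]_z h (z, w))%E.
Proof.
move=> mh h0.
pose phi (w : T) : measurableTypeR R * off i := (X i w, w).
have mphi : measurable_fun setT phi.
  by apply: measurable_fun_pair; [exact: mX|exact: measurable_id_off].
pose phim : {mfun T >-> (measurableTypeR R * off i)%type} :=
  HB.pack phi (isMeasurableFun.Build _ _ _ _ phi mphi).
pose idf : T -> off i := id.
have midf : measurable_fun setT idf by exact: measurable_id_off.
pose idm : {mfun T >-> off i} :=
  HB.pack idf (isMeasurableFun.Build _ _ _ _ idf midf).
have -> : (\int[P]_w h (X i w, w) = \int[pushforward P phim]_x h x)%E.
  by rewrite ge0_integral_pushforward.
pose Q := distribution P idm.
pose N : probability (measurableTypeR R) R := normal_prob (0:R) 1.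
have E : forall A : set (measurableTypeR R * off i), measurable A ->
    (N \x Q)%E A = pushforward P phim A.
  apply: (@product_measure_unique _ _ _ _ _ N Q (distribution P phim)).
  move=> A B mA mB.
  have := @iid_normal_indep_off i A B mA mB.
  by rewrite /= /distribution /pushforward.
transitivity (\int[N \x Q]_x h x)%E.
  by apply: eq_measure_integral => A mA _; exact/esym/E.
rewrite fubini_tonelli2// ge0_integral_distribution//.
- exact: measurable_fun_fubini_tonelli_G.
- by move=> w; apply: integral_ge0.
Qed.

End iid_normal_family.

Lemma big_setD1_cond {V : zmodType} {I J : finType} (A : {set I}) (i0 : I)
    (col : I -> J) (F : I -> V) (j : J) : i0 \in A ->
  \sum_(i in A | col i == j) F i =
  (if col i0 == j then F i0 else 0) + \sum_(i in A :\ i0 | col i == j) F i.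
Proof.
move=> i0A; case: ifPn => c.
  rewrite (bigD1 i0) ?i0A//=; congr (_ + _); apply: eq_bigl => i.
  by rewrite !inE; case: (i != i0); rewrite ?andbT ?andbF.
rewrite add0r; apply: eq_bigl => i; rewrite !inE.
by case: (i =P i0) => // ->; rewrite (negbTE c) andbF.
Qed.

Lemma measurable_expR_sqr_affine {R : realType} (th c u : R) :
  measurable_fun setT (fun z : R => (expR (th * (c + u * z) ^+ 2))%:E).
Proof.
apply/measurable_EFinP; apply: measurableT_comp => //.
apply: measurable_funM => //; apply: measurable_funX.
by apply: measurable_funD => //; exact: measurable_funM.
Qed.

(** * Moment generating functions of sums of squares *)

Section iid_normal_mgf.
Context {d : measure_display} {T : measurableType d} {R : realType}.
Context {P : probability T R} {I : finType} {X : I -> T -> R}.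
Hypothesis iidX : iid_normal P X.
Let mX := iidX.1.

Local Notation off i := (g_sigma_algebraType (cylinders_off X i)).

Lemma measurable_lincomb (Q : pred I) (u : I -> R) :
  measurable_fun setT (fun w : T => \sum_(i | Q i) u i * X i w).
Proof.
under eq_fun do rewrite big_mkcond.
apply: measurable_sum => i; case: (Q i) => //.
by apply: measurable_funM => //; exact: mX.
Qed.

Lemma measurable_lincomb_off (i0 : I) (Q : pred I) (u : I -> R) : ~~ Q i0 ->
  measurable_fun setT ((fun w => \sum_(i | Q i) u i * X i w) : off i0 -> R).
Proof.
move=> Qi0; under eq_fun do rewrite big_mkcond.
apply: measurable_sum => i; case Qi: (Q i) => //.
apply: measurable_funM => //.
have ii : i != i0 by apply/eqP => ii0; rewrite -ii0 Qi in Qi0.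
exact: (measurable_off X i0 i ii).
Qed.

(** Induction on [A], integrating out one coordinate [i0] at a time. This replaces the exponent of
    its colour by [th j0 / k], which is why [th] varies with the colour, and the factors telescope:
    [k * (1 - 2 * (th j0 / k) * b) = k - 2 * th j0 * b]. *)
Lemma iid_normal_exp_sum_sqr {J : finType} (col : I -> J) (u : I -> R)
    (A : {set I}) (th : J -> R) :
  (forall j, 0 < 1 - 2 * th j * \sum_(i in A | col i == j) u i ^+ 2) ->
  (\int[P]_w (expR (\sum_j th j *
       (\sum_(i in A | col i == j) u i * X i w) ^+ 2))%:E =
   (\prod_j (Num.sqrt (1 - 2 * th j * \sum_(i in A | col i == j) u i ^+ 2))^-1)%:E)%E.
Proof.
move: {2}#|A| (leqnn #|A|) => n; elim: n A th => [|n IHn] A th.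
  rewrite leqn0 => /eqP/cards0_eq -> _.
  under eq_integral => w _.
    rewrite big1 ?expR0; first over.
    by move=> j _; rewrite big_pred0 ?expr0n ?mulr0// => i; rewrite inE.
  rewrite integral_cst// mul1e [LHS](probability_setT P) big1// => j _.
  by rewrite big_pred0 ?mulr0 ?subr0 ?sqrtr1 ?invr1// => i; rewrite inE.
move=> cA thA; have [->|[i0 i0A]] := set_0Vmem A.
  by apply: IHn; rewrite ?cards0// => j; rewrite big_pred0 ?mulr0 ?subr0// => i; rewrite inE.
set j0 := col i0; pose A' := A :\ i0.
pose L j w := \sum_(i in A' | col i == j) u i * X i w.
pose b j := \sum_(i in A' | col i == j) u i ^+ 2.
have b0 j : 0 <= b j by apply: sumr_ge0 => i _; rewrite sqr_ge0.
have bE j : \sum_(i in A | col i == j) u i ^+ 2 =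
    (if j0 == j then u i0 ^+ 2 else 0) + b j by exact: big_setD1_cond.
have LE j w : \sum_(i in A | col i == j) u i * X i w =
    (if j0 == j then u i0 * X i0 w else 0) + L j w by exact: big_setD1_cond.
pose k := 1 - 2 * th j0 * u i0 ^+ 2.
have kb : 0 < k - 2 * th j0 * b j0.
  by have := thA j0; rewrite bE eqxx /k mulrDr opprD addrA.
(* For [th j0 >= 0] this follows from the hypothesis on the whole colour class; for negative [th j0]
   it is automatic. *)
have k0 : 0 < k.
  have [t0|t0] := leP 0 (th j0).
    by apply: lt_le_trans kb _; rewrite gerBl !mulr_ge0.
  by rewrite /k; have := sqr_ge0 (u i0); nra.
pose rest w := \sum_(j | j != j0) th j * (L j w) ^+ 2.
pose h (x : measurableTypeR R * off i0) : \bar R :=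
  (expR (th j0 * (L j0 x.2 + u i0 * x.1) ^+ 2) * expR (rest x.2))%:E.
have mL j : measurable_fun setT (L j : off i0 -> R).
  by apply: measurable_lincomb_off; rewrite !inE eqxx.
have mrest : measurable_fun setT (rest : off i0 -> R).
  rewrite /rest; under eq_fun do rewrite big_mkcond.
  apply: measurable_sum => j; case: (j != j0) => //.
  by apply: measurable_funM => //; exact: measurable_funX.
have mh : measurable_fun setT h.
  apply/measurable_EFinP; apply: measurable_funM.
    apply: measurableT_comp => //; apply: measurable_funM => //.
    apply: measurable_funX; apply: measurable_funD.
      exact: measurableT_comp.
    by apply: measurable_funM => //; exact: measurable_fst.
  by do 2 apply: measurableT_comp => //.
pose th' j := if j == j0 then th j0 / k else th j.
have restE w : expR (th j0 / k * L j0 w ^+ 2) * expR (rest w) =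
    expR (\sum_j th' j * L j w ^+ 2).
  rewrite -expRD [in RHS](bigD1 j0)//= /th' eqxx; congr (expR (_ + _)).
  by apply: eq_bigr => j /negbTE ->.
transitivity (\int[P]_w h (X i0 w, w))%E.
  apply: eq_integral => w _; rewrite /h/= -expRD; congr (expR _)%:E.
  rewrite (bigD1 j0)//= LE eqxx addrC [L _ _ + _]addrC addrC; congr (_ + _).
  by apply: eq_bigr => j /negbTE jj0; rewrite LE eq_sym jj0 add0r.
rewrite (iid_normal_resample P X iidX i0 h mh); last first.
  by move=> x; rewrite lee_fin mulr_ge0 ?expR_ge0.
transitivity (\int[P]_w ((Num.sqrt k)^-1%:E * (expR (\sum_j th' j * L j w ^+ 2))%:E))%E.
  apply: eq_integral => w _; rewrite /h/=.
  under eq_integral do rewrite EFinM.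
  rewrite ge0_integralZr//=.
    by rewrite normal_prob01_exp_sqr// -/k -!EFinM -restE [in RHS]mulrA.
  exact: measurable_expR_sqr_affine.
have mE : measurable_fun setT (fun w => (expR (\sum_j th' j * L j w ^+ 2))%:E).
  apply/measurable_EFinP; apply: measurableT_comp => //.
  apply: measurable_sum => j; apply: measurable_funM => //.
  by apply: measurable_funX; exact: measurable_lincomb.
rewrite ge0_integralZl//.
rewrite /L IHn.
- rewrite -EFinM; congr EFin; rewrite (bigD1 j0)//= [in RHS](bigD1 j0)//=.
  rewrite /th' eqxx [LHS]mulrA; congr (_ * _).
    rewrite -/(b j0) bE eqxx -invfM -sqrtrM ?ltW//; congr (Num.sqrt _)^-1.
    by rewrite /k; field; rewrite -/k gt_eqF.
  apply: eq_bigr => j jj0; rewrite (negbTE jj0) bE eq_sym (negbTE jj0) add0r//.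
- by move: cA; rewrite (cardsD1 i0) i0A.
- move=> j; rewrite -/(b j) /th'; case: eqP => [->|/eqP jj0].
    have -> : 1 - 2 * (th j0 / k) * b j0 = (k - 2 * th j0 * b j0) / k.
      by rewrite mulrBl divff ?gt_eqF//; congr (_ - _); ring.
    by rewrite divr_gt0.
  by have := thA j; rewrite bE eq_sym (negbTE jj0) add0r.
Qed.

End iid_normal_mgf.

(** One factor of the moment generating function of a centred chi-square variable, with
    [x = 2 * th * b]. After squaring, the claim is [1 <= expR (x + x ^+ 2) * (1 - x)]. *)
Lemma expR_ge_quadratic {R : realType} (x : R) : `|x| <= 4^-1 ->
  (Num.sqrt (1 - x))^-1 * expR (- x / 2) <= expR (x ^+ 2 / 2).
Proof.
rewrite ler_norml => /andP[xl xr].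
have y1 : 1 + (x + x ^+ 2) <= expR (x + x ^+ 2) by exact: expR_ge1Dx.
have y2 : (1 + (x + x ^+ 2) / 2) ^+ 2 <= expR (x + x ^+ 2).
  have -> : x + x ^+ 2 = (x + x ^+ 2) / 2 + (x + x ^+ 2) / 2 by field.
  rewrite expRD -expr2 ler_sqr ?nnegrE ?expR_ge0//; last by nra.
  by rewrite -splitr expR_ge1Dx.
have x1 : 0 < 1 - x by lra.
have y3 : 1 <= expR (x + x ^+ 2) * (1 - x).
  (* [(1 + x + x ^+ 2) * (1 - x) = 1 - x ^+ 3] settles [x <= 0] only; for [x > 0] the sharper lower
     bound [y2] of the exponential compensates the cubic term. *)
  have [x0|x0] := leP x 0.
    apply: (@le_trans _ _ ((1 + (x + x ^+ 2)) * (1 - x))); first by nra.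
    by rewrite ler_pM2r.
  apply: (@le_trans _ _ ((1 + (x + x ^+ 2) / 2) ^+ 2 * (1 - x))); last by rewrite ler_pM2r.
  have : 0 <= x ^+ 2 * ((1 + x) ^+ 2 * (1 - x) - 4 * x).
    apply: mulr_ge0; first exact: sqr_ge0.
    by nra.
  by nra.
have s0 : 0 <= Num.sqrt (1 - x) * expR (x ^+ 2 / 2).
  by rewrite mulr_ge0 ?sqrtr_ge0 ?expR_ge0.
rewrite ler_pdivrMl ?sqrtr_gt0// -ler_sqr ?nnegrE ?expR_ge0//.
rewrite exprMn sqr_sqrtr; last exact: ltW.
have sqE (a : R) : expR (a / 2) ^+ 2 = expR a by rewrite expr2 -expRD -splitr.
rewrite !sqE -[leLHS]mul1r.
apply: (@le_trans _ _ (expR (x + x ^+ 2) * (1 - x) * expR (- x))).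
  by rewrite ler_pM2r ?expR_gt0.
by rewrite mulrAC -expRD addrAC subrr add0r mulrC.
Qed.

Section iid_normal_moments.
Context {d : measure_display} {T : measurableType d} {R : realType}.
Context {P : probability T R} {I : finType} {X : I -> T -> R}.
Hypothesis iidX : iid_normal P X.

Lemma measurable_expR_sum_sqr {J : finType} (Q : J -> pred I) (u : I -> R)
    (th : J -> R) :
  measurable_fun setT (fun w : T =>
    (expR (\sum_j th j * (\sum_(i | Q j i) u i * X i w) ^+ 2))%:E).
Proof.
apply/measurable_EFinP; apply: measurableT_comp => //.
apply: measurable_sum => j; apply: measurable_funM => //.
by apply: measurable_funX; exact: (measurable_lincomb iidX).
Qed.

(** The colour classes give [#|J|] independent centred Gaussians of common variance [b], and each
    contributes a factor [expR (x ^+ 2 / 2)] with [x = 2 * th * b]. *)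
Lemma iid_normal_exp_deviation {J : finType} (col : I -> J) (u : I -> R)
    (b th : R) : (forall j, \sum_(i | col i == j) u i ^+ 2 = b) ->
  `|2 * th * b| <= 4^-1 ->
  (\int[P]_w (expR (th * (\sum_j (\sum_(i | col i == j) u i * X i w) ^+ 2
       - #|J|%:R * b)))%:E <= (expR (2 * #|J|%:R * (th * b) ^+ 2))%:E)%E.
Proof.
move=> ub thb; pose k : R := expR (- th * (#|J|%:R * b)).
have lt1 : 2 * th * b < 1.
  by move: thb; rewrite ler_norml => /andP[_ h]; apply: le_lt_trans h _; lra.
have E w : expR (th * (\sum_j (\sum_(i | col i == j) u i * X i w) ^+ 2
       - #|J|%:R * b)) =
    k * expR (\sum_j th *
       (\sum_(i in finset.setT | col i == j) u i * X i w) ^+ 2).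
  rewrite -expRD; congr expR; rewrite mulrBr addrC mulNr; congr (_ + _).
  rewrite mulr_sumr; apply: eq_bigr => j _; congr (_ * _ ^+ 2).
  by apply: eq_bigl => i; rewrite inE.
under eq_integral do rewrite E EFinM.
have bE j : \sum_(i in finset.setT | col i == j) u i ^+ 2 = b.
  by rewrite -(ub j); apply: eq_bigl => i; rewrite inE.
rewrite ge0_integralZl//; last 2 first.
- exact: (measurable_expR_sum_sqr (fun j i => (i \in finset.setT) && (col i == j)) u (fun=> th)).
- by rewrite lee_fin expR_ge0.
rewrite (iid_normal_exp_sum_sqr iidX col u _ (fun=> th)); last first.
  by move=> j; rewrite bE subr_gt0.
rewrite -EFinM lee_fin.
under eq_bigr do rewrite bE.
rewrite prodr_const /k.
have -> : expR (- th * (#|J|%:R * b)) = expR (- (2 * th * b) / 2) ^+ #|J|.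
  by rewrite -expRM_natl; congr expR; field.
have -> : expR (2 * #|J|%:R * (th * b) ^+ 2) = expR ((2 * th * b) ^+ 2 / 2) ^+ #|J|.
  by rewrite -expRM_natl; congr expR; field.
rewrite cardT -cardE -exprMn lerXn2r ?nnegrE ?mulr_ge0 ?invr_ge0 ?sqrtr_ge0 ?expR_ge0//.
by rewrite mulrC expR_ge_quadratic.
Qed.

(** With [th = (4 * b)^-1], [x <= 4 * b * expR (th * x)], and the exponential has mean
    [Num.sqrt 2 <= 2]. Going through the exponential formula avoids computing covariances, at the
    price of the constant 8. *)
Lemma iid_normal_lincomb_sqr (u : I -> R) :
  (\int[P]_w ((\sum_i u i * X i w) ^+ 2)%:E <= (8 * \sum_i u i ^+ 2)%:E)%E.
Proof.
set b := \sum_i u i ^+ 2.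
have b0 : 0 <= b by apply: sumr_ge0 => i _; rewrite sqr_ge0.
have [bz|bN0] := eqVneq b 0.
  have u0 i : u i = 0.
    have /eqP := bz; rewrite psumr_eq0; last by move=> j _; rewrite sqr_ge0.
    by move=> /allP/(_ i (mem_index_enum _)); rewrite sqrf_eq0 => /eqP.
  under eq_integral => w _.
    rewrite big1 ?expr0n; last by move=> i _; rewrite u0 mul0r.
    over.
  by rewrite integral0 bz mulr0.
have {bN0}b0 : 0 < b by rewrite lt_neqAle eq_sym bN0.
pose th := (4 * b)^-1; have th0 : 0 < th by rewrite invr_gt0 mulr_gt0.
apply: (@le_trans _ _ (\int[P]_w ((4 * b)%:E * (expR (\sum_(j : unit) th *
    (\sum_(i in finset.setT | tt == j) u i * X i w) ^+ 2))%:E))%E).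
  apply: integral_monotone => w; rewrite -EFinM lee_fin.
  rewrite (bigD1 tt)//= big_pred0_eq addr0.
  rewrite -ler_pdivrMl ?mulr_gt0// -/th.
  have -> : \sum_(i in finset.setT | tt == tt) u i * X i w = \sum_i u i * X i w.
    by apply: eq_bigl => i; rewrite inE.
  apply: le_trans (expR_ge1Dx _); lra.
rewrite ge0_integralZl//; last 2 first.
- exact: (measurable_expR_sum_sqr (fun j i => (i \in finset.setT) && (tt == j)) u (fun=> th)).
- by rewrite lee_fin mulr_ge0// ltW.
have bE j : \sum_(i in finset.setT | tt == j) u i ^+ 2 = b.
  by case: j; apply: eq_bigl => i; rewrite inE.
have h : 1 - 2 * th * b = 2^-1.
  by rewrite /th; field; rewrite gt_eqF.
rewrite (iid_normal_exp_sum_sqr iidX (fun=> tt) u _ (fun=> th)); last first.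
  by move=> j; rewrite bE h.
rewrite -EFinM lee_fin; under eq_bigr do rewrite bE h.
rewrite (bigD1 tt)//= big_pred0_eq mulr1 sqrtrV// invrK.
have -> : 8 * b = 4 * b * 2 by ring.
rewrite ler_pM2l ?mulr_gt0//.
rewrite -(@ler_sqr _ (Num.sqrt 2) 2) ?nnegrE ?sqrtr_ge0// sqr_sqrtr//.
lra.
Qed.

End iid_normal_moments.

(** * A majorant of the squared logarithm with bounded Gaussian mean *)

Section inverse_log_weight.
Context {R : realType}.

(** The window has Gaussian mass at most [4^-1 ^+ k] wherever it is centred, so the height [2 ^+ k]
    leaves the summable mean [2^-1 ^+ k] and still outgrows [k ^+ 2]. *)
Definition log_weight_term (k : nat) (y : R) : \bar R :=
  (if `|y| <= 4^-1 ^+ k then 2 ^+ k else 0)%:E.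

(* A series of indicators that dominates [ln^2 |y|] for [|y| <= 1] and is
   infinite at [0]; unlike [ln^2] its Gaussian mean is elementary. *)
Definition log_weight (y : R) : \bar R := (\sum_(k <oo) log_weight_term k y)%E.

Lemma log_weight_term_ge0 k y : (0 <= log_weight_term k y)%E.
Proof. by rewrite lee_fin; case: ifP. Qed.

Lemma log_weight_ge0 y : (0 <= log_weight y)%E.
Proof. by apply: nneseries_ge0 => k _ _; exact: log_weight_term_ge0. Qed.

Lemma log_weight_term_le k y : (log_weight_term k y <= log_weight y)%E.
Proof.
rewrite /log_weight (nneseries_split 0 k.+1); last first.
  by move=> n _; exact: log_weight_term_ge0.
rewrite add0n big_nat_recr//= -addeA addeC -addeA leeDl// adde_ge0//.
  by apply: nneseries_ge0 => n _ _; exact: log_weight_term_ge0.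
by apply: sume_ge0 => n _; exact: log_weight_term_ge0.
Qed.

Lemma log_weight0 : log_weight 0 = +oo%E.
Proof.
apply/eqP; rewrite eq_le leey/= leNgt; apply/negP => lt.
have := log_weight_ge0 0; move: lt; case E : (log_weight 0) => [r| |]//= _ _.
have [k rk] : exists k, r < 2 ^+ k.
  exists (Num.truncn r).+1; have [r0|r0] := leP 0 r.
    apply: (lt_le_trans (truncnS_gt _)).
    by rewrite -natrX ler_nat; apply: ltnW; exact: ltn_expl.
  by apply: (lt_le_trans r0); rewrite exprn_ge0.
have := log_weight_term_le k 0; rewrite E /log_weight_term normr0.
by rewrite exprn_ge0// lee_fin leNgt rk.
Qed.

Lemma succn_sqr_le_exp2 k : (k.+1%:R ^+ 2 <= 3 * 2 ^+ k :> R).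
Proof.
have : (k.+1 ^ 2 <= 3 * 2 ^ k)%N.
  case: k => [|[|[|]]]// k; elim: k => // k IH.
  rewrite [(2 ^ k.+4)%N]expnS; move: IH; rewrite -!mulnn; set E := (2 ^ k.+3)%N; nia.
by rewrite -!natrX -natrM ler_nat.
Qed.

Lemma ln2_le1 : ln 2 <= 1 :> R.
Proof.
have h : (-1 : R) < 1 by lra.
by have := le_ln1Dx h; rewrite (_ : 1 + 1 = 2 :> R).
Qed.

Lemma ln_sqr_le_log_weight (y : R) : y != 0 -> `|y| <= 1 ->
  ((ln `|y| ^+ 2)%:E <= 12%:E * log_weight y)%E.
Proof.
move=> y0 y1; have yp : 0 < `|y| by rewrite normr_gt0.
set x := - ln `|y|; have x0 : 0 <= x by rewrite oppr_ge0 ln_le0.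
(* The single term of index [k] suffices: [2 * k <= x] and [ln 2 <= 1] give [|y| <= 4^-1 ^+ k],
   while [x < 2 * k.+1] gives [x ^+ 2 <= 12 * 2 ^+ k]. *)
pose k := Num.truncn (x / 2).
have /andP[kl ku] : k%:R <= x / 2 < k.+1%:R.
  by rewrite truncn_itv// divr_ge0.
apply: (@le_trans _ _ (12%:E * log_weight_term k y)%E); last first.
  by rewrite lee_pmul2l// ?lte_fin// log_weight_term_le.
rewrite /log_weight_term ifT.
  rewrite -EFinM lee_fin -sqrrN -/x.
  have : x ^+ 2 <= (2 * k.+1%:R) ^+ 2 by rewrite ler_sqr ?nnegrE; lra.
  by have := succn_sqr_le_exp2 k; rewrite exprMn; lra.
rewrite -ler_ln ?posrE ?exprn_gt0// lnXn//.
rewrite lnV ?posrE// (_ : 4 = 2 ^+ 2 :> R) ?lnXn//; last by rewrite -natrX.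
have := ln2_le1; have : 0 <= k%:R :> R by [].
rewrite -/x -[ln `|y|]opprK -/x -mulr_natl -(mulr_natr (ln 2)).
by nra.
Qed.

Lemma measurable_log_weight_term k : measurable_fun setT (log_weight_term k).
Proof.
apply/measurable_EFinP; apply: measurable_fun_ifT => //.
apply: (measurable_fun_bool true); rewrite setTI.
rewrite (_ : _ @^-1` _ = [set y : R | `|y| <= 4^-1 ^+ k])//.
rewrite (_ : [set y | _] = `[- 4^-1 ^+ k, 4^-1 ^+ k]%classic)//.
by apply/seteqP; split => y /=; rewrite in_itv/= ler_norml.
Qed.

Lemma measurable_log_weight : measurable_fun setT log_weight.
Proof.
apply: ge0_emeasurable_sum => k; first by move=> y _ _; exact: log_weight_term_ge0.
by move=> _; exact: measurable_log_weight_term.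
Qed.

Lemma normal_prob01_log_weight (t : R) :
  (\int[normal_prob 0 1]_z log_weight (z - t)%R <= 2%:E)%E.
Proof.
have mt : measurable_fun setT (fun z : R => z - t) by exact: measurable_funB.
rewrite integral_nneseries//.
- apply: (@le_trans _ _ (\sum_(k <oo) (2^-1 ^+ k)%:E)%E).
    apply: lee_nneseries => [k _ _|k _].
      by apply: integral_ge0 => z _; exact: log_weight_term_ge0.
    pose A := [set z : R | (`|z - t| <= 4^-1 ^+ k)%R].
    have mA : measurable A.
      rewrite (_ : A = `[t - 4^-1 ^+ k, t + 4^-1 ^+ k]%classic)//.
      by apply/seteqP; split => y; rewrite /A/= in_itv/= ler_distl.
    have -> : (\int[normal_prob 0 1]_z log_weight_term k (z - t)%R =
        \int[normal_prob 0 1]_z ((2 ^+ k)%:E * (\1_A z)%:E))%E.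
      apply: eq_integral => z _; rewrite /log_weight_term -EFinM; congr EFin.
      rewrite indicE; case: ifPn => h.
        by rewrite mem_set ?mulr1.
      by rewrite memNset ?mulr0//; exact/negP.
    rewrite ge0_integralZl//; last first.
      by apply/measurable_EFinP; apply: measurable_indic.
    rewrite integral_indic// setIT.
    apply: (@le_trans _ _ ((2 ^+ k)%:E * (4^-1 ^+ k)%:E)%E).
      rewrite lee_pmul2l ?lte_fin ?exprn_gt0//.
      by apply: normal_prob01_ball; rewrite exprn_ge0.
    rewrite -EFinM lee_fin -exprMn.
    by rewrite (_ : 2 * 4^-1 = 2^-1 :> R) //; lra.
  have /cvg_lim half : eseries (fun k => (2 / (2 ^ (k + 1))%:R)%:E : \bar R) @ \oo
      --> (2 / 2 ^+ 0)%:E by exact: cvg_geometric_eseries_half.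
  rewrite expr0 divr1 in half; rewrite -half//.
  under eq_eseriesr => k _.
    rewrite (_ : 2^-1 ^+ k = 2 / (2 ^ (k + 1))%:R); first over.
    by rewrite addn1 expnS natrM invfM mulrA divff// mul1r natrX exprVn.
  by [].
- by move=> k; exact: (measurableT_comp (measurable_log_weight_term k)).
- by move=> k z _; exact: log_weight_term_ge0.
Qed.

End inverse_log_weight.

(** * Distance of a 2x2 block to the rank-one blocks *)

Section cross_residual.
Context {R : realType}.

(** The Schur complement of [d] in the block with rows [(a, b)] and [(c, d)], that is, its
    determinant divided by [d]. It has slope one in [a], which transfers the bounded density of
    [a]. *)
Definition cross_residual (a b c d : R) : R := a - b * c / d.

(** The determinant of the rank-one block vanishes, so [a * d - b * c] is a sum of products of one
    error with one entry; these total at most [6 * e * |d|] because [d] dominates, and the division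
    by [d] leaves [6 * e]. *)
Lemma cross_residual_le_max (x1 x2 y1 y2 a b c d e : R) : 0 <= e ->
  `|a - x1 * y1| <= e -> `|b - x1 * y2| <= e ->
  `|c - x2 * y1| <= e -> `|d - x2 * y2| <= e ->
  `|a| <= `|d| -> `|b| <= `|d| -> `|c| <= `|d| ->
  `|cross_residual a b c d| <= 6 * e.
Proof.
move=> e0 ha hb hc hd ad bd cd; rewrite /cross_residual.
(* For [d = 0] the domination forces [a = 0], and [0^-1 = 0] makes the cross residual vanish. *)
have [d0|dN0] := eqVneq d 0.
  move: ad; rewrite d0 normr0 normr_le0 => /eqP ->.
  by rewrite invr0 mulr0 subr0 normr0 mulr_ge0.
have dp : 0 < `|d| by rewrite normr_gt0.
have -> : a - b * c / d = (a * d - b * c) / d by field.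
rewrite normrM normfV ler_pdivrMr//.
have [de|ed] := ltP `|d| e.
  apply: (le_trans (ler_normB _ _)); rewrite !normrM.
  have : `|a| * `|d| <= `|d| * `|d| by rewrite ler_wpM2r.
  have : `|b| * `|c| <= `|d| * `|d| by rewrite ler_pM.
  by nra.
(* Both groups equal a product of two entries minus [x1 * y1 * x2 * y2], and these common terms
   cancel. *)
have -> : a * d - b * c = a * (d - x2 * y2) + (a - x1 * y1) * (d - (d - x2 * y2))
    - (b * (c - x2 * y1) + (b - x1 * y2) * (c - (c - x2 * y1))) by ring.
move: (a - _) (b - _) (c - _) (d - _) ha hb hc hd => ea eb ec ed' ha hb hc hd.
have prod (u v : R) k : `|u| <= `|d| -> `|v| <= e -> `|u * v| <= `|d| * e.
  by move=> *; rewrite normrM ler_pM.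
have sub (u v : R) : `|u| <= `|d| -> `|v| <= e -> `|u - v| <= 2 * `|d|.
  by move=> hu hv; apply: (le_trans (ler_normB _ _)); lra.
have P1 : `|a * ed'| <= `|d| * e by exact: prod.
have P2 : `|ea * (d - ed')| <= e * (2 * `|d|) by rewrite normrM ler_pM// sub.
have P3 : `|b * ec| <= `|d| * e by exact: prod.
have P4 : `|eb * (c - ec)| <= e * (2 * `|d|) by rewrite normrM ler_pM// sub.
apply: (le_trans (ler_normB _ _)).
have := ler_normD (a * ed') (ea * (d - ed')).
have := ler_normD (b * ec) (eb * (c - ec)).
by lra.
Qed.

(* One of the four cross residuals of a 2x2 block is controlled by the distance
   of the block to any rank-one block: take the one whose denominator is the
   entry of largest modulus. *)
Lemma cross_residual_rank_one (x1 x2 y1 y2 a b c d : R) :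
  let s := (a - x1 * y1) ^+ 2 + (b - x1 * y2) ^+ 2
           + (c - x2 * y1) ^+ 2 + (d - x2 * y2) ^+ 2 in
  [\/ cross_residual a b c d ^+ 2 <= 36 * s,
      cross_residual b a d c ^+ 2 <= 36 * s,
      cross_residual c d a b ^+ 2 <= 36 * s |
      cross_residual d c b a ^+ 2 <= 36 * s].
Proof.
move=> s; pose e := Num.sqrt s.
have s0 : 0 <= s by rewrite !addr_ge0 ?sqr_ge0.
have e0 : 0 <= e by exact: sqrtr_ge0.
have es : e ^+ 2 = s by rewrite sqr_sqrtr.
have sqle (u : R) : u ^+ 2 <= s -> `|u| <= e.
  by move=> us; rewrite -(@ler_pXn2r _ 2) ?nnegrE// es real_normK ?num_real.
have q1 := sqr_ge0 (a - x1 * y1); have q2 := sqr_ge0 (b - x1 * y2).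
have q3 := sqr_ge0 (c - x2 * y1); have q4 := sqr_ge0 (d - x2 * y2).
have h1 : `|a - x1 * y1| <= e by apply: sqle; rewrite /s; lra.
have h2 : `|b - x1 * y2| <= e by apply: sqle; rewrite /s; lra.
have h3 : `|c - x2 * y1| <= e by apply: sqle; rewrite /s; lra.
have h4 : `|d - x2 * y2| <= e by apply: sqle; rewrite /s; lra.
have fin (u : R) : `|u| <= 6 * e -> u ^+ 2 <= 36 * s.
  move=> ue; rewrite -es (_ : 36 * e ^+ 2 = (6 * e) ^+ 2); last by ring.
  by rewrite -real_normK ?num_real// ler_sqr ?nnegrE ?mulr_ge0.
have [ab|/ltW ab] := leP `|a| `|b|; have [cd|/ltW cd] := leP `|c| `|d|.
- have [bd|/ltW bd] := leP `|b| `|d|.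
    constructor 1; apply: fin; apply: (@cross_residual_le_max x1 x2 y1 y2) => //.
    exact: le_trans ab bd.
  constructor 3; apply: fin; apply: (@cross_residual_le_max x2 x1 y1 y2) => //.
  exact: le_trans cd bd.
- have [bc|/ltW bc] := leP `|b| `|c|.
    constructor 2; apply: fin; apply: (@cross_residual_le_max x1 x2 y2 y1) => //.
    exact: le_trans ab bc.
  constructor 3; apply: fin; apply: (@cross_residual_le_max x2 x1 y1 y2) => //.
  exact: le_trans cd bc.
- have [da|/ltW da] := leP `|d| `|a|.
    constructor 4; apply: fin; apply: (@cross_residual_le_max x2 x1 y2 y1) => //.
    exact: le_trans cd da.
  constructor 1; apply: fin; apply: (@cross_residual_le_max x1 x2 y1 y2) => //.
  exact: le_trans ab da.
- have [ca|/ltW ca] := leP `|c| `|a|.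
    constructor 4; apply: fin; apply: (@cross_residual_le_max x2 x1 y2 y1) => //.
    exact: le_trans cd ca.
  constructor 2; apply: fin; apply: (@cross_residual_le_max x1 x2 y2 y1) => //.
  exact: le_trans ab ca.
Qed.

(** Which entry is largest depends on the noise, and conditioning on it would destroy independence;
    summing over the four choices covers every case. *)
Definition block_weight (a b c d : R) : \bar R :=
  (log_weight (cross_residual a b c d) + log_weight (cross_residual b a d c)
   + log_weight (cross_residual c d a b) + log_weight (cross_residual d c b a))%E.

Lemma block_weight_ge0 a b c d : (0 <= block_weight a b c d)%E.
Proof. by rewrite !adde_ge0 ?log_weight_ge0. Qed.

Lemma ln36_le6 : ln 36 <= 6 :> R.
Proof.
apply: (@le_trans _ _ (ln (2 ^+ 6))).
  by rewrite ler_ln ?posrE ?exprn_gt0//; rewrite -natrX ler_nat.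
by rewrite lnXn// -[ln 2 *+ 6]mulr_natr; have := @ln2_le1 R; lra.
Qed.

(** From [- ln s <= 6 - 2 * ln |u|] follows [ln s ^+ 2 <= 72 + 8 * ln |u| ^+ 2] when [|u| <= 1], and
    [96 = 8 * 12]. When [|u| > 1] the constant alone suffices. *)
Lemma ln_sqr_le_sum (s u : R) : 0 < s <= 1 -> u != 0 -> u ^+ 2 <= 36 * s ->
  ((ln s ^+ 2)%:E <= 72%:E + 96%:E * log_weight u)%E.
Proof.
move=> /andP[s0 s1] u0 us; have up : 0 < `|u| by rewrite normr_gt0.
have L1 : 2 * ln `|u| <= ln 36 + ln s.
  rewrite -lnM ?posrE// mulr_natl -lnXn// ler_ln ?posrE ?exprn_gt0 ?mulr_gt0//.
  by rewrite real_normK ?num_real.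
have ls : ln s <= 0 by rewrite ln_le0.
have l36 := ln36_le6.
have [u1|/ltW u1] := leP `|u| 1.
  apply: (@le_trans _ _ (72%:E + (8 * ln `|u| ^+ 2)%:E)%E).
    rewrite -EFinD lee_fin; have lu : ln `|u| <= 0 by rewrite ln_le0.
    have : (- ln s) ^+ 2 <= (6 - 2 * ln `|u|) ^+ 2.
      by rewrite ler_sqr ?nnegrE; lra.
    have := sqr_ge0 (2 * ln `|u| + 6); nra.
  rewrite leeD2l// EFinM (_ : 96 = 8 * 12 :> R); last by lra.
  rewrite [(8 * 12)%:E]EFinM -muleA lee_pmul2l ?lte_fin//.
  exact: ln_sqr_le_log_weight.
apply: (@le_trans _ _ 72%:E).
  rewrite lee_fin; have lu : 0 <= ln `|u| by rewrite ln_ge0.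
  nra.
by rewrite leeDl// mule_ge0 ?log_weight_ge0// lee_fin.
Qed.

Lemma ln_sqr_le_block_weight (x1 x2 y1 y2 a b c d s : R) :
  (a - x1 * y1) ^+ 2 + (b - x1 * y2) ^+ 2
           + (c - x2 * y1) ^+ 2 + (d - x2 * y2) ^+ 2 = s -> 0 < s <= 1 ->
  ((ln s ^+ 2)%:E <= 72%:E + 96%:E * block_weight a b c d)%E.
Proof.
move=> sE s01.
have H (u : R) : u ^+ 2 <= 36 * s -> (log_weight u <= block_weight a b c d)%E ->
    ((ln s ^+ 2)%:E <= 72%:E + 96%:E * block_weight a b c d)%E.
  move=> us ug; have [u0|u0] := eqVneq u 0.
    move: ug; rewrite u0 log_weight0 leye_eq => /eqP ->.
    by rewrite gt0_muley ?lte_fin// addey// leey.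
  apply: (le_trans (ln_sqr_le_sum _ _ s01 u0 us)).
  by rewrite leeD2l// lee_pmul2l ?lte_fin.
have := @cross_residual_rank_one x1 x2 y1 y2 a b c d; rewrite /= sE.
have g1 := log_weight_ge0 (cross_residual a b c d).
have g2 := log_weight_ge0 (cross_residual b a d c).
have g3 := log_weight_ge0 (cross_residual c d a b).
have g4 := log_weight_ge0 (cross_residual d c b a).
case=> /H; apply; rewrite /block_weight.
- by rewrite -!addeA leeDl// !adde_ge0.
- by rewrite [X in (_ <= X + _ + _)%E]addeC -!addeA leeDl// !adde_ge0.
- by rewrite [X in (_ <= X + _)%E]addeC -!addeA leeDl// !adde_ge0.
- by rewrite addeC leeDl// !adde_ge0.
Qed.

Lemma block_weight_pinfty (x1 x2 y1 y2 a b c d : R) :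
  a = x1 * y1 -> b = x1 * y2 -> c = x2 * y1 -> d = x2 * y2 ->
  block_weight a b c d = +oo%E.
Proof.
move=> ea eb ec ed.
have := @cross_residual_rank_one x1 x2 y1 y2 a b c d; rewrite /=.
rewrite -ea -eb -ec -ed !subrr expr0n/= !addr0 mulr0.
have z (u : R) : u ^+ 2 <= 0 -> log_weight u = +oo%E.
  move=> u2; have -> : u = 0.
    by apply/eqP; rewrite -sqrf_eq0 eq_le u2 sqr_ge0.
  exact: log_weight0.
have nN (x : \bar R) : (0 <= x -> x != -oo)%E.
  by move=> x0; rewrite gt_eqF// (lt_le_trans _ x0).
have g0 := @log_weight_ge0 R.
rewrite /block_weight; case=> /z ->.
- by rewrite !addye// nN.
- by rewrite addey ?nN// !addye// nN.
- by rewrite addey ?nN ?adde_ge0// addye// nN.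
- by rewrite addey ?nN ?adde_ge0.
Qed.

End cross_residual.

(** * A dimension-free bound for the squared logarithm of the residual *)

Section rank_one_weight.
Context {R : realType}.

(** By Jensen [- ln V] is at most [ln 4] plus the mean [a] of [- ln (m j)]. Then
    [(2 + a) ^+ 2 <= 8 + 2 * a ^+ 2], and [a ^+ 2] is at most the mean of the squares. The bound
    [m j <= 1] makes every [- ln (m j)] nonnegative. *)
Lemma ln_sqr_mean (J : finType) (m : J -> R) (V : R) : (0 < #|J|)%N ->
  (forall j, 0 < m j <= 1) -> \sum_j m j <= 4 * #|J|%:R * V -> V <= 1 ->
  ln V ^+ 2 <= 8 + 2 / #|J|%:R * \sum_j ln (m j) ^+ 2.
Proof.
move=> J0 m01 mV V1; set n := #|J|%:R : R.
have n0 : 0 < n by rewrite ltr0n.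
have sc (c : R) : \sum_(j : J) c = n * c by rewrite sumr_const cardT -cardE mulr_natl.
have [j0 _] : exists j : J, true by case/card_gt0P: J0 => j _; exists j.
have s0 : 0 < \sum_j m j.
  rewrite (bigD1 j0)//= ltr_pwDl//; first by case/andP: (m01 j0).
  by apply: sumr_ge0 => j _; case/andP: (m01 j) => /ltW.
pose mu := (\sum_j m j) / n; have mu0 : 0 < mu by rewrite divr_gt0.
pose a := (\sum_j - ln (m j)) / n.
have lm j : 0 <= - ln (m j) by rewrite oppr_ge0 ln_le0//; case/andP: (m01 j).
have a0 : 0 <= a by rewrite divr_ge0 ?sumr_ge0// ltW.
have V0 : 0 < V.
  have : 0 < 4 * n * V := lt_le_trans s0 mV.
  by rewrite pmulr_rgt0// mulr_gt0.
(* Jensen in elementary form: [ln x <= x - 1] at [x = m j / mu], summed over [j]. *)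
have jensen : - a <= ln mu.
  rewrite -subr_ge0 opprK -(@pmulr_rge0 _ n)// mulrDr /a [n * (_ / n)]mulrC divfK ?gt_eqF//.
  rewrite -sc -big_split/=.
  apply: (@le_trans _ _ (\sum_j (1 - m j / mu))).
    rewrite big_split/= sc sumrN -mulr_suml mulr1 /mu invf_div mulrC divfK ?gt_eqF//.
    by rewrite subrr.
  apply: ler_sum => j _; case/andP: (m01 j) => mj _.
  have h : -1 < m j / mu - 1 by rewrite ltrBrDr addNr divr_gt0.
  have := le_ln1Dx h; rewrite [1 + _]addrC subrK ln_div ?posrE//; lra.
have lnV : - ln V <= 2 + a.
  have : mu <= 4 * V by rewrite /mu ler_pdivrMr// mulrAC.
  move=> muV; have : ln mu <= ln 4 + ln V.
    by rewrite -lnM ?posrE// ler_ln ?posrE// mulr_gt0.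
  have : ln 4 <= 2 :> R.
    rewrite (_ : 4 = 2 ^+ 2 :> R); last by rewrite -natrX.
    by rewrite lnXn// -[ln 2 *+ 2]mulr_natr; have := @ln2_le1 R; lra.
  by lra.
have lV : 0 <= - ln V by rewrite oppr_ge0 ln_le0.
have cs : n * a ^+ 2 <= \sum_j ln (m j) ^+ 2.
  rewrite -subr_ge0.
  have -> : \sum_j ln (m j) ^+ 2 - n * a ^+ 2 = \sum_j (- ln (m j) - a) ^+ 2.
    have -> : \sum_j (- ln (m j) - a) ^+ 2 =
        \sum_j (ln (m j) ^+ 2 + (- (2 * a) * - ln (m j) + a ^+ 2)).
      by apply: eq_bigr => j _; ring.
    rewrite !big_split/= sc -mulr_sumr.
    have -> : \sum_j - ln (m j) = n * a by rewrite /a mulrC divfK ?gt_eqF.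
    by ring.
  by apply: sumr_ge0 => j _; exact: sqr_ge0.
have cs' : a ^+ 2 <= n^-1 * \sum_j ln (m j) ^+ 2.
  by rewrite ler_pdivlMl.
rewrite -mulrA.
have : ln V ^+ 2 <= (2 + a) ^+ 2 by rewrite -sqrrN ler_sqr ?nnegrE; lra.
have := sqr_ge0 (2 - a); nra.
Qed.

(** The blocks wrap around cyclically through [ordS], so that every entry is covered equally often
    and no boundary correction arises. It is an average of block weights, hence its mean does not
    grow with the matrix. *)
Definition rank_one_weight {p q : nat} (Y : 'I_p -> 'I_q -> R) : \bar R :=
  (8%:E + (2 / (p * q)%:R)%:E * \sum_(k : 'I_p * 'I_q)
     (72%:E + 96%:E * block_weight (Y k.1 k.2) (Y k.1 (ordS k.2))
       (Y (ordS k.1) k.2) (Y (ordS k.1) (ordS k.2))))%E.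

Section rank_one.
Context {p q : nat} (p0 : (0 < p)%N) (q0 : (0 < q)%N).
Context (Y : 'I_p -> 'I_q -> R) (x : 'I_p -> R) (y : 'I_q -> R).

Let e (k : 'I_p * 'I_q) := (Y k.1 k.2 - x k.1 * y k.2) ^+ 2.
Let n : R := (p * q)%:R.
Let n0 : 0 < n. Proof. by rewrite ltr0n muln_gt0 p0. Qed.
Let e0 k : 0 <= e k. Proof. exact: sqr_ge0. Qed.
Let rho k := e k + e (k.1, ordS k.2) + e (ordS k.1, k.2) + e (ordS k.1, ordS k.2).

(** Each of the three shifts is a bijection of the index set, so every entry is counted four
    times. *)
Let sum_rho : \sum_k rho k = 4 * \sum_k e k.
Proof.
have sh1 (f : 'I_p * 'I_q -> R) : \sum_k f (k.1, ordS k.2) = \sum_k f k.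
  rewrite [RHS](reindex (fun k => (k.1, ordS k.2)))//=; apply: onW_bij.
  by exists (fun k => (k.1, ord_pred k.2)) => -[r c] /=; rewrite ?ordSK ?ord_predK.
have sh2 (f : 'I_p * 'I_q -> R) : \sum_k f (ordS k.1, k.2) = \sum_k f k.
  rewrite [RHS](reindex (fun k => (ordS k.1, k.2)))//=; apply: onW_bij.
  by exists (fun k => (ord_pred k.1, k.2)) => -[r c] /=; rewrite ?ordSK ?ord_predK.
rewrite /rho !big_split/= sh1 sh2 (sh1 (fun k => e (ordS k.1, k.2))) sh2.
have -> : \sum_(i | true) e i = \sum_k e k by [].
by ring.
Qed.

Let weight_pinfty k : rho k = 0 -> rank_one_weight Y = +oo%E.
Proof.
move=> rk; rewrite /rank_one_weight.
have [h1 h2 h3 h4] : [/\ e k = 0, e (k.1, ordS k.2) = 0,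
    e (ordS k.1, k.2) = 0 & e (ordS k.1, ordS k.2) = 0].
  move: rk; rewrite /rho; have := e0 k; have := e0 (k.1, ordS k.2).
  have := e0 (ordS k.1, k.2); have := e0 (ordS k.1, ordS k.2).
  by move=> ? ? ? ? ?; split; lra.
have z (u v : R) : (u - v) ^+ 2 = 0 -> u = v.
  by move/eqP; rewrite sqrf_eq0 subr_eq0 => /eqP.
rewrite (bigD1 k)//=.
rewrite (block_weight_pinfty _ _ _ _ _ _ _ _ (z _ _ h1) (z _ _ h2) (z _ _ h3) (z _ _ h4)).
rewrite gt0_muley ?lte_fin// addey// addye; last first.
  rewrite gt_eqF// (lt_le_trans ltNy0)// sume_ge0// => i _.
  by rewrite adde_ge0 ?mule_ge0 ?block_weight_ge0// lee_fin.
by rewrite gt0_muley ?lte_fin ?divr_gt0// addey.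
Qed.

Lemma rank_one_weight_pinfty : \sum_k e k = 0 -> rank_one_weight Y = +oo%E.
Proof.
move=> s0; apply: (weight_pinfty (Ordinal p0, Ordinal q0)).
have : \sum_k rho k = 0 by rewrite sum_rho s0 mulr0.
move/eqP; rewrite psumr_eq0; last by move=> k _; rewrite !addr_ge0.
by move=> /allP/(_ _ (mem_index_enum (Ordinal p0, Ordinal q0)))/eqP.
Qed.

(** The majorant does not involve [x] and [y], so the bound survives a fitted matrix that depends on
    the data in a non-measurable way. Block distances are truncated at 1 to meet the hypothesis of
    [ln_sqr_mean]. *)
Lemma ln_sqr_le_rank_one_weight : n^-1 * \sum_k e k <= 1 ->
  ((ln (n^-1 * \sum_k e k) ^+ 2)%:E <= rank_one_weight Y)%E.
Proof.
move=> V1.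
have [k rk0|rN0] := pickP (fun k => rho k == 0).
  by rewrite (weight_pinfty k (eqP rk0)) leey.
have r0 k : 0 < rho k.
  by rewrite lt_neqAle eq_sym rN0 !addr_ge0.
pose m k := Num.min 1 (rho k).
have m01 k : 0 < m k <= 1 by rewrite lt_min ltr01 r0 ge_min lexx.
have cJ : #|{: 'I_p * 'I_q}| = (p * q)%N by rewrite card_prod !card_ord.
have mV : \sum_k m k <= 4 * #|{: 'I_p * 'I_q}|%:R * (n^-1 * \sum_k e k).
  rewrite cJ -/n -mulrA [n * _]mulrA mulfV ?gt_eqF// mul1r -sum_rho.
  by apply: ler_sum => k _; rewrite ge_min lexx orbT.
have J0 : (0 < #|{: 'I_p * 'I_q}|)%N by rewrite cJ muln_gt0 p0.
have := ln_sqr_mean _ m _ J0 m01 mV V1; rewrite cJ -/n -lee_fin => /le_trans; apply.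
rewrite EFinD EFinM leeD2l// lee_pmul2l ?lte_fin ?divr_gt0//.
rewrite -sumEFin; apply: lee_sum => k _.
have [r1|r1] := leP 1 (rho k).
  by rewrite /m min_l// ln1 expr0n/= adde_ge0 ?mule_ge0 ?block_weight_ge0.
rewrite /m min_r; last exact: ltW.
apply: (ln_sqr_le_block_weight (x k.1) (x (ordS k.1)) (y k.2) (y (ordS k.2))).
  by [].
by rewrite r0 ltW.
Qed.

End rank_one.

Lemma ge0_le_integralD {d} {T : measurableType d} {P : {measure set T -> \bar R}}
    (f g : T -> \bar R) (a b : \bar R) :
  measurable_fun setT f -> measurable_fun setT g ->
  (forall w, 0 <= f w)%E -> (forall w, 0 <= g w)%E ->
  (\int[P]_w f w <= a -> \int[P]_w g w <= b ->
   \int[P]_w (f w + g w) <= a + b)%E.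
Proof. by move=> mf mg f0 g0 fa gb; rewrite ge0_integralD//; exact: leeD. Qed.

Section rank_one_weight_mean.
Context {d : measure_display} {T : measurableType d} {P : probability T R}.

(** The inverse of [x] is [x] times the power [-1] of [x ^+ 2]; the base is nonnegative, so
    measurability of [powR] applies, and at [0] both sides vanish. *)
Lemma measurable_funV {d'} {S : measurableType d'} (f : S -> R) :
  measurable_fun setT f -> measurable_fun setT (fun x => (f x)^-1).
Proof.
move=> mf; have -> : (fun x => (f x)^-1) = (fun x => f x * (f x ^+ 2) `^ (-1)).
  apply/funext => x; rewrite powR_inv1 ?sqr_ge0//.
  have [->|f0] := eqVneq (f x) 0; first by rewrite invr0 mul0r.
  by rewrite expr2 invfM mulrA divff ?mul1r.
apply: measurable_funM => //.
apply: (measurableT_comp (@measurable_powR R (-1))).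
exact: measurable_funX.
Qed.

Lemma iid_normal_log_weight {I : finType} {X : I -> T -> R} (i : I) (t : T -> R) :
  iid_normal P X ->
  measurable_fun setT (t : g_sigma_algebraType (cylinders_off X i) -> R) ->
  (\int[P]_w log_weight (X i w - t w)%R <= 2%:E)%E.
Proof.
move=> iidX mt.
pose h (x : measurableTypeR R * g_sigma_algebraType (cylinders_off X i)) :=
  log_weight (x.1 - t x.2)%R.
have mh : measurable_fun setT h.
  apply: (measurableT_comp measurable_log_weight).
  apply: measurable_funB; first exact: measurable_fst.
  exact: (measurableT_comp mt measurable_snd).
rewrite (iid_normal_resample P X iidX i h mh); last first.
  by move=> x; exact: log_weight_ge0.
apply: (@le_trans _ _ (\int[P]_w 2%:E)%E).
  apply: integral_monotone => w; rewrite /h/=.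
  exact: (normal_prob01_log_weight (t w)).
by rewrite integral_cst// [X in (_ * X)%E](probability_setT P) mule1.
Qed.

Lemma measurable_log_weight_comp (f : T -> R) :
  measurable_fun setT f -> measurable_fun setT (fun w => log_weight (f w)).
Proof. by move=> mf; exact: (measurableT_comp measurable_log_weight). Qed.

Lemma ordS_neq p (r : 'I_p) : (1 < p)%N -> ordS r != r.
Proof.
move=> p1; apply/eqP => /(congr1 val)/=.
have := ltn_ord r; rewrite leq_eqVlt => /predU1P[rp|rp].
  by rewrite rp modnn => r0; move: rp p1; rewrite -r0 => <-.
by rewrite modn_small// => /eqP; rewrite gtn_eqF.
Qed.

Section noisy_matrix.
Context {p q : nat} (p1 : (1 < p)%N) (q1 : (1 < q)%N).
Context {X : 'I_p * 'I_q -> T -> R} (iidX : iid_normal P X).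
Variable M : 'I_p -> 'I_q -> R.

Let Y r c w := M r c + X (r, c) w.

Let mY r c : measurable_fun setT (Y r c).
Proof. by apply: measurable_funD => //; exact: iidX.1. Qed.

Lemma measurable_cross_residual r c r' c' : measurable_fun setT
  (fun w => cross_residual (Y r c w) (Y r c' w) (Y r' c w) (Y r' c' w)).
Proof.
apply: measurable_funB => //; apply: measurable_funM; first exact: measurable_funM.
exact: measurable_funV.
Qed.

(** The noise at [(r, c)] enters with slope one and is independent of [t], which collects the other
    three entries and the mean at [(r, c)]. The bound is therefore uniform in [M]. *)
Lemma mean_log_weight_cross_residual r c r' c' : r' != r -> c' != c ->
  (\int[P]_w log_weight (cross_residual (Y r c w) (Y r c' w) (Y r' c w) (Y r' c' w))
   <= 2%:E)%E.
Proof.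
move=> rr cc.
pose S := g_sigma_algebraType (cylinders_off X (r, c)).
have mo a b : (a, b) != (r, c) -> measurable_fun setT (Y a b : S -> R).
  move=> h; apply: measurable_funD => //; exact: (measurable_off X (r, c) (a, b) h).
pose t w := Y r c' w * Y r' c w / Y r' c' w - M r c.
have mt : measurable_fun setT (t : S -> R).
  apply: measurable_funB => //; apply: measurable_funM; first apply: measurable_funM.
  - by apply: mo; rewrite xpair_eqE (negbTE cc) andbF.
  - by apply: mo; rewrite xpair_eqE (negbTE rr).
  - by apply: measurable_funV; apply: mo; rewrite xpair_eqE (negbTE rr).
apply: le_trans (iid_normal_log_weight (r, c) t iidX mt).
apply: integral_monotone => w; rewrite /cross_residual /t opprB addrA.
by rewrite [X (r, c) w + _]addrC.
Qed.

Let block k w := block_weight (Y k.1 k.2 w) (Y k.1 (ordS k.2) w)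
       (Y (ordS k.1) k.2 w) (Y (ordS k.1) (ordS k.2) w).

Let mblock k : measurable_fun setT (block k).
Proof.
have mc r c r' c' := measurable_log_weight_comp _ (measurable_cross_residual r c r' c').
apply: emeasurable_funD; last exact: mc.
by apply: emeasurable_funD; [apply: emeasurable_funD|]; exact: mc.
Qed.

Let mean_block k : (\int[P]_w block k w <= 8%:E)%E.
Proof.
have mc r c r' c' := measurable_log_weight_comp _ (measurable_cross_residual r c r' c').
have h1 := ordS_neq p k.1 p1; have h2 := ordS_neq q k.2 q1.
have g0 := @log_weight_ge0 R.
rewrite (_ : 8 = 2 + 2 + 2 + 2 :> R); last by lra.
rewrite !EFinD /block /block_weight.
have ml r c r' c' : r' != r -> c' != c -> (\int[P]_w log_weight
    (cross_residual (Y r c w) (Y r c' w) (Y r' c w) (Y r' c' w)) <= 2%:E)%E.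
  exact: mean_log_weight_cross_residual.
apply: ge0_le_integralD => [||w|w||].
- by apply: emeasurable_funD; [apply: emeasurable_funD|]; exact: mc.
- exact: mc.
- by rewrite !adde_ge0.
- by [].
- apply: ge0_le_integralD => [||w|w||].
  + by apply: emeasurable_funD; exact: mc.
  + exact: mc.
  + by rewrite !adde_ge0.
  + by [].
  + apply: ge0_le_integralD => [||w|w||]; [exact: mc|exact: mc|by []|by []| |];
      by apply: ml; rewrite // eq_sym.
  + by apply: ml; rewrite // eq_sym.
- by apply: ml; rewrite // eq_sym.
Qed.

Lemma measurable_rank_one_weight :
  measurable_fun setT (fun w => rank_one_weight (fun r c => Y r c w)).
Proof.
apply: emeasurable_funD => //; apply: emeasurable_funM => //.
apply: emeasurable_sum => k; apply: emeasurable_funD => //.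
by apply: emeasurable_funM => //; exact: mblock.
Qed.

(** A block weight has mean at most [4 * 2], so each summand has mean at most [840 = 72 + 96 * 8],
    and [1688 = 8 + 2 * 840]. *)
Lemma mean_rank_one_weight :
  (\int[P]_w rank_one_weight (fun r c => Y r c w) <= 1688%:E)%E.
Proof.
have p0 : (0 < p)%N by exact: ltnW. have q0 : (0 < q)%N by exact: ltnW.
have cst (c : R) : (\int[P]_w c%:E = c%:E)%E.
  by rewrite integral_cst// [X in (_ * X)%E](probability_setT P) mule1.
have b0 k w : (0 <= 72%:E + 96%:E * block k w)%E.
  by rewrite adde_ge0// mule_ge0 ?block_weight_ge0.
have m1 k : measurable_fun setT (fun w => 72%:E + 96%:E * block k w)%E.
  by apply: emeasurable_funD => //; apply: emeasurable_funM => //; exact: mblock.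
have n0 : 0 < (p * q)%:R :> R by rewrite ltr0n muln_gt0 p0.
have c0 : (0 <= (2 / (p * q)%:R : R)%:E)%E by rewrite lee_fin divr_ge0// ltW.
have mS : measurable_fun setT (fun w => \sum_k (72%:E + 96%:E * block k w))%E.
  exact: emeasurable_sum.
rewrite /rank_one_weight ge0_integralD//; last 2 first.
- by move=> w _; rewrite mule_ge0// sume_ge0// => k _; exact: b0.
- by apply: emeasurable_funM.
rewrite cst ge0_integralZl//; last by move=> w _; rewrite sume_ge0// => k _; exact: b0.
rewrite ge0_integral_sum//; last by move=> k w _; exact: b0.
apply: (@le_trans _ _ (8%:E + (2 / (p * q)%:R)%:E * \sum_(k : 'I_p * 'I_q) 840%:E))%E.
  rewrite leeD2l// lee_wpmul2l// lee_sum// => k _.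
  rewrite ge0_integralD//; last 2 first.
  - by move=> w _; rewrite mule_ge0 ?block_weight_ge0.
  - by apply: emeasurable_funM => //; exact: mblock.
  rewrite cst ge0_integralZl//; last 2 first.
  - exact: mblock.
  - by move=> w _; exact: block_weight_ge0.
  have -> : (840%:E = 72%:E + 96%:E * 8%:E :> \bar R)%E.
    by rewrite -EFinM -EFinD; congr EFin; lra.
  rewrite leeD2l// lee_pmul2l ?lte_fin//; exact: mean_block.
rewrite sumEFin -EFinM -EFinD lee_fin sumr_const cardT -cardE card_prod !card_ord.
rewrite -[840 *+ _]mulr_natr.
have -> : 2 / (p * q)%:R * (840 * (p * q)%:R) = 1680 :> R.
  by rewrite mulrCA divfK ?gt_eqF//; lra.
by lra.
Qed.

End noisy_matrix.
End rank_one_weight_mean.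
End rank_one_weight.

(** * From a net to the whole sphere for a quadratic form *)

Section operator_norm_net.
Context {R : realType}.

Lemma cauchy_schwarz {I : finType} (a b : I -> R) :
  (\sum_i a i * b i) ^+ 2 <= (\sum_i a i ^+ 2) * (\sum_i b i ^+ 2).
Proof.
set A := \sum_i a i ^+ 2; set B := \sum_i b i ^+ 2; set C := \sum_i a i * b i.
have A0 : 0 <= A by apply: sumr_ge0 => i _; exact: sqr_ge0.
have [Az|AN0] := eqVneq A 0.
  have az i : a i = 0.
    have /eqP := Az; rewrite psumr_eq0; last by move=> j _; exact: sqr_ge0.
    by move=> /allP/(_ i (mem_index_enum _)); rewrite sqrf_eq0 => /eqP.
  by rewrite Az mul0r /C big1 ?expr0n// => i _; rewrite az mul0r.
have Ap : 0 < A by rewrite lt_neqAle eq_sym AN0.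
have : 0 <= \sum_i (A * b i - C * a i) ^+ 2 by apply: sumr_ge0 => i _; exact: sqr_ge0.
have -> : \sum_i (A * b i - C * a i) ^+ 2 = A * (A * B - C ^+ 2).
  transitivity (\sum_i (A ^+ 2 * b i ^+ 2 + (- (2 * A * C) * (a i * b i) + C ^+ 2 * a i ^+ 2))).
    by apply: eq_bigr => i _; ring.
  by rewrite !big_split/= -!mulr_sumr -/A -/B -/C; ring.
by rewrite pmulr_rge0// subr_ge0.
Qed.

Context {p q : nat}.
Implicit Types (x : 'I_p -> 'I_q -> R) (u v : 'I_p -> R).

(** The quadratic form of [x x' - q I]; its mean is zero when the entries of [x] are independent
    standard normals. *)
Definition gram_deviation x u : R :=
  \sum_c (\sum_r u r * x r c) ^+ 2 - q%:R * \sum_r u r ^+ 2.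

(** Polarization of the bilinear form at [(u - v, u + v)]. The weights 4 and 1/4 make the two new
    vectors have total squared norm [32 |u - v|^2 + |u + v|^2 / 8], at most 1 when [|u - v| <= 1/8]
    and [|u|, |v| <= 1]. *)
Lemma gram_deviation_polarize x u v :
  gram_deviation x u - gram_deviation x v =
  (gram_deviation x (fun r => 4 * (u r - v r) + (u r + v r) / 4)
   - gram_deviation x (fun r => 4 * (u r - v r) - (u r + v r) / 4)) / 4.
Proof.
set a := (fun r => _ + _); set b := (fun r => _ - _).
have lin c (f : 'I_p -> R) (s t : R) :
    (forall r, f r = s * u r + t * v r) ->
    \sum_r f r * x r c = s * (\sum_r u r * x r c) + t * (\sum_r v r * x r c).
  move=> fE; rewrite !mulr_sumr -big_split; apply: eq_bigr => r _.
  by rewrite fE /=; ring.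
have S1 : \sum_c (\sum_r u r * x r c) ^+ 2 - \sum_c (\sum_r v r * x r c) ^+ 2 =
    (\sum_c (\sum_r a r * x r c) ^+ 2 - \sum_c (\sum_r b r * x r c) ^+ 2) / 4.
  rewrite -!sumrB mulr_suml; apply: eq_bigr => c _.
  rewrite (lin c a (4 + 4^-1) (4^-1 - 4)); last by move=> r; rewrite /a; field.
  rewrite (lin c b (4 - 4^-1) (- 4 - 4^-1)); last by move=> r; rewrite /b; field.
  by field.
have S2 : \sum_r u r ^+ 2 - \sum_r v r ^+ 2 =
    (\sum_r a r ^+ 2 - \sum_r b r ^+ 2) / 4.
  by rewrite -!sumrB mulr_suml; apply: eq_bigr => r _; rewrite /a /b; field.
rewrite /gram_deviation.
transitivity ((\sum_c (\sum_r u r * x r c) ^+ 2 - \sum_c (\sum_r v r * x r c) ^+ 2)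
   - q%:R * (\sum_r u r ^+ 2 - \sum_r v r ^+ 2)); first by ring.
by rewrite S1 S2; ring.
Qed.

Lemma gram_deviationZ x (k : R) u :
  gram_deviation x (fun r => k * u r) = k ^+ 2 * gram_deviation x u.
Proof.
rewrite /gram_deviation mulrBr; congr (_ - _).
  rewrite mulr_sumr; apply: eq_bigr => c _; rewrite -exprMn; congr (_ ^+ 2).
  by rewrite mulr_sumr; apply: eq_bigr => r _; rewrite mulrA.
rewrite mulrCA; congr (_ * _); rewrite mulr_sumr; apply: eq_bigr => r _.
by rewrite exprMn.
Qed.

Lemma gram_deviation_bounded x : exists t : R, forall u,
  \sum_r u r ^+ 2 = 1 -> `|gram_deviation x u| <= t.
Proof.
exists (\sum_c \sum_r x r c ^+ 2 + q%:R) => u u1.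
rewrite /gram_deviation u1 mulr1; apply: (le_trans (ler_normB _ _)).
rewrite lerD//; last by rewrite ger0_norm.
rewrite ger0_norm; last by apply: sumr_ge0 => c _; exact: sqr_ge0.
apply: ler_sum => c _; apply: (le_trans (cauchy_schwarz _ _)).
by rewrite u1 mul1r.
Qed.

(** The supremum [s] over the sphere satisfies [s <= M + s / 4]; since [s] is finite by the crude
    bound of [gram_deviation_bounded], it can be absorbed, and [4 / 3 * M <= 2 * M]. *)
Lemma gram_deviation_net x (M : R) :
  (forall u, \sum_r u r ^+ 2 = 1 -> exists v : 'I_p -> R,
     [/\ \sum_r (u r - v r) ^+ 2 <= 64^-1, \sum_r v r ^+ 2 <= 1
       & `|gram_deviation x v| <= M]) ->
  forall u, \sum_r u r ^+ 2 = 1 -> `|gram_deviation x u| <= 2 * M.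
Proof.
move=> net.
pose S := [set t : R | exists2 u, \sum_r u r ^+ 2 = 1 & t = `|gram_deviation x u|].
have [t0 ht0] := gram_deviation_bounded x.
have ubS : has_ubound S by exists t0 => _ [u u1 ->]; exact: ht0.
pose s := sup S.
have sub u : \sum_r u r ^+ 2 = 1 -> `|gram_deviation x u| <= s.
  by move=> u1; apply: ub_le_sup => //; exists u.
have hom u : `|gram_deviation x u| <= s * \sum_r u r ^+ 2.
  have N0 : 0 <= \sum_r u r ^+ 2 by apply: sumr_ge0 => r _; exact: sqr_ge0.
  have [Nz|Np] := eqVneq (\sum_r u r ^+ 2) 0.
    have uz : u = fun r => 0 * u r.
      apply/funext => r; have /eqP := Nz.
      rewrite psumr_eq0; last by move=> j _; exact: sqr_ge0.
      move=> /allP/(_ r (mem_index_enum _)).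
      by rewrite sqrf_eq0 => /eqP ->; rewrite mul0r.
    by rewrite Nz mulr0 uz gram_deviationZ expr0n mul0r normr0.
  set n := \sum_r u r ^+ 2 in N0 Np *.
  have {}Np : 0 < n by rewrite lt_neqAle eq_sym Np.
  have sn0 : 0 < Num.sqrt n by rewrite sqrtr_gt0.
  have E : gram_deviation x u = n * gram_deviation x (fun r => (Num.sqrt n)^-1 * u r).
    by rewrite gram_deviationZ exprVn sqr_sqrtr// mulrA mulfV ?mul1r ?gt_eqF.
  rewrite E normrM gtr0_norm// mulrC ler_pM2r//; apply: sub.
  under eq_bigr do rewrite exprMn.
  by rewrite -mulr_sumr exprVn sqr_sqrtr// mulVf ?gt_eqF.
have step u : \sum_r u r ^+ 2 = 1 -> `|gram_deviation x u| <= M + s / 4.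
  move=> u1; have [v [uv v1 vM]] := net u u1.
  have uvs : \sum_r (u r + v r) ^+ 2 <= 4.
    have : \sum_r (u r + v r) ^+ 2 <= \sum_r (2 * u r ^+ 2 + 2 * v r ^+ 2).
      by apply: ler_sum => r _; have := sqr_ge0 (u r - v r); nra.
    by rewrite big_split/= -!mulr_sumr u1; lra.
  have s0 : 0 <= s by apply: le_trans (sub u u1).
  have := gram_deviation_polarize x u v.
  set a := (fun r => _ + _); set b := (fun r => _ - _) => pol.
  have := hom a; have := hom b.
  have ab : \sum_r a r ^+ 2 + \sum_r b r ^+ 2 <= 1.
    have -> : \sum_r a r ^+ 2 + \sum_r b r ^+ 2 =
      32 * \sum_r (u r - v r) ^+ 2 + 8^-1 * \sum_r (u r + v r) ^+ 2.
      rewrite -big_split !mulr_sumr -big_split; apply: eq_bigr => r _.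
      by rewrite /a /b/=; field.
    lra.
  move: pol vM; rewrite !ler_norml => pol /andP[v1' v2'] /andP[b1 b2] /andP[a1 a2].
  have : s * (\sum_r a r ^+ 2 + \sum_r b r ^+ 2) <= s by rewrite ler_piMr.
  by rewrite mulrDr => sab; apply/andP; split; lra.
move=> u u1.
have : s <= M + s / 4.
  apply: ge_sup; first by exists `|gram_deviation x u|, u.
  by move=> _ [v v1 ->]; exact: step.
have := sub u u1; have := step u u1.
have [v [_ _ /(le_trans (normr_ge0 _)) M0]] := net u u1.
by lra.
Qed.

End operator_norm_net.

(** * An explicit grid in the unit ball and its cardinality *)

Section net_count.
Context {R : realType}.

Lemma sum_half_pow (n : nat) : \sum_(k < n) 2^-1 ^+ k <= 2 :> R.
Proof.
suff : \sum_(k < n) 2^-1 ^+ k = 2 - 2 * 2^-1 ^+ n :> R.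
  by move=> ->; rewrite gerBl mulr_ge0// exprn_ge0.
elim: n => [|n IHn]; first by rewrite big_ord0 expr0; lra.
by rewrite big_ord_recr /= IHn exprS; lra.
Qed.

(** Exponential weighting: each counted [f] has [2 ^+ s * \prod_i 2^-1 ^+ f i >= 1], and the sum of
    these weights over all [f] factors into [p] geometric sums, each at most 2. *)
Lemma card_bounded_sum (p s n : nat) :
  (#|[pred f : {ffun 'I_p -> 'I_n} | (\sum_i f i <= s)%N]| <= 2 ^ (s + p))%N.
Proof.
rewrite -(@ler_nat R) natrX -sum1_card natr_sum.
apply: (@le_trans _ _ (\sum_(f : {ffun 'I_p -> 'I_n}) 2 ^+ s * \prod_i 2^-1 ^+ f i)).
  rewrite big_mkcond; apply: ler_sum => f _; case: ifPn => fs; last first.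
    by rewrite mulr_ge0 ?exprn_ge0// prodr_ge0// => i _; rewrite exprn_ge0.
  rewrite prodrXr -(@ler_pM2r _ (2 ^+ \sum_i f i)) ?exprn_gt0// mul1r.
  by rewrite -mulrA -exprMn mulVf// expr1n mulr1 ler_weXn2l// ler1n.
rewrite -mulr_sumr exprD ler_pM2l ?exprn_gt0//.
rewrite -(bigA_distr_bigA (fun (i : 'I_p) (j : 'I_n) => (2^-1 : R) ^+ j)) /=.
rewrite -[X in _ <= _ ^+ X]card_ord -prodr_const.
by apply: ler_prod => i _; rewrite sum_half_pow andbT sumr_ge0.
Qed.

End net_count.

Section grid.
Context {R : realType} {p : nat}.

Let N := (8 * p).+1.
Let index := ({ffun 'I_p -> 'I_N} * {ffun 'I_p -> bool})%type.

Definition grid_point (g : index) (r : 'I_p) : R :=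
  (-1) ^+ (g.2 r) * (g.1 r)%:R / (8 * Num.sqrt p%:R).

(** A unit vector has l1-norm at most [Num.sqrt p], so its integer coordinates at mesh
    [1 / (8 * Num.sqrt p)] sum to at most [8 * p]. This constraint is what makes the count
    exponential in [p], without a [ln p] in the exponent. *)
Definition grid_index (g : index) : bool :=
  (\sum_r g.1 r <= 8 * p)%N && (\sum_r grid_point g r ^+ 2 <= 1).

Lemma card_grid_index : (#|grid_index| <= 2 ^ (10 * p))%N.
Proof.
apply: (@leq_trans #|[predX [pred f : {ffun 'I_p -> 'I_N} | (\sum_i f i <= 8 * p)%N]
    & predT : pred {ffun 'I_p -> bool}]|).
  by apply: subset_leq_card; apply/fintype.subsetP => -[f s]; rewrite !inE/= => /andP[->].
rewrite cardX card_ffun card_bool card_ord.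
apply: (@leq_trans (2 ^ (8 * p + p) * 2 ^ p)).
  by rewrite leq_mul2r (@card_bounded_sum R) orbT.
by rewrite -expnD leq_exp2l//; lia.
Qed.

(** Moduli are rounded down and signs kept: no coordinate grows, so the norm stays at most 1, and
    [p] squared errors of at most [1 / (64 * p)] add up to [1 / 64]. *)
Lemma grid_approx (u : 'I_p -> R) : \sum_r u r ^+ 2 = 1 ->
  exists2 g, grid_index g & \sum_r (u r - grid_point g r) ^+ 2 <= 64^-1.
Proof.
move=> u1.
have p0 : (0 < p)%N.
  by case: p u u1 => // u; rewrite big_ord0 => /esym/eqP; rewrite oner_eq0.
have pp : 0 < p%:R :> R by rewrite ltr0n.
set h : R := 8 * Num.sqrt p%:R.
have h0 : 0 < h by rewrite mulr_gt0// sqrtr_gt0.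
have h2 : h ^+ 2 = 64 * p%:R by rewrite exprMn sqr_sqrtr ?ltW//; lra.
pose n r := Num.truncn (h * `|u r|).
have nle r : (n r)%:R <= h * `|u r| by rewrite truncn_le// mulr_ge0// ltW.
have nlt r : h * `|u r| < (n r).+1%:R by exact: truncnS_gt.
have sumu : \sum_r `|u r| <= Num.sqrt p%:R.
  rewrite -(@ler_pXn2r _ 2) ?nnegrE ?sqrtr_ge0 ?sumr_ge0// sqr_sqrtr ?(ltW pp)//.
  have := cauchy_schwarz (fun r => `|u r|) (fun=> 1).
  have -> : \sum_r `|u r| ^+ 2 = 1.
    by rewrite -u1; apply: eq_bigr => r _; rewrite real_normK ?num_real.
  rewrite mul1r expr1n sumr_const card_ord; under eq_bigr do rewrite mulr1.
  by [].
have sumn : (\sum_r n r <= 8 * p)%N.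
  rewrite -(@ler_nat R) natr_sum natrM.
  apply: (@le_trans _ _ (h * Num.sqrt p%:R)).
    apply: (@le_trans _ _ (\sum_r h * `|u r|)); first exact: ler_sum.
    by rewrite -mulr_sumr ler_pM2l.
  by rewrite /h -mulrA -expr2 sqr_sqrtr// ltW.
have nN r : (n r < N)%N.
  by rewrite ltnS (leq_trans _ sumn)// (bigD1 r)//= leq_addr.
pose g : index := ([ffun r => Ordinal (nN r)], [ffun r => u r < 0]).
have gE r : grid_point g r = (-1) ^+ (u r < 0)%R * ((n r)%:R / h).
  by rewrite /grid_point !ffunE/= mulrA.
have uE r : u r = (-1) ^+ (u r < 0)%R * `|u r| by rewrite mulr_sign_norm.
have sg (b : bool) : ((-1) ^+ b) ^+ 2 = 1 :> R by rewrite sqrr_sign.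
have nh r : (n r)%:R / h <= `|u r| by rewrite ler_pdivrMr// mulrC.
have nh0 r : 0 <= (n r)%:R / h by rewrite divr_ge0// ltW.
exists g; last first.
  apply: (@le_trans _ _ (\sum_(r : 'I_p) (h ^+ 2)^-1)).
    apply: ler_sum => r _; rewrite gE {1}uE -mulrBr exprMn sg mul1r -exprVn.
    rewrite ler_sqr ?nnegrE ?subr_ge0// ?invr_ge0 ?(ltW h0)//.
    rewrite lerBlDr -[X in X + _]mul1r -mulrDl ler_pdivlMr// mulrC.
    by have := nlt r; rewrite -natr1 => /ltW; lra.
  by rewrite sumr_const card_ord h2 -[_ *+ p]mulr_natr invfM mulfVK ?gt_eqF.
apply/andP; split.
  by rewrite (eq_bigr n)// => r _; rewrite ffunE.
rewrite -u1; apply: ler_sum => r _; rewrite gE exprMn sg mul1r.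
by rewrite -[leRHS]real_normK ?num_real// ler_sqr ?nnegrE.
Qed.

End grid.

(** * Uniform deviation of the Gram form in mean square *)

Section operator_deviation.
Context {d : measure_display} {T : measurableType d} {R : realType}.
Context {P : probability T R} {p q : nat} {X : 'I_p * 'I_q -> T -> R}.
Hypothesis iidX : iid_normal P X.

Lemma sum_column {V : zmodType} (F : 'I_p * 'I_q -> V) (c : 'I_q) :
  \sum_(i | i.2 == c) F i = \sum_r F (r, c).
Proof.
rewrite (eq_bigr (fun i => F (i.1, i.2))); last by case.
rewrite -(pair_big predT (fun j => j == c) (fun r j => F (r, j)))/=.
by apply: eq_bigr => r _; rewrite big_pred1_eq.
Qed.

Local Notation dev v w := (gram_deviation (fun r c => X (r, c) w) v).

Lemma measurable_gram_deviation (v : 'I_p -> R) :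
  measurable_fun setT (fun w => dev v w).
Proof.
apply: measurable_funB => //; apply: measurable_sum => c.
apply: measurable_funX; apply: measurable_sum => r.
by apply: measurable_funM => //; exact: iidX.1.
Qed.

Lemma mean_exp_gram_deviation (v : 'I_p -> R) (th : R) :
  `|2 * th * \sum_r v r ^+ 2| <= 4^-1 ->
  (\int[P]_w (expR (th * dev v w))%:E
   <= (expR (2 * q%:R * (th * \sum_r v r ^+ 2) ^+ 2))%:E)%E.
Proof.
set b := \sum_r v r ^+ 2 => thb.
have := @iid_normal_exp_deviation _ _ _ _ _ _ iidX _ snd (fun i => v i.1) b th.
rewrite card_ord => /(_ _ thb) H.
apply: le_trans (H _); last by move=> c; rewrite (sum_column (fun i => v i.1 ^+ 2)).
apply: integral_monotone => w; rewrite lee_fin /gram_deviation -/b.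
have -> : \sum_c (\sum_r v r * X (r, c) w) ^+ 2 =
    \sum_c (\sum_(i | i.2 == c) v i.1 * X i w) ^+ 2.
  by apply: eq_bigr => c _; rewrite (sum_column (fun i => v i.1 * X i w)).
exact: lexx.
Qed.

(** With [x = S * expR (- a)], [ln S = a + ln x <= a + 2 * Num.sqrt x]. Hence a bound [expR a] on
    the mean of [S] gives a bound [2 * a ^+ 2 + 8] on the mean of [ln S ^+ 2], without integrating
    tails. *)
Lemma ln_sqr_le_shift (a S : R) : 0 <= a -> 1 <= S ->
  ln S ^+ 2 <= 2 * a ^+ 2 + 8 * (S * expR (- a)).
Proof.
move=> a0 S1; have S0 : 0 < S by lra.
set x := S * expR (- a); have x0 : 0 < x by rewrite mulr_gt0 ?expR_gt0.
have lnx : ln S = a + ln x.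
  by rewrite /x lnM ?posrE ?expR_gt0// expRK; ring.
have lnsq : ln x = 2 * ln (Num.sqrt x).
  by rewrite -{1}(sqr_sqrtr (ltW x0)) lnXn ?sqrtr_gt0// mulr_natl.
have sx0 : 0 < Num.sqrt x by rewrite sqrtr_gt0.
have le : ln (Num.sqrt x) <= Num.sqrt x.
  have h : -1 < Num.sqrt x - 1 by lra.
  by have := le_ln1Dx h; rewrite [1 + _]addrC subrK; lra.
have lS : 0 <= ln S by rewrite ln_ge0.
rewrite -(sqr_sqrtr (ltW x0)).
have : ln S ^+ 2 <= (a + 2 * Num.sqrt x) ^+ 2 by rewrite ler_sqr ?nnegrE; lra.
by have := sqr_ge0 (a - 2 * Num.sqrt x); nra.
Qed.

Hypotheses (p0 : (0 < p)%N) (pq : (p <= q)%N).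
(** Chosen so that the exponent [2 * q * th ^+ 2 = p / 32] is of the order of the entropy of the
    grid; [p <= q] keeps [th] at most [8^-1], inside the range of the moment generating function
    bound. *)
Let th : R := Num.sqrt (p%:R / q%:R) / 8.
Let pp : 0 < p%:R :> R. Proof. by rewrite ltr0n. Qed.
Let qp : 0 < q%:R :> R. Proof. by rewrite ltr0n (leq_trans p0). Qed.
Let th0 : 0 < th. Proof. by rewrite divr_gt0 ?sqrtr_gt0// divr_gt0. Qed.
Let th2 : th ^+ 2 = p%:R / q%:R / 64.
Proof. by rewrite exprMn sqr_sqrtr ?divr_ge0// exprVn; congr (_ / _); lra. Qed.
Let th8 : th <= 8^-1.
Proof.
rewrite -ler_sqr ?nnegrE ?(ltW th0)// th2.
have : p%:R / q%:R <= 1 :> R by rewrite ler_pdivrMr// mul1r ler_nat.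
by lra.
Qed.

(** A soft maximum: [ln (S w) / th] dominates [|dev|] at every grid point, while the mean of [S] is
    computable term by term. *)
Let S w : R := \sum_(g | @grid_index R p g)
  (expR (th * dev (grid_point g) w) + expR ((- th) * dev (grid_point g) w)).

Let mexp (t : R) v : measurable_fun setT (fun w => expR (t * dev v w)).
Proof.
apply: measurableT_comp => //; apply: measurable_funM => //.
exact: measurable_gram_deviation.
Qed.

Let mS : measurable_fun setT S.
Proof.
rewrite /S; under eq_fun do rewrite big_mkcond.
apply: measurable_sum => g; case: (grid_index g) => //.
by apply: measurable_funD; exact: mexp.
Qed.

(** At most [2 ^ (10 * p)] grid points contribute [2 * expR (p / 32)] each, and
    [(10 * p + 1) * ln 2 + p / 32 <= 12 * p]. *)
Let mean_S : (\int[P]_w (S w)%:E <= (expR (12 * p%:R))%:E)%E.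
Proof.
under eq_integral do rewrite -sumEFin big_mkcond /=.
rewrite ge0_integral_sum//; last 2 first.
- move=> g; case: (grid_index g) => //; apply/measurable_EFinP.
  by apply: measurable_funD; exact: mexp.
- by move=> g w _; case: ifP => // _; rewrite lee_fin addr_ge0 ?expR_ge0.
apply: (@le_trans _ _ (\sum_(g | @grid_index R p g) (2 * expR (p%:R / 32))%:E)%E).
  rewrite [leRHS]big_mkcond/=; apply: lee_sum => g _; case: ifP => [gi|_]; last first.
    by rewrite integral0.
  have b1 : \sum_r grid_point g r ^+ 2 <= 1 :> R by case/andP: gi.
  have b0 : 0 <= \sum_r grid_point g r ^+ 2 :> R.
    by apply: sumr_ge0 => r _; exact: sqr_ge0.
  have half (t : R) : `|t| = th ->
    (\int[P]_w (expR (t * dev (grid_point g) w))%:E <= (expR (p%:R / 32))%:E)%E.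
    move=> tth; apply: (le_trans (mean_exp_gram_deviation _ _ _)).
      by rewrite !normrM tth (ger0_norm b0) ger0_norm//; have := th0; have := th8; nra.
    rewrite lee_fin ler_expR exprMn -(real_normK (num_real t)) tth th2.
    apply: (@le_trans _ _ (2 * q%:R * (p%:R / q%:R / 64) * 1)); last first.
      by rewrite le_eqVlt; apply/orP; left; apply/eqP; field; rewrite gt_eqF.
    rewrite [leLHS]mulrA ler_pM2l ?expr_le1//.
    by rewrite !mulr_gt0// invr_gt0.
  under eq_integral do rewrite EFinD.
  rewrite ge0_integralD//; last 2 first.
  - by apply/measurable_EFinP; exact: mexp.
  - by apply/measurable_EFinP; exact: mexp.
  rewrite mulrDl mul1r EFinD; apply: leeD; apply: half.
    by rewrite gtr0_norm.
  by rewrite normrN gtr0_norm.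
rewrite sumEFin lee_fin sumr_const.
apply: (@le_trans _ _ (2 ^+ (10 * p) * (2 * expR (p%:R / 32)))).
  rewrite -[leLHS]mulr_natl ler_pM2r ?mulr_gt0 ?expR_gt0//.
  by rewrite -natrX ler_nat card_grid_index.
have e2 n : 2 ^+ n = expR (n%:R * ln 2) :> R.
  by rewrite expRM_natl lnK ?posrE.
rewrite mulrA -exprSr e2 -expRD ler_expR -natr1 natrM.
have p1 : 1 <= p%:R :> R by rewrite ler1n.
have := ln2_le1 (R := R).
by nra.
Qed.

(** The zero vector belongs to the grid and has zero deviation. The bound makes [ln (S w)]
    nonnegative. *)
Let S_ge1 w : 1 <= S w.
Proof.
pose g : {ffun 'I_p -> 'I_(8 * p).+1} * {ffun 'I_p -> bool} :=
  ([ffun=> ord0], [ffun=> false]).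
have g0 : grid_point g = fun=> 0 :> R.
  by apply/funext => r; rewrite /grid_point !ffunE mulr0 mul0r.
have gi : @grid_index R p g.
  rewrite /grid_index g0 big1 ?leq0n; last by move=> r _; rewrite ffunE.
  by rewrite big1 ?ler01// => r _; rewrite expr0n.
have d0 : dev (fun=> 0) w = 0.
  rewrite /gram_deviation !big1 ?mulr0 ?subrr//.
    by move=> r _; rewrite expr0n.
  by move=> c _; rewrite big1 ?expr0n// => r _; rewrite mul0r.
rewrite /S (bigD1 g)//= g0 d0 !mulr0 expR0 -addrA ler_wpDr// addr_ge0//.
by apply: sumr_ge0 => i _; rewrite addr_ge0 ?expR_ge0.
Qed.

Let dev_le_S w (u : 'I_p -> R) : \sum_r u r ^+ 2 = 1 ->
  `|dev u w| <= 2 * (ln (S w) / th).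
Proof.
apply: gram_deviation_net => {}u /grid_approx[g gi ug]; exists (grid_point g).
split=> //; first by case/andP: gi.
have bound (t : R) : t = th \/ t = - th -> t * dev (grid_point g) w <= ln (S w).
  move=> tE; rewrite -ler_expR lnK ?posrE; last exact: lt_le_trans (S_ge1 w).
  rewrite /S (bigD1 g)//= ler_wpDr//.
    by apply: sumr_ge0 => i _; rewrite addr_ge0 ?expR_ge0.
  by case: tE => ->; [rewrite lerDl|rewrite lerDr]; rewrite expR_ge0.
rewrite ler_pdivlMr// -[X in _ * X](gtr0_norm th0) -normrM ler_norml mulrC.
have := bound th (or_introl erefl); have := bound (- th) (or_intror erefl).
by rewrite mulNr => h1 h2; apply/andP; split; lra.
Qed.

(** [H] is a measurable substitute for the squared supremum over the sphere. With [a = 12 * p] the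
    shifted bound has mean at most [2 * a ^+ 2 + 8 <= 296 * p ^+ 2], and the prefactor
    [4 / (th * n) ^+ 2] with [th ^+ 2 = p / q / 64] supplies 256. *)
Lemma gram_deviation_dominated : exists H : T -> R,
  [/\ measurable_fun setT H, forall w, 0 <= H w,
      (\int[P]_w (H w)%:E <= (256 * 296 / (p * q)%:R)%:E)%E &
      forall w u, \sum_r u r ^+ 2 = 1 -> (dev u w / (p * q)%:R) ^+ 2 <= H w].
Proof.
set n : R := (p * q)%:R; have n0 : 0 < n by rewrite ltr0n muln_gt0 p0 (leq_trans p0).
have nE : n = p%:R * q%:R by rewrite /n natrM.
pose k : R := 4 / (th * n) ^+ 2; have k0 : 0 < k by rewrite divr_gt0// exprn_gt0// mulr_gt0.
pose a : R := 12 * p%:R; have a0 : 0 <= a by rewrite mulr_ge0.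
have p1 : 1 <= p%:R :> R by rewrite ler1n.
exists (fun w => k * (2 * a ^+ 2 + 8 * (S w * expR (- a)))); split.
- apply: measurable_funM => //; apply: measurable_funD => //.
  by do 2 apply: measurable_funM => //.
- move=> w; have := S_ge1 w; have := expR_gt0 (- a) => e0 s1.
  rewrite mulr_ge0 ?(ltW k0)// addr_ge0// ?mulr_ge0 ?sqr_ge0//; lra.
- under eq_integral do rewrite EFinM EFinD.
  rewrite ge0_integralZl//; last 3 first.
  - apply: emeasurable_funD => //; apply/measurable_EFinP.
    by do 2 apply: measurable_funM => //.
  - move=> w _; rewrite -EFinD lee_fin addr_ge0 ?mulr_ge0 ?sqr_ge0 ?expR_ge0//.
    exact: le_trans (S_ge1 w).
  - by rewrite lee_fin ltW.
  rewrite ge0_integralD//; last 3 first.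
  - by move=> w _; rewrite lee_fin mulr_ge0 ?sqr_ge0.
  - move=> w _; rewrite lee_fin !mulr_ge0 ?expR_ge0//.
    exact: le_trans (S_ge1 w).
  - apply/measurable_EFinP.
    by do 2 apply: measurable_funM => //.
  rewrite integral_cst// [X in (_ * (_ * X + _))%E](probability_setT P) mule1.
  under eq_integral do rewrite mulrCA EFinM.
  rewrite ge0_integralZr//; last 2 first.
  - by apply/measurable_EFinP.
  - by move=> w _; rewrite lee_fin (le_trans _ (S_ge1 w)).
  apply: (@le_trans _ _ (k%:E * ((2 * a ^+ 2)%:E + (expR a)%:E * (8 * expR (- a))%:E)))%E.
    rewrite lee_pmul2l ?lte_fin// leeD2l// lee_wpmul2r// ?lee_fin ?mulr_ge0 ?expR_ge0//.
  rewrite -(EFinM (expR a)) -EFinD -EFinM lee_fin.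
  rewrite (mulrCA (expR a)) -expRD subrr expR0 mulr1.
  apply: (@le_trans _ _ (k * (296 * p%:R ^+ 2))).
    by rewrite ler_pM2l// /a; nra.
  rewrite /k exprMn th2 nE le_eqVlt; apply/orP; left; apply/eqP.
  by field; rewrite !gt_eqF.
- move=> w u u1; have := dev_le_S w u u1; set D := dev u w => DS.
  apply: (@le_trans _ _ (k * ln (S w) ^+ 2)); last first.
    by rewrite ler_pM2l// ln_sqr_le_shift.
  have -> : k * ln (S w) ^+ 2 = (2 * (ln (S w) / th) / n) ^+ 2.
    by rewrite /k; field; rewrite !gt_eqF.
  rewrite !exprMn ler_pM2r ?exprn_gt0 ?invr_gt0//.
  rewrite -(real_normK (num_real D)) -exprMn -exprMn ler_sqr ?nnegrE//.
  exact: le_trans DS.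
Qed.

End operator_deviation.

(** * Algebra of the rank-one residual *)

Section rank_one_residual.
Context {R : realType} {p q : nat}.
Implicit Types (k x z : 'I_p -> 'I_q -> R) (u : 'I_p -> R) (v : 'I_q -> R).

Definition bilinear z u v : R := \sum_r \sum_c u r * z r c * v c.

(** For unit [u] and [v], [bilinear z u v] is the scale that minimises the distance; at a leading
    singular pair it is the spectral norm. *)
Definition rank_one_residual z u v : R :=
  \sum_r \sum_c (z r c - bilinear z u v * u r * v c) ^+ 2.

Definition projection_sqr z u : R := \sum_c (\sum_r u r * z r c) ^+ 2.

Lemma bilinearE z u v : bilinear z u v = \sum_c (\sum_r u r * z r c) * v c.
Proof.
rewrite /bilinear exchange_big; apply: eq_bigr => c _; rewrite mulr_suml.
by apply: eq_bigr.
Qed.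

Lemma rank_one_distance z u v (l : R) :
  \sum_r u r ^+ 2 = 1 -> \sum_c v c ^+ 2 = 1 ->
  \sum_r \sum_c (z r c - l * u r * v c) ^+ 2 =
  \sum_r \sum_c z r c ^+ 2 - 2 * l * bilinear z u v + l ^+ 2.
Proof.
move=> u1 v1.
transitivity (\sum_r \sum_c (z r c ^+ 2 + (- (2 * l)) * (u r * z r c * v c)
   + l ^+ 2 * (u r ^+ 2 * v c ^+ 2))).
  by apply: eq_bigr => r _; apply: eq_bigr => c _; ring.
under eq_bigr do rewrite !big_split/= -!mulr_sumr v1 mulr1.
by rewrite !big_split/= -!mulr_sumr u1 mulr1 mulNr.
Qed.

Lemma rank_one_residualE z u v :
  \sum_r u r ^+ 2 = 1 -> \sum_c v c ^+ 2 = 1 ->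
  rank_one_residual z u v = \sum_r \sum_c z r c ^+ 2 - bilinear z u v ^+ 2.
Proof.
by move=> u1 v1; rewrite /rank_one_residual rank_one_distance//; ring.
Qed.

Lemma bilinear_sqr_le z u v : \sum_c v c ^+ 2 = 1 ->
  bilinear z u v ^+ 2 <= projection_sqr z u.
Proof.
by move=> v1; rewrite bilinearE -[leRHS]mulr1 -v1; exact: cauchy_schwarz.
Qed.

(** The left side is the squared value at [u] of the quadratic form of the matrix [k x'], and the
    right side is the squared Frobenius norm of that matrix, which no longer depends on [u]. *)
Lemma cross_projection_le k x u : \sum_r u r ^+ 2 = 1 ->
  (\sum_c (\sum_r u r * k r c) * (\sum_r u r * x r c)) ^+ 2 <=
  \sum_(i : 'I_p * 'I_p) (\sum_c k i.1 c * x i.2 c) ^+ 2.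
Proof.
move=> u1.
have -> : \sum_c (\sum_r u r * k r c) * (\sum_r u r * x r c) =
    \sum_(i : 'I_p * 'I_p) (u i.1 * u i.2) * (\sum_c k i.1 c * x i.2 c).
  under [RHS]eq_bigr do rewrite mulr_sumr.
  rewrite exchange_big/=; apply: eq_bigr => c _.
  rewrite mulr_suml -(pair_bigA _ (fun r r' => u r * u r' * (k r c * x r' c)))/=.
  apply: eq_bigr => r _; rewrite mulr_sumr; apply: eq_bigr => r' _; ring.
apply: (le_trans (cauchy_schwarz _ _)).
rewrite -(pair_bigA _ (fun r r' => (u r * u r') ^+ 2))/=.
under eq_bigr do under eq_bigr do rewrite exprMn.
under eq_bigr do rewrite -mulr_sumr u1 mulr1.
by rewrite u1 mul1r.
Qed.

(* [x] is the noise on the scale of unit variance. *)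
Lemma rank_one_residual_ge k x (s phi2 : R) u v : (0 < p)%N -> (0 < q)%N ->
  \sum_r \sum_c k r c ^+ 2 = 1 ->
  \sum_r u r ^+ 2 = 1 -> \sum_c v c ^+ 2 = 1 -> projection_sqr k u <= phi2 ->
  let n : R := (p * q)%:R in
  let z r c := s * k r c + x r c / Num.sqrt n in
  exists2 xi,
    1 - p%:R^-1 + s ^+ 2 * (1 - phi2) - xi <=
      rank_one_residual z u v &
    xi ^+ 2 <= 4 * (((\sum_r \sum_c x r c ^+ 2 - n) / n) ^+ 2
      + 4 * s ^+ 2 / n * (\sum_r \sum_c k r c * x r c) ^+ 2
      + 4 * s ^+ 2 / n * (\sum_(i : 'I_p * 'I_p) (\sum_c k i.1 c * x i.2 c) ^+ 2)
      + (gram_deviation x u / n) ^+ 2).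
Proof.
move=> p0 q0 k1 u1 v1 ku n z.
have pp : 0 < p%:R :> R by rewrite ltr0n.
have qp : 0 < q%:R :> R by rewrite ltr0n.
have nE : n = p%:R * q%:R by rewrite /n natrM.
have n0 : 0 < n by rewrite nE mulr_gt0.
set h := Num.sqrt n in z *; have h0 : 0 < h by rewrite sqrtr_gt0.
have h2 : h ^+ 2 = n by rewrite sqr_sqrtr// ltW.
set S := \sum_r \sum_c x r c ^+ 2; set K := \sum_r \sum_c k r c * x r c.
set W := \sum_(i : 'I_p * 'I_p) _.
set C := \sum_c (\sum_r u r * k r c) * (\sum_r u r * x r c).
have CW : C ^+ 2 <= W by exact: cross_projection_le.
have z2 : \sum_r \sum_c z r c ^+ 2 = s ^+ 2 + 2 * s / h * K + S / n.
  transitivity (\sum_r \sum_c (s ^+ 2 * k r c ^+ 2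
     + 2 * s / h * (k r c * x r c) + n^-1 * x r c ^+ 2)).
    apply: eq_bigr => r _; apply: eq_bigr => c _; rewrite /z -h2.
    by field; rewrite gt_eqF.
  under eq_bigr do rewrite !big_split/= -!mulr_sumr.
  by rewrite !big_split/= -!mulr_sumr k1 mulr1 [n^-1 * _]mulrC.
have pz : projection_sqr z u = s ^+ 2 * projection_sqr k u + 2 * s / h * C
    + (gram_deviation x u + q%:R) / n.
  rewrite /gram_deviation u1 mulr1 subrK /projection_sqr /C.
  transitivity (\sum_c (s ^+ 2 * (\sum_r u r * k r c) ^+ 2
     + 2 * s / h * ((\sum_r u r * k r c) * (\sum_r u r * x r c))
     + n^-1 * (\sum_r u r * x r c) ^+ 2)).
    apply: eq_bigr => c _.
    have -> : \sum_r u r * z r c =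
        s * (\sum_r u r * k r c) + h^-1 * (\sum_r u r * x r c).
      rewrite !mulr_sumr -big_split/=; apply: eq_bigr => r _; rewrite /z.
      by field; rewrite gt_eqF.
    by rewrite -h2; field; rewrite gt_eqF.
  by rewrite !big_split/= -!mulr_sumr [n^-1 * _]mulrC.
(* The residual is at least the squared norm of [z] minus [projection_sqr z u]. The signal leaves
   [s ^+ 2 * (1 - phi2)], the noise leaves [1 - q / n = 1 - p^-1], and [xi] collects the four
   centred terms. *)
exists (- ((S - n) / n) - 2 * s / h * K + 2 * s / h * C + gram_deviation x u / n).
  rewrite rank_one_residualE//.
  have := bilinear_sqr_le z u v v1; rewrite pz z2 => bl.
  have : s ^+ 2 * projection_sqr k u <= s ^+ 2 * phi2 by rewrite ler_wpM2l ?sqr_ge0.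
  have -> : (S - n) / n = S / n - 1 by rewrite mulrBl divff// gt_eqF.
  have : (gram_deviation x u + q%:R) / n = gram_deviation x u / n + p%:R^-1.
    by rewrite nE; field; rewrite !gt_eqF.
  lra.
have -> : 4 * s ^+ 2 / n * K ^+ 2 = (2 * s / h * K) ^+ 2.
  by rewrite -h2; field; rewrite gt_eqF.
apply: (@le_trans _ _ (4 * (((S - n) / n) ^+ 2 + (2 * s / h * K) ^+ 2
  + (2 * s / h * C) ^+ 2 + (gram_deviation x u / n) ^+ 2))).
  set a := (S - n) / n; set b := _ * K; set c := _ * C.
  set e := gram_deviation x u / n.
  have := sqr_ge0 (a - b); have := sqr_ge0 (a + c); have := sqr_ge0 (a + e).
  have := sqr_ge0 (b + c); have := sqr_ge0 (b + e); have := sqr_ge0 (c - e).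
  nra.
have -> : (2 * s / h * C) ^+ 2 = 4 * s ^+ 2 / n * C ^+ 2.
  by rewrite -h2; field; rewrite gt_eqF.
rewrite ler_pM2l// lerD2r lerD2l ler_wpM2l// divr_ge0 ?(ltW n0)//.
by rewrite mulr_ge0 ?sqr_ge0.
Qed.

End rank_one_residual.

(** With [y = xi / a]: for [y <= 1/2], [ln (1 - y) >= - 2 * |y|], which arithmetic-geometric mean
    turns into [eta + y ^+ 2 / eta]. For [y > 1/2] the error is so large that [4 * L * y ^+ 2] pays
    for all of [ln a], and a negative [ln Z] is paid by its own square. *)
Lemma ln_ge_deficit {R : realType} (a Z xi eta L : R) : 0 < eta -> 0 < a ->
  ln a <= L -> 0 <= L -> 0 < Z -> a - xi <= Z ->
  ln a - (eta + (3 / eta + 4 * L) * (xi / a) ^+ 2)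
    - (if Z <= 1 then eta * ln Z ^+ 2 else 0) <= ln Z.
Proof.
move=> eta0 a0 aL L0 Z0; set y := xi / a; set G := (if _ then _ else _).
have G0 : 0 <= G by rewrite /G; case: ifP => // _; rewrite mulr_ge0 ?sqr_ge0// ltW.
have -> : a - xi = a * (1 - y) by rewrite /y mulrBr mulr1 mulrC divfK// gt_eqF.
move=> yZ.
have amgm (t : R) : 2 * t <= eta + t ^+ 2 / eta.
  rewrite -subr_ge0 (_ : _ - _ = (eta - t) ^+ 2 / eta).
    by rewrite divr_ge0 ?sqr_ge0// ltW.
  by field; rewrite gt_eqF.
have y2 := sqr_ge0 y; have Ly : 0 <= L * y ^+ 2 by rewrite mulr_ge0.
have ye : 0 <= y ^+ 2 / eta by rewrite divr_ge0// ltW.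
have E : (3 / eta + 4 * L) * y ^+ 2 = 3 * (y ^+ 2 / eta) + 4 * (L * y ^+ 2) by ring.
have [yh|yh] := leP y 2^-1.
  have y1 : 0 < 1 - y by lra.
  have h1 : ln a + ln (1 - y) <= ln Z.
    by rewrite -lnM ?posrE// ler_ln ?posrE// mulr_gt0.
  have h2 : - y / (1 - y) <= ln (1 - y).
    have i0 : 0 < (1 - y)^-1 by rewrite invr_gt0.
    have h : -1 < (1 - y)^-1 - 1 by lra.
    have := le_ln1Dx h; rewrite [1 + _]addrC subrK lnV ?posrE//.
    have -> : - y / (1 - y) = 1 - (1 - y)^-1 by field; rewrite gt_eqF.
    lra.
  have h3 : - (2 * `|y|) <= - y / (1 - y).
    rewrite mulNr lerNr opprK ler_pdivrMr//.
    by have := ler_norm y; have := normr_ge0 y; nra.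
  have := amgm `|y|; rewrite real_normK ?num_real//.
  rewrite E; lra.
have y4 : 1 <= 4 * y ^+ 2 by nra.
have Ly4 : L <= 4 * (L * y ^+ 2) by nra.
have [Z1|Z1] := leP Z 1; last first.
  have : 0 <= ln Z by rewrite ln_ge0// ltW.
  by rewrite E; lra.
have lZ : 0 <= - ln Z by rewrite oppr_ge0 ln_le0.
rewrite E /G Z1.
have : - ln Z <= y ^+ 2 / eta + eta * ln Z ^+ 2.
  have := sqr_ge0 (2 * eta * - ln Z - 1).
  have -> : (2 * eta * - ln Z - 1) ^+ 2 =
    (4 * eta) * (eta * ln Z ^+ 2 + 4^-1 / eta - - ln Z) by field; rewrite gt_eqF.
  rewrite pmulr_rge0 ?mulr_gt0// => h.
  have : 4^-1 / eta <= y ^+ 2 / eta by rewrite ler_pM2r ?invr_gt0//; lra.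
  by lra.
by lra.
Qed.

(** * Second moments of linear and quadratic noise terms *)

Section noise_moments.
Context {d : measure_display} {T : measurableType d} {R : realType}.
Context {P : probability T R} {p q : nat} {X : 'I_p * 'I_q -> T -> R}.
Hypothesis iidX : iid_normal P X.
Hypotheses (p0 : (0 < p)%N) (q0 : (0 < q)%N).
Let n : R := (p * q)%:R.
Let n0 : 0 < n. Proof. by rewrite ltr0n muln_gt0 p0. Qed.

Definition noise_deviation (w : T) : R := \sum_r \sum_c X (r, c) w ^+ 2 - n.

Lemma measurable_noise_deviation : measurable_fun setT noise_deviation.
Proof.
apply: measurable_funB => //; do 2 (apply: measurable_sum => ?).
by apply: measurable_funX; exact: iidX.1.
Qed.

Lemma sqr_le_expRD (x : R) : x ^+ 2 <= expR x + expR (- x).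
Proof.
wlog x0 : x / 0 <= x.
  move=> H; have [/H//|x0] := leP 0 x.
  by have := H (- x); rewrite sqrrN opprK [in X in _ -> X]addrC; apply; lra.
have h : 1 + x / 4 <= expR (x / 4) by exact: expR_ge1Dx.
have sq (y : R) : expR y = expR (y / 2) ^+ 2 by rewrite expr2 -expRD -splitr.
have h2 : x <= expR (x / 2).
  have -> : expR (x / 2) = expR (x / 4) ^+ 2.
    by rewrite sq; congr (expR _ ^+ 2); field.
  have := sqr_ge0 (1 - x / 4); nra.
apply: ler_wpDr; first exact: expR_ge0.
by rewrite sq ler_sqr ?nnegrE ?expR_ge0.
Qed.

(** At [t] of modulus [1 / (8 * h)] the exponential moment is at most [expR 32^-1 <= 2]; then
    [x ^+ 2 <= expR x + expR (- x)] yields [64 / n * (2 + 2)]. *)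
Lemma mean_sqr_noise_deviation :
  (\int[P]_w (((noise_deviation w / n) ^+ 2)%:E) <= (256 / n)%:E)%E.
Proof.
set h := Num.sqrt n; have h0 : 0 < h by rewrite sqrtr_gt0.
have h2 : h ^+ 2 = n by rewrite sqr_sqrtr// ltW.
have h1 : 1 <= h.
  rewrite -(@ler_pXn2r _ 2) ?nnegrE ?(ltW h0)// h2 expr1n.
  by rewrite /n ler1n muln_gt0 p0.
have mexp (t : R) : `|t| = 8^-1 / h ->
    (\int[P]_w (expR (t * noise_deviation w))%:E <= 2%:E)%E.
  move=> tE.
  have := @iid_normal_exp_deviation _ _ _ _ _ _ iidX _ id (fun=> 1) 1 t.
  have u1 j : \sum_(i : 'I_p * 'I_q | i == j) (1 : R) ^+ 2 = 1.
    by rewrite big_pred1_eq expr1n.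
  move=> /(_ u1); rewrite !mulr1 card_prod !card_ord -/n.
  have tn : `|2 * t| <= 4^-1.
    rewrite normrM tE normr_nat mulrA ler_pdivrMr//; lra.
  move=> /(_ tn) H; apply: (@le_trans _ _ (expR (2 * n * t ^+ 2))%:E).
    apply: le_trans H; apply: integral_monotone => w.
    rewrite lee_fin le_eqVlt; apply/orP; left; apply/eqP; congr expR.
    congr (_ * (_ - _)); rewrite pair_bigA/=; apply: eq_bigr => -[r c] _ /=.
    by rewrite big_pred1_eq mul1r.
  rewrite lee_fin -(real_normK (num_real t)) tE -h2.
  have -> : 2 * h ^+ 2 * (8^-1 / h) ^+ 2 = 32^-1 by field; rewrite gt_eqF.
  have e32 : 1 + - 32^-1 <= expR (- 32^-1 : R) by exact: expR_ge1Dx.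
  rewrite -[leRHS]invrK -[leLHS]invrK lef_pV2 ?posrE ?invr_gt0 ?expR_gt0//.
  rewrite -expRN; lra.
have mE (t : R) : measurable_fun setT (fun w => (expR (t * noise_deviation w))%:E).
  apply/measurable_EFinP; apply: measurableT_comp => //.
  by apply: measurable_funM => //; exact: measurable_noise_deviation.
set t := 8^-1 / h; have t0 : 0 < t by rewrite divr_gt0.
apply: (@le_trans _ _ (\int[P]_w ((64 / n)%:E *
   ((expR (t * noise_deviation w))%:E + (expR (- t * noise_deviation w))%:E)))%E).
  apply: integral_monotone => w; rewrite -EFinD -EFinM lee_fin.
  have := sqr_le_expRD (t * noise_deviation w); rewrite mulNr.
  have -> : (noise_deviation w / n) ^+ 2 = (64 / n) * (t * noise_deviation w) ^+ 2.
    by rewrite /t -h2; field; rewrite gt_eqF.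
  by move=> H; rewrite ler_pM2l// divr_gt0.
rewrite ge0_integralZl//; last 3 first.
- by apply: emeasurable_funD; exact: mE.
- by move=> w _; rewrite adde_ge0 ?lee_fin ?expR_ge0.
- by rewrite lee_fin divr_ge0// ltW.
rewrite ge0_integralD//.
apply: (@le_trans _ _ ((64 / n)%:E * (2%:E + 2%:E)))%E.
  rewrite lee_pmul2l ?lte_fin ?divr_gt0//; apply: leeD; apply: mexp.
    by rewrite gtr0_norm.
  by rewrite normrN gtr0_norm.
rewrite -(EFinD 2 2) -(EFinM (64 / n)) lee_fin le_eqVlt; apply/orP; left; apply/eqP.
by rewrite mulrAC; congr (_ / _); lra.
Qed.

Lemma measurable_sum_noise (k : 'I_p -> 'I_q -> R) :
  measurable_fun setT (fun w => \sum_r \sum_c k r c * X (r, c) w).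
Proof.
do 2 (apply: measurable_sum => ?).
by apply: measurable_funM => //; exact: iidX.1.
Qed.

Lemma mean_sqr_sum_noise (k : 'I_p -> 'I_q -> R) :
  (\int[P]_w ((\sum_r \sum_c k r c * X (r, c) w) ^+ 2)%:E
   <= (8 * \sum_r \sum_c k r c ^+ 2)%:E)%E.
Proof.
have := iid_normal_lincomb_sqr iidX (fun i => k i.1 i.2).
rewrite pair_bigA; apply: le_trans; apply: integral_monotone => w.
rewrite pair_bigA lee_fin le_eqVlt; apply/orP; left; apply/eqP; congr (_ ^+ 2).
by apply: eq_bigr => -[].
Qed.

Lemma mean_sqr_row_noise (k : 'I_q -> R) (r : 'I_p) :
  (\int[P]_w ((\sum_c k c * X (r, c) w) ^+ 2)%:E <= (8 * \sum_c k c ^+ 2)%:E)%E.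
Proof.
have := mean_sqr_sum_noise (fun r' c => if r' == r then k c else 0).
have E (F : 'I_p -> 'I_q -> R) :
    \sum_r' \sum_c (if r' == r then F r' c else 0) = \sum_c F r c.
  rewrite (bigD1 r)//= eqxx [X in _ + X]big1 ?addr0// => r' /negbTE rr.
  by rewrite rr big1.
rewrite -(E (fun=> fun c => k c ^+ 2)).
under [X in (_ <= (8 * X)%:E)%E -> _]eq_bigr do under eq_bigr do
  rewrite (fun_if (fun y => y ^+ 2)) expr0n.
apply: le_trans; apply: integral_monotone => w; rewrite -(E (fun r' c => k c * X (r', c) w)).
rewrite le_eqVlt; apply/orP; left; apply/eqP; congr (_ ^+ 2)%:E.
apply: eq_bigr => r' _; apply: eq_bigr => c _.
by case: ifP; rewrite ?mul0r.
Qed.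

End noise_moments.

Lemma ge0_le_integralZl {d} {T : measurableType d} {R : realType}
    {P : {measure set T -> \bar R}} (f : T -> \bar R) (c : R) (a : \bar R) :
  measurable_fun setT f -> (forall w, 0 <= f w)%E -> 0 <= c ->
  (\int[P]_w f w <= a -> \int[P]_w (c%:E * f w) <= c%:E * a)%E.
Proof. by move=> mf f0 c0 fa; rewrite ge0_integralZl//; exact: lee_wpmul2l. Qed.

(** * Mean of the logarithm of the residual *)

Section residual_log_mean.
Context {d : measure_display} {T : measurableType d} {R : realType}.
Context {P : probability T R} {p q : nat} {X : 'I_p * 'I_q -> T -> R}.
Hypothesis iidX : iid_normal P X.
Hypotheses (p1 : (1 < p)%N) (q1 : (1 < q)%N).
Variables (k : 'I_p -> 'I_q -> R) (s : R).
Hypotheses (k1 : \sum_r \sum_c k r c ^+ 2 = 1) (s0 : 0 <= s).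
Let p0 : (0 < p)%N. Proof. exact: ltnW. Qed.
Let q0 : (0 < q)%N. Proof. exact: ltnW. Qed.
Let n : R := (p * q)%:R.
Let n0 : 0 < n. Proof. by rewrite ltr0n muln_gt0 p0. Qed.
Let h : R := Num.sqrt n.
Let h0 : 0 < h. Proof. by rewrite sqrtr_gt0. Qed.
Let h2 : h ^+ 2 = n. Proof. by rewrite sqr_sqrtr// ltW. Qed.

Let z w r c := s * k r c + X (r, c) w / h.

Definition residual_weight (w : T) : \bar R :=
  rank_one_weight (fun r c => h * s * k r c + X (r, c) w).

Lemma measurable_residual_weight : measurable_fun setT residual_weight.
Proof. exact: (measurable_rank_one_weight iidX (fun r c => h * s * k r c)). Qed.

Lemma mean_residual_weight : (\int[P]_w residual_weight w <= 1688%:E)%E.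
Proof. exact: (mean_rank_one_weight p1 q1 iidX (fun r c => h * s * k r c)). Qed.

Lemma residual_weight_ge0 w : (0 <= residual_weight w)%E.
Proof.
rewrite adde_ge0// mule_ge0//.
by apply: sume_ge0 => i _; rewrite adde_ge0// mule_ge0// block_weight_ge0.
Qed.

Let residualE w (u : 'I_p -> R) (v : 'I_q -> R) (l : R) :
  n^-1 * \sum_(i : 'I_p * 'I_q)
    (h * s * k i.1 i.2 + X (i.1, i.2) w - (h * (l * u i.1)) * v i.2) ^+ 2 =
  \sum_r \sum_c (z w r c - l * u r * v c) ^+ 2.
Proof.
rewrite pair_bigA mulr_sumr; apply: eq_bigr => i _ /=.
by rewrite /z -h2; field; rewrite gt_eqF.
Qed.

Lemma residual_weight_pinfty w u v :
  rank_one_residual (z w) u v = 0 -> residual_weight w = +oo%E.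
Proof.
rewrite /rank_one_residual -residualE => /eqP.
rewrite mulf_eq0 invr_eq0 gt_eqF//= => /eqP e0.
exact: (rank_one_weight_pinfty p0 q0 _ (fun r => h * (bilinear (z w) u v * u r)) v e0).
Qed.

Lemma ln_sqr_le_residual_weight w u v :
  rank_one_residual (z w) u v <= 1 ->
  ((ln (rank_one_residual (z w) u v) ^+ 2)%:E <= residual_weight w)%E.
Proof.
rewrite /rank_one_residual -residualE => Z1.
exact: (ln_sqr_le_rank_one_weight p0 q0 _ (fun r => h * (bilinear (z w) u v * u r)) v Z1).
Qed.


Variable phi2 : R.
Hypotheses (phi0 : 0 <= phi2) (phi1 : phi2 <= 1) (pq : (p <= q)%N).
Hypothesis kphi : forall u : 'I_p -> R,
  \sum_r u r ^+ 2 = 1 -> projection_sqr k u <= phi2.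

Let t : R := s ^+ 2 * (1 - phi2).
Let L : R := ln (1 + t).
Let eta : R := h^-1 + s / Num.sqrt h / (1 + t).
Let a : R := 1 - p%:R^-1 + t.

Let t0 : 0 <= t. Proof. by rewrite mulr_ge0 ?sqr_ge0// subr_ge0. Qed.
Let eta0 : 0 < eta.
Proof.
by rewrite ltr_pwDl ?invr_gt0// !divr_ge0 ?sqrtr_ge0// addr_ge0.
Qed.
Let pV : p%:R^-1 <= 2^-1 :> R.
Proof. by rewrite lef_pV2 ?posrE ?ltr0n// ler_nat. Qed.
Let pV0 : 0 < p%:R^-1 :> R. Proof. by rewrite invr_gt0 ltr0n. Qed.
Let a_ge : (1 + t) / 2 <= a.
Proof. by rewrite /a; have := t0; have := pV; lra. Qed.
Let a0 : 0 < a. Proof. by apply: lt_le_trans a_ge; rewrite divr_gt0// ltr_pwDl. Qed.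
Let L0 : 0 <= L. Proof. by rewrite ln_ge0// lerDl. Qed.
Let aL : ln a <= L.
Proof. by rewrite ler_ln ?posrE ?a0 ?ltr_pwDl// /a; have := pV0; lra. Qed.

(** The two pure noise terms combine to [4 * 256 * 297 / n]. The signal terms need
    [(1 + p) / n <= 2 / h], true since [p <= q] forces [p <= h]. The final factor 4 comes from
    [1 + t <= 2 * a]. *)
Let noise_bound :
  4 * (256 / n + 4 * s ^+ 2 / n * 8 + 4 * s ^+ 2 / n * (8 * p%:R)
       + 256 * 296 / n) / a ^+ 2 <= 4 * (1024 * 297) * eta ^+ 2.
Proof.
rewrite ler_pdivrMr ?exprn_gt0//.
have t1 : 0 < 1 + t by rewrite ltr_pwDl.
have eta_ge : 1 / n + s ^+ 2 / h <= (1 + t) ^+ 2 * eta ^+ 2.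
  rewrite -exprMn /eta mulrDr [(1 + t) * (_ / _)]mulrC divfK ?gt_eqF//.
  have sh0 : 0 < Num.sqrt h by rewrite sqrtr_gt0.
  have -> : s ^+ 2 / h = (s / Num.sqrt h) ^+ 2.
    by rewrite exprMn exprVn sqr_sqrtr// ltW.
  have -> : 1 / n = h^-1 ^+ 2 by rewrite -h2 exprVn mul1r.
  have b0 : 0 <= s / Num.sqrt h by rewrite divr_ge0// ltW.
  have c0 : 0 < h^-1 by rewrite invr_gt0.
  rewrite sqrrD; have : h^-1 ^+ 2 <= ((1 + t) * h^-1) ^+ 2.
    by rewrite ler_sqr ?nnegrE ?(ltW c0)// ?mulr_ge0 ?(ltW c0)// ?(ltW t1)// ler_peMl ?(ltW c0)// lerDl.
  have : 0 <= (1 + t) * h^-1 * (s / Num.sqrt h) *+ 2.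
    by rewrite mulrn_wge0// mulr_ge0// mulr_ge0// ltW.
  lra.
have a2 : (1 + t) ^+ 2 <= 4 * a ^+ 2.
  have -> : 4 * a ^+ 2 = (2 * a) ^+ 2 by ring.
  by rewrite ler_sqr ?nnegrE ?mulr_ge0 ?(ltW a0) ?(ltW t1)//; have := a_ge; lra.
have pn : (1 + p%:R) / n <= 2 / h.
  rewrite ler_pdivrMr// -h2 expr2 mulrA divfK ?gt_eqF//.
  have : p%:R <= h.
    rewrite -(@ler_pXn2r _ 2) ?nnegrE ?(ltW h0)// h2 /n natrM expr2.
    by rewrite ler_pM2l ?ltr0n// ler_nat.
  have : 1 <= p%:R :> R by rewrite ler1n.
  lra.
have s2 := sqr_ge0 s.
apply: (@le_trans _ _ (1024 * 297 * (1 / n + s ^+ 2 / h))).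
  have : s ^+ 2 * ((1 + p%:R) / n) <= s ^+ 2 * (2 / h) by rewrite ler_wpM2l.
  have : 0 <= s ^+ 2 / h by rewrite divr_ge0// ltW.
  have -> : 4 * s ^+ 2 / n * 8 = 32 * (s ^+ 2 / n) by ring.
  have -> : 4 * s ^+ 2 / n * (8 * p%:R) = 32 * (s ^+ 2 * p%:R / n) by ring.
  have -> : s ^+ 2 * ((1 + p%:R) / n) = s ^+ 2 / n + s ^+ 2 * p%:R / n by ring.
  lra.
have e2 := sqr_ge0 eta; nra.
Qed.

(** [H] adds the losses of [ln_ge_deficit], with [ln Z ^+ 2] replaced by its weight. Writing
    [C = 1024 * 297], the [3 / eta] term costs [12 * C * eta], the [4 * L] term costs
    [16 * C * L * eta ^+ 2], and the remaining [1689 * eta] fits into [4 * C * eta]. *)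
Lemma residual_log_ge : exists H : T -> \bar R,
  [/\ measurable_fun setT H, forall w, (0 <= H w)%E,
      (\int[P]_w H w <= (16 * (1024 * 297) * (eta * (1 + L * eta)))%:E)%E &
      forall w u v, \sum_r u r ^+ 2 = 1 -> \sum_c v c ^+ 2 = 1 ->
        (rank_one_residual (z w) u v = 0 -> H w = +oo%E) /\
        (0 < rank_one_residual (z w) u v ->
         ((ln a)%:E - H w <= (ln (rank_one_residual (z w) u v))%:E)%E)].
Proof.
have [G [mG G0 EG Gdev]] := gram_deviation_dominated iidX p0 pq.
pose Kw w := \sum_r \sum_c k r c * X (r, c) w.
pose Ww w := \sum_(i : 'I_p * 'I_p) (\sum_c k i.1 c * X (i.2, c) w) ^+ 2.
pose b := 4 * s ^+ 2 / n.
have b0 : 0 <= b by rewrite !mulr_ge0 ?invr_ge0 ?(ltW n0)// sqr_ge0.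
pose Xi w := (noise_deviation (X := X) w / n) ^+ 2 + b * Kw w ^+ 2 + b * Ww w + G w.
pose D := (3 / eta + 4 * L) * 4 / a ^+ 2.
have D0 : 0 <= D.
  by rewrite !mulr_ge0 ?invr_ge0 ?exprn_ge0 ?(ltW a0)// addr_ge0 ?divr_ge0 ?(ltW eta0)// mulr_ge0.
have W0 w : 0 <= Ww w by apply: sumr_ge0 => i _; exact: sqr_ge0.
have Xi0 w : 0 <= Xi w by rewrite !addr_ge0 ?(mulr_ge0 b0) ?sqr_ge0.
have mK : measurable_fun setT Kw by exact: (measurable_sum_noise iidX).
have mrow (i : 'I_p * 'I_p) : measurable_fun setT (fun w => (\sum_c k i.1 c * X (i.2, c) w) ^+ 2).
  apply: measurable_funX; apply: measurable_sum => c.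
  by apply: measurable_funM => //; exact: iidX.1.
have mW : measurable_fun setT Ww by exact: measurable_sum.
have mN : measurable_fun setT (fun w => (noise_deviation (X := X) w / n) ^+ 2).
  by apply: measurable_funX; apply: measurable_funM => //; exact: (measurable_noise_deviation iidX).
have mK2 : measurable_fun setT (fun w => b * Kw w ^+ 2).
  by apply: measurable_funM => //; exact: measurable_funX.
have mW2 : measurable_fun setT (fun w => b * Ww w) by exact: measurable_funM.
have mXi : measurable_fun setT Xi.
  by do 3 (apply: measurable_funD => //).
have EXi : (\int[P]_w (Xi w)%:E <= (256 / n + b * 8 + b * (8 * p%:R) + 256 * 296 / n)%:E)%E.
  have bint (f : T -> R) (c : R) : measurable_fun setT f -> (forall w, 0 <= f w) ->
      (\int[P]_w (f w)%:E <= c%:E -> \int[P]_w (b * f w)%:E <= (b * c)%:E)%E.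
    move=> mf f0 fc; under eq_integral do rewrite (EFinM b).
    rewrite (EFinM b c); apply: (ge0_le_integralZl (fun w => (f w)%:E)) => //; first exact/measurable_EFinP.
  under eq_integral do rewrite !EFinD.
  rewrite !EFinD; apply: ge0_le_integralD => [||w|w||//].
  - by repeat apply: emeasurable_funD; exact/measurable_EFinP.
  - exact/measurable_EFinP.
  - by rewrite !adde_ge0// lee_fin ?sqr_ge0// mulr_ge0// sqr_ge0.
  - by rewrite lee_fin.
  apply: ge0_le_integralD => [||w|w||].
  - by repeat apply: emeasurable_funD; exact/measurable_EFinP.
  - exact/measurable_EFinP.
  - by rewrite !adde_ge0// lee_fin ?sqr_ge0// mulr_ge0// sqr_ge0.
  - by rewrite lee_fin mulr_ge0.
  - apply: ge0_le_integralD => [||w|w||].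
    + exact/measurable_EFinP.
    + exact/measurable_EFinP.
    + by rewrite lee_fin sqr_ge0.
    + by rewrite lee_fin mulr_ge0 ?sqr_ge0.
    + exact: mean_sqr_noise_deviation.
    + apply: bint; [exact: measurable_funX|by move=> w; exact: sqr_ge0|].
      by have := mean_sqr_sum_noise iidX k; rewrite k1 mulr1.
  - apply: bint => //.
    under eq_integral do rewrite -sumEFin.
    rewrite ge0_integral_sum//; last 2 first.
    + by move=> i; exact/measurable_EFinP.
    + by move=> i w _; rewrite lee_fin sqr_ge0.
    apply: (@le_trans _ _ (\sum_(i : 'I_p * 'I_p) (8 * \sum_c k i.1 c ^+ 2)%:E)%E).
      by apply: lee_sum => i _; exact: mean_sqr_row_noise.
    rewrite sumEFin lee_fin -mulr_sumr ler_pM2l//.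
    rewrite -(pair_bigA _ (fun r r' => \sum_c k r c ^+ 2))/=.
    under eq_bigr do rewrite sumr_const card_ord.
    by rewrite sumrMnl k1.
exists (fun w => (eta%:E + D%:E * (Xi w)%:E) + eta%:E * residual_weight w)%E; split.
- apply: emeasurable_funD; first apply: emeasurable_funD => //.
    by apply: emeasurable_funM => //; apply/measurable_EFinP.
  by apply: emeasurable_funM => //; exact: measurable_residual_weight.
- move=> w; rewrite adde_ge0//.
    by rewrite adde_ge0 ?mule_ge0 ?lee_fin ?(ltW eta0).
  by rewrite mule_ge0 ?residual_weight_ge0// lee_fin ltW.
- have bint (f : T -> R) (c e : R) : measurable_fun setT f -> (forall w, 0 <= f w) ->
      0 <= c -> (\int[P]_w (f w)%:E <= e%:E ->
      \int[P]_w (c%:E * (f w)%:E) <= (c * e)%:E)%E.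
    move=> mf f0 c0 fc; rewrite (EFinM c e).
    apply: (ge0_le_integralZl (fun w => (f w)%:E)) => //; first exact/measurable_EFinP.
  set e := (X in (_ <= X%:E)%E) in EXi.
  apply: (@le_trans _ _ (eta%:E + (D * e)%:E + eta%:E * 1688%:E)%E).
    apply: ge0_le_integralD => [||w|w||].
    + apply: emeasurable_funD => //.
      by apply: emeasurable_funM => //; exact/measurable_EFinP.
    + by apply: emeasurable_funM => //; exact: measurable_residual_weight.
    + by rewrite adde_ge0 ?mule_ge0 ?lee_fin ?(ltW eta0).
    + by rewrite mule_ge0 ?residual_weight_ge0// lee_fin ltW.
    + apply: ge0_le_integralD => [||w|w||].
      * by [].
      * by apply: emeasurable_funM => //; exact/measurable_EFinP.
      * by rewrite lee_fin ltW.
      * by rewrite mule_ge0 ?lee_fin.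
      * by rewrite integral_cst// [X in (_ * X)%E](probability_setT P) mule1.
      * exact: bint.
    + apply: ge0_le_integralZl; [exact: measurable_residual_weight| |exact: ltW|].
        exact: residual_weight_ge0.
      exact: mean_residual_weight.
  rewrite -EFinM -!EFinD lee_fin.
  have := noise_bound; rewrite -/b -/e => eb.
  have -> : D * e = (3 / eta + 4 * L) * (4 * e / a ^+ 2) by rewrite /D; ring.
  have f0 : 0 <= 3 / eta + 4 * L by rewrite addr_ge0 ?divr_ge0 ?(ltW eta0)// mulr_ge0.
  have := ler_wpM2l f0 eb.
  have -> : (3 / eta + 4 * L) * (4 * (1024 * 297) * eta ^+ 2) =
    4 * (1024 * 297) * (3 * eta + 4 * (L * eta ^+ 2)) by field; rewrite gt_eqF.
  rewrite (_ : eta * (1 + L * eta) = eta + L * eta ^+ 2); last by ring.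
  have := eta0; have := mulr_ge0 L0 (sqr_ge0 eta); lra.
- move=> w u v u1 v1; split => [Z0|Z0].
    by rewrite (residual_weight_pinfty _ _ _ Z0) gt0_muley ?lte_fin//.
  have [xi xiZ xi2] := rank_one_residual_ge k (fun r c => X (r, c) w) s phi2 u v
    p0 q0 k1 u1 v1 (kphi u u1).
  have := @ln_ge_deficit _ a _ xi eta L eta0 a0 aL L0 Z0 xiZ.
  set Z := rank_one_residual (z w) u v in Z0 *.
  set g := (if _ then _ else _) => lnZ.
  have gG : (g%:E <= eta%:E * residual_weight w)%E.
    rewrite /g; case: ifPn => Z1.
      rewrite EFinM lee_pmul2l ?lte_fin//; exact: ln_sqr_le_residual_weight.
    by rewrite mule_ge0 ?residual_weight_ge0// lee_fin ltW.
  apply: (@le_trans _ _ ((ln a - (eta + D * Xi w))%:E - g%:E)%E).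
    rewrite EFinB -EFinM -EFinD oppeD; last by rewrite fin_num_adde_defr.
    by rewrite addeA leeD2l// leeN2.
  rewrite -EFinB lee_fin; apply: le_trans lnZ; rewrite lerD2r lerD2l lerN2 lerD2l.
  have -> : D * Xi w = (3 / eta + 4 * L) * (4 / a ^+ 2 * Xi w) by rewrite /D; ring.
  rewrite ler_wpM2l ?addr_ge0 ?divr_ge0 ?(ltW eta0)// ?mulr_ge0//.
  rewrite exprMn exprVn ler_pdivrMr ?exprn_gt0// mulrAC divfK ?gt_eqF ?exprn_gt0//.
  apply: (le_trans xi2); rewrite ler_pM2l//.
  by rewrite /Xi lerD2l; exact: Gdev.
Qed.

End residual_log_mean.

(** With normalised noise energy [1 + e], [ln (1 + e) <= e <= h^-1 + h * e ^+ 2], whose mean is of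
    order [h^-1]. The weight is there to be infinite when the residual vanishes, where [ln 0 = 0]
    could exceed the bound. The constants total [1 + 256 + 1688 <= 2000]. *)
Lemma residual_log_le {d} {T : measurableType d} {R : realType}
    {P : probability T R} {p q : nat} {X : 'I_p * 'I_q -> T -> R}
    (iidX : iid_normal P X) (p1 : (1 < p)%N) (q1 : (1 < q)%N)
    (k : 'I_p -> 'I_q -> R) (s : R) :
  let n : R := (p * q)%:R in
  let z w r c := s * k r c + X (r, c) w / Num.sqrt n in
  exists H : T -> \bar R,
  [/\ measurable_fun setT H, forall w, (0 <= H w)%E,
      (\int[P]_w H w <= (2000 / Num.sqrt n)%:E)%E &
      forall w u v,
        (rank_one_residual (z w) u v = 0 -> H w = +oo%E) /\
        (0 < rank_one_residual (z w) u v ->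
         rank_one_residual (z w) u v <= \sum_r \sum_c (X (r, c) w / Num.sqrt n) ^+ 2 ->
         ((ln (rank_one_residual (z w) u v))%:E <= H w)%E)].
Proof.
move=> n z.
have p0 : (0 < p)%N by exact: ltnW. have q0 : (0 < q)%N by exact: ltnW.
have n0 : 0 < n by rewrite ltr0n muln_gt0 p0.
set h := Num.sqrt n in z *; have h0 : 0 < h by rewrite sqrtr_gt0.
have h2 : h ^+ 2 = n by rewrite sqr_sqrtr// ltW.
have hV : 0 < h^-1 by rewrite invr_gt0.
pose D w := (noise_deviation (X := X) w / n) ^+ 2.
have mD : measurable_fun setT D.
  apply: measurable_funX; apply: measurable_funM => //.
  exact: (measurable_noise_deviation iidX).
have D0 w : 0 <= D w by exact: sqr_ge0.
have W0 := residual_weight_ge0 (X := X) k s.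
exists (fun w => h^-1%:E + h%:E * (D w)%:E + h^-1%:E * residual_weight (X := X) k s w)%E.
split.
- apply: emeasurable_funD; first apply: emeasurable_funD => //.
    by apply: emeasurable_funM => //; apply/measurable_EFinP.
  by apply: emeasurable_funM => //; exact: (measurable_residual_weight iidX).
- by move=> w; rewrite !adde_ge0 ?mule_ge0 ?lee_fin ?(ltW h0) ?(ltW hV).
- apply: (@le_trans _ _ (h^-1%:E + h%:E * (256 / n)%:E + h^-1%:E * 1688%:E)%E).
    apply: ge0_le_integralD => [||w|w||].
    + apply: emeasurable_funD => //.
      by apply: emeasurable_funM => //; exact/measurable_EFinP.
    + by apply: emeasurable_funM => //; exact: (measurable_residual_weight iidX).
    + by rewrite !adde_ge0 ?mule_ge0 ?lee_fin ?(ltW h0) ?(ltW hV).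
    + by rewrite !mule_ge0 ?lee_fin ?(ltW hV).
    + apply: ge0_le_integralD => [||w|w||].
      * by [].
      * by apply: emeasurable_funM => //; exact/measurable_EFinP.
      * by rewrite lee_fin ltW.
      * by rewrite mule_ge0 ?lee_fin ?(ltW h0).
      * by rewrite integral_cst// [X in (_ * X)%E](probability_setT P) mule1.
      * apply: (ge0_le_integralZl (fun w => (D w)%:E)); last exact: mean_sqr_noise_deviation.
        - exact/measurable_EFinP.
        - by move=> w; rewrite lee_fin.
        - exact: ltW.
    + apply: ge0_le_integralZl; [exact: (measurable_residual_weight iidX)| |exact: ltW|].
        exact: W0.
      exact: mean_residual_weight.
  rewrite -(EFinM h) -(EFinM h^-1) -!EFinD lee_fin.
  have -> : h * (256 / n) = 256 * h^-1 by rewrite -h2; field; rewrite gt_eqF.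
  lra.
- move=> w u v; split => [Z0|Z0 Zle].
    by rewrite (residual_weight_pinfty p1 q1 _ _ _ _ _ Z0) gt0_muley ?lte_fin// addey.
  apply: (@le_trans _ _ (h^-1 + h * D w)%:E); last first.
    by rewrite EFinD (EFinM h) leeDl// mule_ge0 ?lee_fin ?(ltW hV).
  rewrite lee_fin; set e := noise_deviation (X := X) w / n.
  have E : \sum_r \sum_c (X (r, c) w / h) ^+ 2 = 1 + e.
    rewrite /e /noise_deviation mulrBl -/n divff ?gt_eqF// addrC subrK.
    rewrite mulr_suml; apply: eq_bigr => r _; rewrite mulr_suml; apply: eq_bigr => c _.
    by rewrite exprMn exprVn h2.
  have e1 : 0 < 1 + e by rewrite -E; exact: lt_le_trans Zle.
  apply: (@le_trans _ _ (ln (1 + e))).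
    by rewrite ler_ln ?posrE// -E.
  have h' : -1 < e by lra.
  apply: (le_trans (le_ln1Dx h')).
  rewrite /D -/e -subr_ge0.
  have -> : h^-1 + h * e ^+ 2 - e = h^-1 * ((1 - h * e / 2) ^+ 2 + 3 / 4 * (h * e) ^+ 2).
    by field; rewrite gt_eqF.
  by rewrite mulr_ge0 ?(ltW hV)// addr_ge0 ?sqr_ge0// mulr_ge0 ?sqr_ge0.
Qed.

(** The graph of the concave [ln] lies above its chord between [2^-1] and [1]; there is equality at
    [x = 2^-1]. *)
Lemma ln_onem_ge {R : realType} (x : R) : 0 <= x <= 2^-1 -> - (2 * ln 2) * x <= ln (1 - x).
Proof.
move=> /andP[x0 x2].
have i01 : 0 <= 2 * x <= 1 by apply/andP; split; lra.
have t1 : 2 * x <= 1 by lra. have t0 : 0 <= 2 * x by lra.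
have := @concave_ln R (Itv01 t0 t1) 2^-1 1.
rewrite !convRE/= /unstable.onem ln1 mulr0 addr0 mulr1 lnV ?posrE//.
have h0 : 0 < 2^-1 :> R by rewrite invr_gt0.
move=> /(_ h0 ltr01).
rewrite (_ : 2 * x / 2 + (1 - 2 * x) = 1 - x); last by lra.
by apply: le_trans; rewrite le_eqVlt; apply/orP; left; apply/eqP; ring.
Qed.

(** * The lower bound made symmetric in the two dimensions *)

Section gap_bound.
Context {d : measure_display} {T : measurableType d} {R : realType}.
Context {P : probability T R}.

Lemma iid_normal_swap {p q : nat} {X : 'I_p * 'I_q -> T -> R} :
  iid_normal P X -> iid_normal P (fun i => X (i.2, i.1)).
Proof.
move=> [mX PX]; split => [i|V mV]; first exact: mX.
have := PX (fun i => V (i.2, i.1)) (fun i => mV _).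
rewrite (reindex (fun i : 'I_p * 'I_q => (i.2, i.1)))/=; last first.
  by exists (fun i => (i.2, i.1)) => -[].
move=> <-; congr (P _); apply/seteqP; split => w /= H [a b]; exact: (H (b, a)).
Qed.

Lemma bilinear_transpose {p q : nat} (z : 'I_p -> 'I_q -> R) u v :
  bilinear (fun c r => z r c) v u = bilinear z u v.
Proof.
rewrite /bilinear exchange_big; apply: eq_bigr => r _; apply: eq_bigr => c _.
by rewrite mulrC mulrA mulrAC.
Qed.

Lemma rank_one_residual_transpose {p q : nat} (z : 'I_p -> 'I_q -> R) u v :
  rank_one_residual (fun c r => z r c) v u = rank_one_residual z u v.
Proof.
rewrite /rank_one_residual exchange_big bilinear_transpose.
by apply: eq_bigr => r _; apply: eq_bigr => c _; rewrite mulrAC.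
Qed.

(** The supremum over [v] is reached at the normalised vector [k' u], where the bilinear form equals
    [Num.sqrt (projection_sqr k u)]. *)
Lemma projection_sqr_le {p q : nat} (k : 'I_p -> 'I_q -> R) (phi2 : R) (u : 'I_p -> R) :
  0 <= phi2 -> (forall v, \sum_c v c ^+ 2 = 1 -> bilinear k u v ^+ 2 <= phi2) ->
  projection_sqr k u <= phi2.
Proof.
move=> phi0 H; set N := projection_sqr k u.
have N0 : 0 <= N by apply: sumr_ge0 => c _; exact: sqr_ge0.
have [->//|NN] := eqVneq N 0.
have Np : 0 < N by rewrite lt_neqAle eq_sym NN.
have hp : 0 < Num.sqrt N by rewrite sqrtr_gt0.
have h2 : Num.sqrt N ^+ 2 = N by rewrite sqr_sqrtr.
have := H (fun c => (\sum_r u r * k r c) / Num.sqrt N).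
under eq_bigr do rewrite exprMn.
rewrite -mulr_suml -/(projection_sqr k u) -/N exprVn h2 divff// => /(_ erefl).
rewrite bilinearE; under eq_bigr do rewrite mulrA -expr2.
rewrite -mulr_suml -/(projection_sqr k u) -/N.
have -> : N / Num.sqrt N = Num.sqrt N by rewrite -{1}h2 expr2 mulfK ?gt_eqF.
by rewrite h2.
Qed.

(** Subtracting a term for [p] and one for [q] makes the statement invariant under transposition,
    which reduces to [p <= q]. Multiplied by [p * q], the two terms become [2 ln 2 (p + q)], the
    shape of the penalty. *)
Lemma gap_residual_log_ge {p q : nat} {X : 'I_p * 'I_q -> T -> R}
    (k : 'I_p -> 'I_q -> R) (s phi2 : R) :
  iid_normal P X -> (1 < p)%N -> (1 < q)%N ->
  \sum_r \sum_c k r c ^+ 2 = 1 -> 0 <= s -> 0 <= phi2 -> phi2 <= 1 ->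
  (forall u v, \sum_r u r ^+ 2 = 1 -> \sum_c v c ^+ 2 = 1 ->
     bilinear k u v ^+ 2 <= phi2) ->
  let n : R := (p * q)%:R in let h := Num.sqrt n in
  let z w r c := s * k r c + X (r, c) w / h in
  let t := s ^+ 2 * (1 - phi2) in
  let L := ln (1 + t) in
  let eta := h^-1 + s / Num.sqrt h / (1 + t) in
  exists H : T -> \bar R,
  [/\ measurable_fun setT H, forall w, (0 <= H w)%E,
      (\int[P]_w H w <= (16 * (1024 * 297) * (eta * (1 + L * eta)))%:E)%E &
      forall w u v, \sum_r u r ^+ 2 = 1 -> \sum_c v c ^+ 2 = 1 ->
        (rank_one_residual (z w) u v = 0 -> H w = +oo%E) /\
        (0 < rank_one_residual (z w) u v ->
         ((L - 2 * ln 2 / p%:R - 2 * ln 2 / q%:R)%:E - H w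
           <= (ln (rank_one_residual (z w) u v))%:E)%E)].
Proof.
wlog pq : p q X k / (p <= q)%N.
  move=> W iidX p1 q1 k1 s0 phi0 phi1 kphi n h z t L eta.
  have [pq|/ltnW qp] := leqP p q; first exact: W.
  have k1' : \sum_c \sum_r k r c ^+ 2 = 1 by rewrite exchange_big.
  have kphi' u v : \sum_r u r ^+ 2 = 1 -> \sum_c v c ^+ 2 = 1 ->
      bilinear (fun c r => k r c) u v ^+ 2 <= phi2.
    by move=> u1 v1; rewrite bilinear_transpose; exact: kphi.
  have [H [mH H0 EH HZ]] := W q p _ (fun c r => k r c) qp (iid_normal_swap iidX)
    q1 p1 k1' s0 phi0 phi1 kphi'.
  exists H; split => //; first by move: EH; rewrite mulnC.
  move=> w u v u1 v1; have := HZ w v u v1 u1.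
  rewrite /= mulnC -/n -/h rank_one_residual_transpose -/t -/L.
  by rewrite [in X in X -> _]addrAC.
move=> iidX p1 q1 k1 s0 phi0 phi1 kphi n h z t L eta.
have kphi' u : \sum_r u r ^+ 2 = 1 -> projection_sqr k u <= phi2.
  by move=> u1; apply: projection_sqr_le => // v; exact: kphi.
have [H [mH H0 EH HZ]] := residual_log_ge iidX p1 q1 k s k1 s0 phi2 phi1 pq kphi'.
exists H; split => // w u v u1 v1; have [HZ1 HZ2] := HZ w u v u1 v1; split => // /HZ2.
apply: le_trans; rewrite leeD2r// lee_fin.
have t0 : 0 <= t by rewrite mulr_ge0 ?sqr_ge0// subr_ge0.
have pV : p%:R^-1 <= 2^-1 :> R by rewrite lef_pV2 ?posrE ?ltr0n ?(ltnW p1)// ler_nat.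
have pV0 : 0 < p%:R^-1 :> R by rewrite invr_gt0 ltr0n ltnW.
have l2 : 0 <= 2 * ln 2 / q%:R :> R.
  by rewrite divr_ge0// mulr_ge0// ln_ge0// ler1n.
have lp : - (2 * ln 2) * p%:R^-1 <= ln (1 - p%:R^-1) :> R.
  by apply: ln_onem_ge; rewrite (ltW pV0).
(* [(1 + t) * (1 - p^-1) <= 1 - p^-1 + t] separates the dimensional loss from the signal. *)
apply: (@le_trans _ _ (L + ln (1 - p%:R^-1))); first by rewrite mulNr in lp; lra.
have t1 : 0 < 1 + t by lra.
have p1' : 0 < 1 - p%:R^-1 :> R by lra.
rewrite /L -lnM// ler_ln ?posrE ?mulr_gt0//; rewrite -/t; [nra|lra].
Qed.

End gap_bound.

(** * Spectral norm and existence of leading singular vectors *)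

Section spectral_norm.
Context {R : realType}.
Implicit Types (u v : nat -> R) (C : nat -> nat -> R).

Lemma vnorm2_ord p u : vnorm2 p u = \sum_(r < p) u r ^+ 2.
Proof. by rewrite /vnorm2 big_mkord. Qed.

Lemma bilin_ord p q C u v : bilin p q C u v =
  bilinear (fun (r : 'I_p) (c : 'I_q) => C r c) (fun r => u r) (fun c => v c).
Proof.
by rewrite /bilin big_mkord; apply: eq_bigr => r _; rewrite big_mkord.
Qed.

Lemma frob2_ord p q C : frob2 p q C = \sum_(r < p) \sum_(c < q) C r c ^+ 2.
Proof.
by rewrite /frob2 big_mkord; apply: eq_bigr => r _; rewrite big_mkord.
Qed.

Lemma bilin_sqr_le_frob2 p q C u v : vnorm2 p u = 1 -> vnorm2 q v = 1 ->
  bilin p q C u v ^+ 2 <= frob2 p q C.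
Proof.
rewrite !vnorm2_ord bilin_ord frob2_ord => u1 v1.
apply: (le_trans (bilinear_sqr_le _ _ _ v1)).
rewrite exchange_big/=; apply: ler_sum => c _.
by apply: (le_trans (cauchy_schwarz _ _)); rewrite u1 mul1r.
Qed.

Let values p q C := [set x : R | exists u v, vnorm2 p u = 1 /\ vnorm2 q v = 1 /\
                               x = bilin p q C u v].

Let values_ubound p q C : has_ubound (values p q C).
Proof.
exists (1 + frob2 p q C) => _ [u [v [u1 [v1 ->]]]].
have := bilin_sqr_le_frob2 p q C u v u1 v1; nra.
Qed.

Lemma bilin_le_specnorm p q C u v : vnorm2 p u = 1 -> vnorm2 q v = 1 ->
  bilin p q C u v <= specnorm p q C.
Proof. by move=> u1 v1; apply: (ub_le_sup (values_ubound p q C)); exists u, v. Qed.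

Lemma bilin_sqr_le_specnorm p q C u v : vnorm2 p u = 1 -> vnorm2 q v = 1 ->
  bilin p q C u v ^+ 2 <= specnorm p q C ^+ 2.
Proof.
move=> u1 v1; have b1 := bilin_le_specnorm p q C u v u1 v1.
have u1' : vnorm2 p (fun i => - u i) = 1.
  by rewrite -u1; apply: eq_bigr => i _; rewrite sqrrN.
have := bilin_le_specnorm p q C _ v u1' v1.
have -> : bilin p q C (fun i => - u i) v = - bilin p q C u v.
  rewrite /bilin -sumrN; apply: eq_bigr => i _; rewrite -sumrN.
  by apply: eq_bigr => j _; rewrite !mulNr.
by move=> b2; nra.
Qed.

Lemma unit_vector_exists p : (0 < p)%N -> exists u, vnorm2 p u = 1.
Proof.
case: p => // p _; exists (fun i => (i == 0%N)%:R).
by rewrite vnorm2_ord big_ord_recl/= expr1n big1 ?addr0// => i _; rewrite expr0n.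
Qed.

Lemma specnorm_ge0 p q C : (0 < p)%N -> (0 < q)%N -> 0 <= specnorm p q C.
Proof.
move=> /unit_vector_exists[u u1] /unit_vector_exists[v v1].
have b1 := bilin_le_specnorm p q C u v u1 v1.
have u1' : vnorm2 p (fun i => - u i) = 1.
  by rewrite -u1; apply: eq_bigr => i _; rewrite sqrrN.
have := bilin_le_specnorm p q C _ v u1' v1.
have -> : bilin p q C (fun i => - u i) v = - bilin p q C u v.
  rewrite /bilin -sumrN; apply: eq_bigr => i _; rewrite -sumrN.
  by apply: eq_bigr => j _; rewrite !mulNr.
by lra.
Qed.

Lemma specnorm_le1 p q C : (0 < p)%N -> (0 < q)%N ->
  frob2 p q C = 1 -> specnorm p q C <= 1.
Proof.
move=> /unit_vector_exists[u u1] /unit_vector_exists[v v1] C1.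
apply: ge_sup; first by exists (bilin p q C u v), u, v.
move=> _ [u' [v' [u1' [v1' ->]]]].
by have := bilin_sqr_le_frob2 p q C u' v' u1' v1'; rewrite C1; nra.
Qed.

Lemma continuous_sqr {T : topologicalType} (f : T -> R) :
  continuous f -> continuous (fun x => f x ^+ 2).
Proof.
move=> cf x; apply: (@continuous_comp _ _ _ f (fun y : R => y ^+ 2)); first exact: cf.
exact: exprn_continuous.
Qed.

Lemma continuous_sphere_fun p :
  continuous (fun x : 'rV[R]_p => \sum_r x ord0 r ^+ 2).
Proof.
apply: continuous_big => [|r _]; first exact: add_continuous.
by apply: continuous_sqr; exact: coord_continuous.
Qed.

Lemma compact_sphere p : compact [set x : 'rV[R]_p | \sum_r x ord0 r ^+ 2 = 1].
Proof.
apply: bounded_closed_compact.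
  exists 1; split => // M M1 x /= x1; apply: le_trans (ltW M1).
  rewrite [leLHS]mx_normrE; apply: bigmax_le => // -[i r] _ /=; rewrite ord1.
  rewrite -(@ler_pXn2r _ 2) ?nnegrE// real_normK ?num_real// expr1n -x1.
  by rewrite (bigD1 r)//= lerDl sumr_ge0// => j _; exact: sqr_ge0.
apply: (@preimage_closed _ _ (fun x : 'rV[R]_p => \sum_r x ord0 r ^+ 2) [set y | y = 1]).
  move=> x _; apply: continuous_sphere_fun.
exact: closed_eq.
Qed.

(** The continuous map [u |-> |C' u|^2] attains its maximum on the compact sphere, and [v] is the
    normalised [C' u], or any unit vector if that vanishes. This gives the choice operator in
    [lead_sv] something to select. *)
Lemma bilin_specnorm_attained p q C : (0 < p)%N -> (0 < q)%N ->
  exists uv : (nat -> R) * (nat -> R), vnorm2 p uv.1 = 1 /\ vnorm2 q uv.2 = 1 /\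
    bilin p q C uv.1 uv.2 = specnorm p q C.
Proof.
move=> p0 q0; pose z (r : 'I_p) (c : 'I_q) := C r c.
pose f (x : 'rV[R]_p) := projection_sqr z (fun r => x ord0 r).
have cf : continuous f.
  apply: continuous_big => [|c _]; first exact: add_continuous.
  apply: continuous_sqr; apply: continuous_big => [|r _ y]; first exact: add_continuous.
  by apply: continuousM; [exact: coord_continuous|exact: cst_continuous].
have S0 : [set x : 'rV[R]_p | \sum_r x ord0 r ^+ 2 = 1] !=set0.
  have [u u1] := unit_vector_exists p p0; exists (\row_r u r) => /=.
  by rewrite -u1 vnorm2_ord; apply: eq_bigr => r _; rewrite mxE.
have [x /[!inE]/= x1 xmax] := EVT_max_rV S0 (compact_sphere p) (continuous_subspaceT cf).
pose ext n (g : 'I_n -> R) (i : nat) : R :=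
  if insub i is Some r then g r else 0.
have extE n (g : 'I_n -> R) (i : 'I_n) : ext n g i = g i by rewrite /ext valK.
pose u := ext p (fun r => x ord0 r).
have u1 : vnorm2 p u = 1.
  by rewrite vnorm2_ord -x1; apply: eq_bigr => r _; rewrite /u extE.
have uE : (fun r : 'I_p => u r) = (fun r => x ord0 r) by apply/funext => r; rewrite /u extE.
have fmax u' v' : vnorm2 p u' = 1 -> vnorm2 q v' = 1 -> bilin p q C u' v' ^+ 2 <= f x.
  rewrite !vnorm2_ord bilin_ord => u1' v1'.
  apply: (le_trans (bilinear_sqr_le _ _ _ v1')).
  have := xmax (\row_r u' r); rewrite inE/= => /(_ _).
  have -> : f (\row_r u' r) = projection_sqr z (fun r => u' r).
    by rewrite /f; congr projection_sqr; apply/funext => r; rewrite mxE.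
  by apply; rewrite -u1'; apply: eq_bigr => r _; rewrite mxE.
have N0 : 0 <= f x by apply: sumr_ge0 => c _; exact: sqr_ge0.
have [v [v1 uv]] : exists v, vnorm2 q v = 1 /\ bilin p q C u v = Num.sqrt (f x).
  have [Nz|NN] := eqVneq (f x) 0.
    have [v v1] := unit_vector_exists q q0; exists v; split => //.
    by have := fmax u v u1 v1; rewrite Nz sqrtr0 => h; apply/eqP; rewrite -sqrf_eq0 eq_le h sqr_ge0.
  have Np : 0 < f x by rewrite lt_neqAle eq_sym NN.
  exists (ext q (fun c => (\sum_(r < p) u r * z r c) / Num.sqrt (f x))).
  have fE : \sum_c (\sum_(r < p) u r * z r c) ^+ 2 = f x.
    by rewrite /f -uE.
  rewrite vnorm2_ord bilin_ord bilinearE; split.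
    under eq_bigr do rewrite extE exprMn.
    by rewrite -mulr_suml fE exprVn sqr_sqrtr// divff.
  under eq_bigr do rewrite extE mulrA -expr2.
  rewrite -mulr_suml fE -{1}(sqr_sqrtr N0) expr2 mulfK// gt_eqF// sqrtr_gt0//.
exists (u, v); split => //; split => //=.
apply/eqP; rewrite eq_le bilin_le_specnorm//= uv.
apply: ge_sup; first by exists (bilin p q C u v), u, v.
move=> _ [u' [v' [u1' [v1' ->]]]].
have := fmax u' v' u1' v1'; rewrite -{1}(sqr_sqrtr N0) => h.
have := sqrtr_ge0 (f x); nra.
Qed.

Lemma lead_svP p q C : (0 < p)%N -> (0 < q)%N ->
  let uv := lead_sv p q C in
  vnorm2 p uv.1 = 1 /\ vnorm2 q uv.2 = 1 /\ bilin p q C uv.1 uv.2 = specnorm p q C.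
Proof.
move=> p0 q0; rewrite /lead_sv.
apply: (epsilon_spec (inhabits ((fun=> 0), (fun=> 0))) (fun uv => vnorm2 p uv.1 = 1 /\
  vnorm2 q uv.2 = 1 /\ bilin p q C uv.1 uv.2 = specnorm p q C)).
exact: bilin_specnorm_attained.
Qed.

End spectral_norm.

(** * Rearrangement as a permutation of entries *)

Section rearrangement.
Context {M N m n : nat} (mM : (m <= M)%N) (nN : (n <= N)%N).
Local Notation p := (2 ^ (m + n))%N.
Local Notation q := (2 ^ (M + N - m - n))%N.

(** In mixed radix, [r = (i, j)] and [c = (k, l)] become the row [(i, k)] and the column [(j, l)]:
    the two middle digits are exchanged, so the inverse has the same shape. *)
Definition block_row (r c : nat) : nat :=
  (r %/ 2 ^ n * 2 ^ (M - m) + c %/ 2 ^ (N - n))%N.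
Definition block_col (r c : nat) : nat :=
  (r %% 2 ^ n * 2 ^ (N - n) + c %% 2 ^ (N - n))%N.

Lemma mixed_radix_lt (a b x y : nat) : (x < a)%N -> (y < b)%N -> (x * b + y < a * b)%N.
Proof.
move=> xa yb; apply: (@leq_trans (x.+1 * b)); first by rewrite mulSn addnC ltn_add2r.
by rewrite leq_mul2r xa orbT.
Qed.

Let pE : p = (2 ^ m * 2 ^ n)%N. Proof. by rewrite expnD. Qed.
Let qE : q = (2 ^ (M - m) * 2 ^ (N - n))%N.
Proof. by rewrite -expnD; congr (2 ^ _)%N; lia. Qed.
Let ME : (2 ^ M = 2 ^ m * 2 ^ (M - m))%N.
Proof. by rewrite -expnD; congr (2 ^ _)%N; lia. Qed.
Let NE : (2 ^ N = 2 ^ n * 2 ^ (N - n))%N.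
Proof. by rewrite -expnD; congr (2 ^ _)%N; lia. Qed.

Lemma block_row_lt r c : (r < p)%N -> (c < q)%N -> (block_row r c < 2 ^ M)%N.
Proof.
move=> rp cq; rewrite ME; apply: mixed_radix_lt; rewrite ltn_divLR ?expn_gt0//.
  by rewrite -pE.
by rewrite -qE.
Qed.

Lemma block_col_lt r c : (block_col r c < 2 ^ N)%N.
Proof. by rewrite NE; apply: mixed_radix_lt; rewrite ltn_mod expn_gt0. Qed.

Definition block_index (i : 'I_p * 'I_q) : 'I_(2 ^ M) * 'I_(2 ^ N) :=
  (Ordinal (block_row_lt i.1 i.2 (ltn_ord i.1) (ltn_ord i.2)),
   Ordinal (block_col_lt i.1 i.2)).

Let inv_row (x y : nat) : nat := (x %/ 2 ^ (M - m) * 2 ^ n + y %/ 2 ^ (N - n))%N.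
Let inv_col (x y : nat) : nat := (x %% 2 ^ (M - m) * 2 ^ (N - n) + y %% 2 ^ (N - n))%N.

Let inv_row_lt x y : (x < 2 ^ M)%N -> (y < 2 ^ N)%N -> (inv_row x y < p)%N.
Proof.
move=> xM yN; rewrite pE; apply: mixed_radix_lt; rewrite ltn_divLR ?expn_gt0//.
  by rewrite -ME.
by rewrite -NE.
Qed.

Let inv_col_lt x y : (inv_col x y < q)%N.
Proof. by rewrite qE; apply: mixed_radix_lt; rewrite ltn_mod expn_gt0. Qed.

Lemma divn_mixed_radix b x y : (y < b)%N -> ((x * b + y) %/ b = x)%N.
Proof. by move=> yb; rewrite divnMDl ?(leq_ltn_trans _ yb)// divn_small ?addn0. Qed.

Lemma modn_mixed_radix b x y : (y < b)%N -> ((x * b + y) %% b = y)%N.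
Proof. by move=> yb; rewrite modnMDl modn_small. Qed.

Lemma bij_block_index : bijective block_index.
Proof.
exists (fun i : 'I_(2 ^ M) * 'I_(2 ^ N) => (Ordinal (inv_row_lt i.1 i.2 (ltn_ord i.1) (ltn_ord i.2)),
   Ordinal (inv_col_lt i.1 i.2))).
- move=> [r c]; congr pair; apply/val_inj => /=; rewrite /inv_row /inv_col /block_row /block_col.
    rewrite !divn_mixed_radix ?ltn_mod ?expn_gt0// -?divn_eq//.
    by rewrite ltn_divLR ?expn_gt0// -qE.
  rewrite !modn_mixed_radix ?ltn_mod ?expn_gt0// -?divn_eq//.
  by rewrite ltn_divLR ?expn_gt0// -qE.
- move=> [x y]; congr pair; apply/val_inj => /=; rewrite /inv_row /inv_col /block_row /block_col.
    rewrite !divn_mixed_radix ?ltn_mod ?expn_gt0// -?divn_eq//.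
    by rewrite ltn_divLR ?expn_gt0// -NE.
  rewrite !modn_mixed_radix ?ltn_mod ?expn_gt0// -?divn_eq//.
  by rewrite ltn_divLR ?expn_gt0// -NE.
Qed.

Lemma rearr_block_index {R : realType} (C : nat -> nat -> R) (i : 'I_p * 'I_q) :
  rearr M N m n C i.1 i.2 = C (block_index i).1 (block_index i).2.
Proof. by []. Qed.

Lemma big_block_index {V : Type} {idx : V} {op : Monoid.com_law idx}
    (F : 'I_(2 ^ M) * 'I_(2 ^ N) -> V) :
  \big[op/idx]_j F j = \big[op/idx]_i F (block_index i).
Proof.
by rewrite (reindex block_index)//=; apply: onW_bij; exact: bij_block_index.
Qed.

Lemma frob2_rearr {R : realType} (C : nat -> nat -> R) :
  frob2 (2 ^ M)%N (2 ^ N)%N C = frob2 p q (rearr M N m n C).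
Proof.
rewrite !frob2_ord !pair_bigA/=.
exact: (big_block_index (fun j => C j.1 j.2 ^+ 2)).
Qed.

Lemma iid_normal_rearr {d} {T : measurableType d} {R : realType} (P : probability T R)
    (E : T -> nat -> nat -> R) :
  (forall i j, measurable_fun setT (fun w => E w i j)) ->
  (forall i j V, measurable V ->
     P ((fun w => E w i j) @^-1` V) = normal_prob 0 1 V) ->
  (forall (V : nat -> nat -> set R), (forall i j, measurable (V i j)) ->
     (P (\bigcap_(i in `I_(2 ^ M)%N) \bigcap_(j in `I_(2 ^ N)%N)
          ((fun w => E w i j) @^-1` V i j))
     = \prod_(0 <= i < 2 ^ M) \prod_(0 <= j < 2 ^ N)
          P ((fun w => E w i j) @^-1` V i j))%E) ->
  iid_normal P (fun (i : 'I_p * 'I_q) w => rearr M N m n (E w) i.1 i.2).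
Proof.
move=> mE nE indE; split => [i|V mV]; first exact: mE.
have [g gK Kg] := bij_block_index.
pose V' (x y : nat) : set R :=
  if insub x is Some x' then if insub y is Some y' then V (g (x', y')) else setT else setT.
have mV' x y : measurable (V' x y).
  by rewrite /V'; case: insubP => // ? _ _; case: insubP => // ? _ _; exact: mV.
have V'E (j : 'I_(2 ^ M) * 'I_(2 ^ N)) : V' j.1 j.2 = V (g j).
  by rewrite /V' !valK; case: j.
have := indE V' mV'.
have -> : \bigcap_(i in `I_(2 ^ M)) \bigcap_(j in `I_(2 ^ N))
    ((fun w => E w i j) @^-1` V' i j) =
    [set w | forall i : 'I_p * 'I_q, V i (rearr M N m n (E w) i.1 i.2)].
  apply/seteqP; split => w /= H.
    move=> i; rewrite rearr_block_index -[i in V i]gK -V'E.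
    exact: (H _ (ltn_ord _) _ (ltn_ord _)).
  move=> x xM y yN; have := H (g (Ordinal xM, Ordinal yN)).
  by rewrite rearr_block_index Kg -V'E.
move=> ->; rewrite big_mkord.
under eq_bigr do rewrite big_mkord.
rewrite pair_bigA/= (big_block_index (fun j => P ((fun w => E w j.1 j.2) @^-1` V' j.1 j.2))).
by apply: eq_bigr => i _; rewrite V'E gK nE.
Qed.

Section fit.
Context {R : realType} (Y : nat -> nat -> R).
Let z (r : 'I_p) (c : 'I_q) := rearr M N m n Y r c.
Let residual :=
  frob2 (2 ^ M)%N (2 ^ N)%N (fun x y => Y x y - fitY M N m n Y x y).

Let p0 : (0 < p)%N. Proof. by rewrite expn_gt0. Qed.
Let q0 : (0 < q)%N. Proof. by rewrite expn_gt0. Qed.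

Lemma fit_residualE : exists u v,
  [/\ \sum_r u r ^+ 2 = 1, \sum_c v c ^+ 2 = 1,
      residual = rank_one_residual z u v &
      bilinear z u v = specnorm p q (rearr M N m n Y)].
Proof.
have [u1 [v1 uv]] := lead_svP p q (rearr M N m n Y) p0 q0.
set lu := lead_sv _ _ _ in u1 v1 uv.
exists (fun r : 'I_p => lu.1 r), (fun c : 'I_q => lu.2 c); split.
- by rewrite -vnorm2_ord.
- by rewrite -vnorm2_ord.
- rewrite /residual frob2_rearr frob2_ord /rank_one_residual.
  apply: eq_bigr => r _; apply: eq_bigr => c _; congr (_ ^+ 2).
  rewrite /rearr /fitY -/lu /kron /unvec; congr (_ - _).
  rewrite !divn_mixed_radix ?modn_mixed_radix ?ltn_mod ?expn_gt0// -?divn_eq//; last 2 first.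
    by rewrite ltn_divLR ?expn_gt0// -qE.
    by rewrite ltn_divLR ?expn_gt0// -qE.
  by rewrite mulrA -uv bilin_ord.
- by rewrite -uv bilin_ord.
Qed.

(** Rank-one case of the Eckart-Young theorem: the distance is the squared norm minus
    [2 * l * b - l ^+ 2], which is at most [b ^+ 2] and hence at most the squared spectral norm. *)
Lemma fit_residual_le (l : R) (u v : nat -> R) : vnorm2 p u = 1 -> vnorm2 q v = 1 ->
  residual <= \sum_(r < p) \sum_(c < q) (z r c - l * u r * v c) ^+ 2.
Proof.
have [u' [v' [u1' v1' -> bl]]] := fit_residualE.
move=> u1 v1; have := bilin_sqr_le_specnorm p q (rearr M N m n Y) u v u1 v1.
rewrite -bl bilin_ord rank_one_residualE// rank_one_distance -?vnorm2_ord//.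
rewrite -/z; set b := bilinear z _ _; set b' := bilinear z u' v'.
by have := sqr_ge0 (l - b); nra.
Qed.

End fit.

End rearrangement.

Lemma rank_one_residualZ {R : realType} {p q : nat} (s : R) (z : 'I_p -> 'I_q -> R) u v :
  rank_one_residual (fun r c => s * z r c) u v = s ^+ 2 * rank_one_residual z u v.
Proof.
have E : bilinear (fun r c => s * z r c) u v = s * bilinear z u v.
  rewrite /bilinear mulr_sumr; apply: eq_bigr => r _; rewrite mulr_sumr.
  by apply: eq_bigr => c _; ring.
rewrite /rank_one_residual E [RHS]mulr_sumr; apply: eq_bigr => r _.
by rewrite [RHS]mulr_sumr; apply: eq_bigr => c _; ring.
Qed.

Lemma rearr_kron {R : realType} (M N m n : nat) (A B : nat -> nat -> R) r c :
  (m <= M)%N -> (n <= N)%N -> (c < 2 ^ (M + N - m - n))%N ->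
  rearr M N m n (kron (2 ^ (M - m)) (2 ^ (N - n)) A B) r c =
  A (r %/ 2 ^ n)%N (r %% 2 ^ n)%N * B (c %/ 2 ^ (N - n))%N (c %% 2 ^ (N - n))%N.
Proof.
move=> mM nN cq; have cE : (c %/ 2 ^ (N - n) < 2 ^ (M - m))%N.
  by rewrite ltn_divLR ?expn_gt0// -expnD; apply: leq_trans cq _; rewrite leq_exp2l//; lia.
rewrite /rearr /kron !divn_mixed_radix ?modn_mixed_radix ?ltn_mod ?expn_gt0//.
Qed.

Lemma vnorm2_vec {R : realType} (a b : nat) (A : nat -> nat -> R) :
  vnorm2 (a * b) (fun i => A (i %/ b)%N (i %% b)%N) = frob2 a b A.
Proof.
rewrite /vnorm2 /frob2 big_nat_mul; apply: eq_big_nat => i _.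
rewrite -{1}[(i * b)%N]add0n mulSn big_addn addnK; apply: eq_big_nat => j /= jb.
by rewrite addnC divn_mixed_radix// modn_mixed_radix.
Qed.

Lemma bilinear_sqr_le_specnorm {R : realType} p q (C : nat -> nat -> R)
    (u : 'I_p -> R) (v : 'I_q -> R) : \sum_r u r ^+ 2 = 1 -> \sum_c v c ^+ 2 = 1 ->
  bilinear (fun (r : 'I_p) (c : 'I_q) => C r c) u v ^+ 2 <= specnorm p q C ^+ 2.
Proof.
pose ext n (g : 'I_n -> R) (i : nat) : R := if insub i is Some r then g r else 0.
have extE n (g : 'I_n -> R) : (fun i : 'I_n => ext n g i) = g.
  by apply/funext => i; rewrite /ext valK.
move=> u1 v1; have := bilin_sqr_le_specnorm p q C (ext p u) (ext q v).
rewrite bilin_ord !vnorm2_ord (extE p u) (extE q v).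
rewrite (eq_bigr (fun r => u r ^+ 2)); last by move=> r _; rewrite -[in RHS](extE p u).
rewrite [X in _ -> X = _ -> _](eq_bigr (fun r => v r ^+ 2)); last by move=> r _; rewrite -[in RHS](extE q v).
by apply.
Qed.

Section integral_comparison.
Context {d : measure_display} {T : measurableType d} {R : realType}.
Context {P : probability T R}.
Variables (f : T -> R) (H : T -> \bar R) (a c : R).
Hypotheses (mH : measurable_fun setT H) (H0 : forall w, (0 <= H w)%E).
Hypothesis Hc : (\int[P]_w H w <= c%:E)%E.

Let iH : P.-integrable setT H.
Proof.
apply/integrableP; split => //; under eq_integral do rewrite gee0_abs//.
by rewrite (le_lt_trans Hc) ?ltry.
Qed.

Let ia : P.-integrable setT (fun=> a%:E : \bar R).
Proof. exact: finite_measure_integrable_cst. Qed.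

Let Ea : (\int[P]_w a%:E = a%:E)%E.
Proof. by rewrite integral_cst// [X in (_ * X)%E](probability_setT P) mule1. Qed.

Lemma integral_ge_cstB : (forall w, (a%:E - H w <= (f w)%:E)%E) ->
  ((a - c)%:E <= \int[P]_w (f w)%:E)%E.
Proof.
move=> aHf; apply: (@le_trans _ _ (\int[P]_w (a%:E - H w))%E).
  by rewrite (integralB measurableT ia iH) Ea EFinB leeB.
exact: integral_monotone.
Qed.

Lemma integral_le_cstD : (forall w, ((f w)%:E <= a%:E + H w)%E) ->
  (\int[P]_w (f w)%:E <= (a + c)%:E)%E.
Proof.
move=> faH; apply: (@le_trans _ _ (\int[P]_w (a%:E + H w))%E).
  exact: integral_monotone.
by rewrite (integralD measurableT ia iH) Ea EFinD leeD2l.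
Qed.

End integral_comparison.

(** * Expected criterion at a fixed configuration *)

Section configuration.
Context {d : measure_display} {T : measurableType d} {R : realType}.
Context {P : probability T R} {M N m0 n0 : nat}.
Hypotheses (mM0 : (m0 <= M)%N) (nN0 : (n0 <= N)%N).
Variables A B : nat -> nat -> R.
Hypothesis A1 : frob2 (2 ^ m0) (2 ^ n0) A = 1.
Hypothesis B1 : frob2 (2 ^ (M - m0)) (2 ^ (N - n0)) B = 1.
Let K := kron (2 ^ (M - m0)) (2 ^ (N - n0)) A B.
Let phi : R := phi_gap M N m0 n0 A B.

Let rank_one_K r c : (c < 2 ^ (M + N - m0 - n0))%N ->
  rearr M N m0 n0 K r c = A (r %/ 2 ^ n0)%N (r %% 2 ^ n0)%N
    * B (c %/ 2 ^ (N - n0))%N (c %% 2 ^ (N - n0))%N.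
Proof. exact: rearr_kron. Qed.

Let uA i := A (i %/ 2 ^ n0)%N (i %% 2 ^ n0)%N.
Let vB i := B (i %/ 2 ^ (N - n0))%N (i %% 2 ^ (N - n0))%N.

Let uA1 : vnorm2 (2 ^ (m0 + n0)) uA = 1.
Proof. by rewrite expnD vnorm2_vec. Qed.

Let vB1 : vnorm2 (2 ^ (M + N - m0 - n0)) vB = 1.
Proof.
rewrite (_ : (2 ^ (M + N - m0 - n0) = 2 ^ (M - m0) * 2 ^ (N - n0))%N) ?vnorm2_vec//.
by rewrite -expnD; congr (2 ^ _)%N; lia.
Qed.

Let K1 : frob2 (2 ^ M) (2 ^ N) K = 1.
Proof.
rewrite (frob2_rearr mM0 nN0) frob2_ord.
under eq_bigr => r _ do under eq_bigr => c _ do rewrite rank_one_K// exprMn.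
under eq_bigr => r _ do rewrite -mulr_sumr -(vnorm2_ord _ vB) vB1 mulr1.
by rewrite -(vnorm2_ord _ uA) uA1.
Qed.

Let phi0 : 0 <= phi. Proof. exact: bigmax_ge_id. Qed.

Let specnorm_K m n : (m <= M)%N -> (n <= N)%N ->
  specnorm (2 ^ (m + n)) (2 ^ (M + N - m - n)) (rearr M N m n K) <= 1.
Proof. by move=> mM nN; apply: specnorm_le1; rewrite ?expn_gt0// -frob2_rearr. Qed.

Let phi1 : phi <= 1.
Proof.
apply: bigmax_le => // m _; apply: bigmax_le => // n _; apply: specnorm_K.
  by rewrite -ltnS.
by rewrite -ltnS.
Qed.

Lemma psi_gap_sqr : psi_gap M N m0 n0 A B ^+ 2 = 1 - phi ^+ 2.
Proof. by rewrite sqr_sqrtr// subr_ge0 expr_le1. Qed.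

Lemma psi_gap_le1 : psi_gap M N m0 n0 A B <= 1.
Proof.
rewrite -(@ler_pXn2r _ 2) ?nnegrE ?sqrtr_ge0// psi_gap_sqr expr1n.
by have := sqr_ge0 phi; lra.
Qed.

Let specnorm_wrong m n : wrong M N m0 n0 (m, n) ->
  specnorm (2 ^ (m + n)) (2 ^ (M + N - m - n)) (rearr M N m n K) <= phi.
Proof.
move=> W; have /andP[/and4P[/= mM nN _ _] _] := W.
have m1 : (m < M.+1)%N by []. have n1 : (n < N.+1)%N by [].
apply: le_trans (le_bigmax _ _ (Ordinal m1)) => /=.
exact: (@le_bigmax_cond _ R _ 0 (Ordinal n1)
  (fun n : 'I_N.+1 => wrong M N m0 n0 (m, n : nat))
  (fun n : 'I_N.+1 =>
    specnorm (2 ^ (m + n)) (2 ^ (M + N - m - n)) (rearr M N m n K))).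
Qed.

Variables (lam sigma kappa : R) (E : T -> nat -> nat -> R).
Hypotheses (lam0 : 0 < lam) (sigma0 : 0 < sigma).
Hypothesis mE : forall i j, measurable_fun setT (fun w => E w i j).
Hypothesis nE : forall i j V, measurable V ->
     P ((fun w => E w i j) @^-1` V) = normal_prob 0 1 V.
Hypothesis indE : forall (V : nat -> nat -> set R), (forall i j, measurable (V i j)) ->
     (P (\bigcap_(i in `I_(2 ^ M)%N) \bigcap_(j in `I_(2 ^ N)%N)
          ((fun w => E w i j) @^-1` V i j))
     = \prod_(0 <= i < 2 ^ M) \prod_(0 <= j < 2 ^ N)
          P ((fun w => E w i j) @^-1` V i j))%E.

Let Y w (x y : nat) : R :=
  lam * K x y + sigma * (2 : R) `^ (- ((M + N)%:R / 2)) * E w x y.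
Let D : R := (2 ^ (M + N))%:R.
Let h : R := Num.sqrt D.
Let s : R := lam / sigma.
Let t : R := s ^+ 2 * psi_gap M N m0 n0 A B ^+ 2.
Let L : R := ln (1 + t).
Let eta : R := h^-1 + s / Num.sqrt h / (1 + t).

Let D0 : 0 < D. Proof. by rewrite ltr0n expn_gt0. Qed.
Let s0 : 0 <= s. Proof. by rewrite divr_ge0 ?ltW. Qed.
Let sigma2 : 0 < sigma ^+ 2. Proof. by rewrite exprn_gt0. Qed.

Section fixed_sizes.
Context {m n : nat} (mM : (m <= M)%N) (nN : (n <= N)%N).
Local Notation p := (2 ^ (m + n))%N.
Local Notation q := (2 ^ (M + N - m - n))%N.

Let pq : (p * q)%N = (2 ^ (M + N))%N.
Proof. by rewrite -expnD; congr (2 ^ _)%N; lia. Qed.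

Let X (i : 'I_p * 'I_q) w := rearr M N m n (E w) i.1 i.2.
Let k (r : 'I_p) (c : 'I_q) := rearr M N m n K r c.
Let z w r c := s * k r c + X (r, c) w / h.

Let iidX : iid_normal P X. Proof. exact: iid_normal_rearr. Qed.

Let hV : (2 : R) `^ (- ((M + N)%:R / 2)) = h^-1.
Proof.
rewrite powRN; congr (_^-1); rewrite powRrM powR12_sqrt ?powR_ge0//.
by rewrite powR_mulrn// /h /D natrX.
Qed.

Let residual w :=
  frob2 (2 ^ M)%N (2 ^ N)%N (fun x y => Y w x y - fitY M N m n (Y w) x y).

Let zE w : (fun (r : 'I_p) (c : 'I_q) => rearr M N m n (Y w) r c) =
  (fun r c => sigma * z w r c).
Proof.
apply/funext => r; apply/funext => c; rewrite /z /s /X /k /rearr /Y hV.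
by field; rewrite !gt_eqF// sqrtr_gt0.
Qed.

Lemma fit_residual_noise w : exists u v,
  [/\ \sum_r u r ^+ 2 = 1, \sum_c v c ^+ 2 = 1 &
      residual w = sigma ^+ 2 * rank_one_residual (z w) u v].
Proof.
have [u [v [u1 v1 rE _]]] := fit_residualE mM nN (Y w).
by exists u, v; split => //; rewrite -rank_one_residualZ -zE.
Qed.

Let k1 : \sum_r \sum_c k r c ^+ 2 = 1.
Proof. by rewrite -frob2_ord -frob2_rearr. Qed.

Let residual_ge0 u v w : 0 <= rank_one_residual (z w) u v.
Proof. by do 2 (apply: sumr_ge0 => ? _); exact: sqr_ge0. Qed.

Let p1 : (0 < m + n)%N -> (1 < p)%N.
Proof. by move=> mn; rewrite -{1}(expn0 2) ltn_exp2l. Qed.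

Let q1 : (m + n < M + N)%N -> (1 < q)%N.
Proof. by move=> mn; rewrite -{1}(expn0 2) ltn_exp2l//; lia. Qed.

Lemma mean_IC_wrong_ge : wrong M N m0 n0 (m, n) -> 2 * ln 2 <= kappa ->
  ((D * (ln (sigma ^+ 2) + L - 16 * (1024 * 297) * (eta * (1 + L * eta))))%:E
   <= \int[P]_w (IC M N kappa m n (Y w))%:E)%E.
Proof.
move=> W kap.
have kphi u v : \sum_r u r ^+ 2 = 1 -> \sum_c v c ^+ 2 = 1 ->
    bilinear k u v ^+ 2 <= phi ^+ 2.
  move=> u1 v1; apply: (le_trans (bilinear_sqr_le_specnorm p q (rearr M N m n K) u v u1 v1)).
  by rewrite ler_sqr ?nnegrE ?specnorm_ge0 ?expn_gt0 ?specnorm_wrong.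
have W' := W; case/andP: W' => /and4P[_ _ mn0 mnMN] _.
(* Excluding [(0, 0)] and [(M, N)] makes both dimensions of the rearranged matrix at least 2, so
   that 2x2 blocks exist. *)
have mn_gt0 : (0 < m + n)%N.
  by move: mn0; rewrite xpair_eqE negb_and; lia.
have mn_lt : (m + n < M + N)%N.
  by move: mnMN; rewrite xpair_eqE negb_and; lia.
have phi2 : phi ^+ 2 <= 1 by rewrite expr_le1.
have [H [mH H0 EH HZ]] := gap_residual_log_ge k s _ iidX (p1 mn_gt0) (q1 mn_lt)
  k1 s0 (sqr_ge0 phi) phi2 kphi.
rewrite pq -/D -/h -psi_gap_sqr -/t -/L -/eta in EH HZ.
set C := 16 * _ * _ in EH *.
pose l := L - 2 * ln 2 / p%:R - 2 * ln 2 / q%:R.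
pose b := kappa * ((2 ^ (m + n))%N + (2 ^ (M + N - m - n))%N)%:R.
apply: (@le_trans _ _ (D * (ln (sigma ^+ 2) + l) + b - D * C)%:E).
  rewrite lee_fin /l /b natrD.
  have pp : 0 < p%:R :> R by rewrite ltr0n expn_gt0.
  have qp : 0 < q%:R :> R by rewrite ltr0n expn_gt0.
  have DE : D = p%:R * q%:R by rewrite -natrM pq.
  have e1 : D * (2 * ln 2 / p%:R) = 2 * ln 2 * q%:R by rewrite DE; field; rewrite gt_eqF.
  have e2 : D * (2 * ln 2 / q%:R) = 2 * ln 2 * p%:R by rewrite DE; field; rewrite gt_eqF.
  have : 2 * ln 2 * (p%:R + q%:R) <= kappa * (p%:R + q%:R).
    by rewrite ler_pM2r// addr_gt0.
  rewrite !mulrDr !mulrN e1 e2; lra.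
apply: (integral_ge_cstB _ (fun w => D%:E * H w)%E).
- exact: emeasurable_funM.
- by move=> w; rewrite mule_ge0// lee_fin ltW.
- by rewrite EFinM; apply: ge0_le_integralZl => //; exact: ltW.
move=> w; have [u [v [u1 v1 rE]]] := fit_residual_noise w.
have [HZ0 HZ1] := HZ w u v u1 v1.
(* Where the residual vanishes, [ln] returns the uninformative value [0]; there [H] is infinite and
   the left side is [-oo]. *)
have := residual_ge0 u v w; rewrite le_eqVlt => /predU1P[Z0|Z0].
  by rewrite (HZ0 (esym Z0)) gt0_muley ?lte_fin// addeC leNye.
rewrite /IC -/(residual w) rE lnM ?posrE// -/b.
apply: (@le_trans _ _ ((D * ln (sigma ^+ 2) + b)%:E + D%:E * (l%:E - H w))%E).
  rewrite muleBr ?fin_num_adde_defr// -(EFinM D l) addeA -EFinD.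
  rewrite leeD2r// lee_fin; lra.
rewrite mulrDr addrAC (EFinD (D * ln (sigma ^+ 2) + b)) leeD2l//.
rewrite (EFinM D (ln (rank_one_residual _ _ _))) lee_pmul2l ?lte_fin//.
exact: HZ1.
Qed.

(** The competitor [lam * u0 * v0] removes the signal exactly, so the best fit leaves at most the
    energy of the noise. *)
Lemma mean_IC_rank_one_le (u0 v0 : nat -> R) : vnorm2 p u0 = 1 -> vnorm2 q v0 = 1 ->
  (forall r c, k r c = u0 r * v0 c) -> (0 < m + n)%N -> (m + n < M + N)%N ->
  (\int[P]_w (IC M N kappa m n (Y w))%:E <=
   (D * (ln (sigma ^+ 2) + 2000 / h) +
    kappa * ((2 ^ (m + n))%N + (2 ^ (M + N - m - n))%N)%:R)%:E)%E.
Proof.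
move=> u01 v01 kE mn_gt0 mn_lt.
have [H [mH H0 EH HZ]] := residual_log_le iidX (p1 mn_gt0) (q1 mn_lt) k s.
rewrite pq -/D -/h in EH HZ.
set b := kappa * _.
rewrite (_ : D * _ + b = (D * ln (sigma ^+ 2) + b) + D * (2000 / h)); last by ring.
apply: (integral_le_cstD _ (fun w => D%:E * H w)%E).
- exact: emeasurable_funM.
- by move=> w; rewrite mule_ge0// lee_fin ltW.
- by rewrite (EFinM D); apply: ge0_le_integralZl => //; exact: ltW.
move=> w; have [u [v [u1 v1 rE]]] := fit_residual_noise w.
have [HZ0 HZ1] := HZ w u v.
have := residual_ge0 u v w; rewrite le_eqVlt => /predU1P[Z0|Z0].
  by rewrite (HZ0 (esym Z0)) gt0_muley ?lte_fin// addey// leey.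
have Zle : rank_one_residual (z w) u v <= \sum_r \sum_c (X (r, c) w / h) ^+ 2.
  rewrite -(ler_pM2l sigma2) -rE.
  apply: (le_trans (fit_residual_le mM nN (Y w) lam u0 v0 u01 v01)).
  rewrite le_eqVlt; apply/orP; left; apply/eqP.
  rewrite mulr_sumr; apply: eq_bigr => r _; rewrite mulr_sumr; apply: eq_bigr => c _.
  have -> : rearr M N m n (Y w) r c = sigma * z w r c.
    exact: (congr1 (fun g => g r c) (zE w)).
  rewrite /z kE /s; field.
  by rewrite !gt_eqF// sqrtr_gt0.
rewrite /IC -/(residual w) rE lnM ?posrE// -/b.
rewrite mulrDr addrAC (EFinD (D * ln (sigma ^+ 2) + b)) leeD2l//.
rewrite (EFinM D (ln (rank_one_residual _ _ _))) lee_pmul2l ?lte_fin//.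
exact: HZ1.
Qed.

End fixed_sizes.

Lemma mean_IC_true_le : (0 < m0 + n0)%N -> (m0 + n0 < M + N)%N ->
  (\int[P]_w (IC M N kappa m0 n0 (Y w))%:E <=
   (D * (ln (sigma ^+ 2) + 2000 / h) +
    kappa * ((2 ^ (m0 + n0))%N + (2 ^ (M + N - m0 - n0))%N)%:R)%:E)%E.
Proof.
apply: (mean_IC_rank_one_le mM0 nN0 uA vB) => // r c.
by rewrite rank_one_K.
Qed.

End configuration.

(** * Comparison of the error rates with the signal *)

Section signal_rates.
Context {R : realType}.

Lemma powR2_quarter (n : nat) :
  (2 : R) `^ (n%:R / 4) = Num.sqrt (Num.sqrt (2 ^ n)%:R).
Proof.
have -> : n%:R / 4 = n%:R * 2^-1 * 2^-1 :> R by field.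
rewrite !powRrM powR12_sqrt ?powR_ge0// powR12_sqrt ?powR_ge0//.
by rewrite powR_mulrn// natrX.
Qed.

(* [om] is the quantity required to diverge by the second half of (A3). *)
Lemma signal_rates (D s psi : R) : 0 < D -> 0 < s -> 0 <= psi <= 1 ->
  let h := Num.sqrt D in let b := Num.sqrt h in
  let om := b * s * psi ^+ 2 in
  let t := s ^+ 2 * psi ^+ 2 in let L := ln (1 + t) in
  let eta := h^-1 + s / b / (1 + t) in
  let r := om^-1 + 2 / om ^+ 2 + 2 / h in
  0 < om ->
  [/\ 0 < L, 0 < eta, eta <= L * r, eta <= r & h^-1 <= L * r].
Proof.
move=> D0 s0 /andP[psi0 psi1] h b om t L eta r om0.
have h0 : 0 < h by rewrite sqrtr_gt0.
have b0 : 0 < b by rewrite sqrtr_gt0.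
have b2 : b ^+ 2 = h by rewrite sqr_sqrtr// ltW.
have psip : 0 < psi.
  rewrite lt_neqAle psi0 andbT; apply/eqP => pz.
  by move: om0; rewrite /om -pz expr0n mulr0 ltxx.
have t0 : 0 < t by rewrite mulr_gt0// exprn_gt0.
have t1 : 0 < 1 + t by lra.
have tL : t / (1 + t) <= L.
  have i0 : 0 < (1 + t)^-1 by rewrite invr_gt0.
  have i1 : -1 < (1 + t)^-1 - 1 by lra.
  have := le_ln1Dx i1; rewrite [1 + _]addrC subrK lnV ?posrE//.
  have -> : t / (1 + t) = 1 - (1 + t)^-1 by field; rewrite gt_eqF.
  by rewrite /L; lra.
have tt0 : 0 < t / (1 + t) by rewrite divr_gt0.
have tt1 : t / (1 + t) <= 1 by rewrite ler_pdivrMr//; lra.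
have L0 : 0 < L by exact: lt_le_trans tL.
have omV : 0 < om^-1 by rewrite invr_gt0.
have hV : 0 < h^-1 by rewrite invr_gt0.
(* The factor [psi ^+ 2] cancels in [t / om = s / b]; what remains, [t / (1 + t)], is bounded both
   by [L] and by 1. *)
have sE : s / b / (1 + t) = t / (1 + t) * om^-1.
  have -> : s / b = t / om by rewrite /om /t; field; rewrite !gt_eqF.
  by rewrite mulrAC.
have om2 : 0 < 2 / om ^+ 2 by rewrite divr_gt0// exprn_gt0.
have h2 : 0 < 2 / h by rewrite divr_gt0.
(* For [t <= 1], [om ^+ 2 = h * t * psi ^+ 2 <= h * t] and [t <= 2 * L]. For [t > 1], [L >= 2^-1]
   and the summand [2 / h] is enough. *)
have hL : h^-1 <= L * (2 / om ^+ 2 + 2 / h).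
  have [t_le1|t_gt1] := leP t 1.
    have : h^-1 <= t / om ^+ 2.
      rewrite ler_pdivlMr ?exprn_gt0// -b2.
      have -> : b ^- 2 * om ^+ 2 = t * psi ^+ 2 by rewrite /om /t; field; rewrite gt_eqF.
      by rewrite ler_piMr ?(ltW t0)// expr_le1.
    have t2 : t <= 2 * L.
      have : t / 2 <= t / (1 + t) by rewrite ler_pM2l// lef_pV2 ?posrE//; lra.
      lra.
    have : t / om ^+ 2 <= 2 * L / om ^+ 2 by rewrite ler_pM2r// invr_gt0 exprn_gt0.
    have : 0 < L * (2 / h) by rewrite mulr_gt0.
    rewrite mulrDr (mulrA L 2) [L * 2]mulrC; lra.
  have : 2^-1 <= t / (1 + t) by rewrite ler_pdivlMr//; lra.
  move=> t2; have L2 : 2^-1 <= L by lra.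
  have : 2^-1 * (2 / h) <= L * (2 / h) by rewrite ler_pM2r.
  have -> : 2^-1 * (2 / h) = h^-1 by field; rewrite gt_eqF.
  have : 0 < L * (2 / om ^+ 2) by rewrite mulr_gt0.
  by rewrite mulrDr; lra.
have q1 : t / (1 + t) * om^-1 <= L * om^-1 by rewrite ler_pM2r.
have q2 : t / (1 + t) * om^-1 <= om^-1 by rewrite ler_piMl// ltW.
split => //.
- by rewrite /eta sE addr_gt0// mulr_gt0.
- by rewrite /eta sE /r -addrA mulrDr; lra.
- by rewrite /eta sE /r; lra.
- by rewrite /r -addrA mulrDr; have := mulr_gt0 L0 omV; lra.
Qed.

End signal_rates.

Theorem theorem2 (R : realType) (d : measure_display) (T : measurableType d)
  (P : probability T R)
  (M N m0 n0 : nat -> nat) (lam sigma kappa : nat -> R)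
  (A B : nat -> nat -> nat -> R) (E : nat -> T -> nat -> nat -> R) :
  (* sequence with M + N -> oo *)
  (forall c : nat, \forall k \near \oo, (c <= M k + N k)%N) ->
  (* the model: A is 2^m0 x 2^n0, B is 2^(M-m0) x 2^(N-n0), unit Frobenius norms *)
  (forall k, (m0 k <= M k)%N /\ (n0 k <= N k)%N) ->
  (forall k, 0 < lam k) -> (forall k, 0 < sigma k) ->
  (forall k, frob2 (2 ^ m0 k)%N (2 ^ n0 k)%N (A k) = 1) ->
  (forall k, frob2 (2 ^ (M k - m0 k))%N (2 ^ (N k - n0 k))%N (B k) = 1) ->
  (* (A1) *)
  ((fun k => ((m0 k + n0 k)%:R : R) / ln (ln ((M k * N k)%:R))) @ \oo --> +oo) ->
  ((fun k => (((M k - m0 k) + (N k - n0 k))%:R : R) / ln (ln ((M k * N k)%:R)))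
     @ \oo --> +oo) ->
  (* (A2) entries of E k are i.i.d. N(0,1) *)
  (forall k i j, measurable_fun setT (fun w => E k w i j)) ->
  (forall k i j V, measurable V ->
     P ((fun w => E k w i j) @^-1` V) = normal_prob 0 1 V) ->
  (forall k (V : nat -> nat -> set R), (forall i j, measurable (V i j)) ->
     (P (\bigcap_(i in `I_(2 ^ M k)%N) \bigcap_(j in `I_(2 ^ N k)%N)
          ((fun w => E k w i j) @^-1` V i j))
     = \prod_(0 <= i < 2 ^ M k) \prod_(0 <= j < 2 ^ N k)
          P ((fun w => E k w i j) @^-1` V i j))%E) ->
  (* (A3) *)
  ((fun k => (2 : R) `^ ((M k + N k)%:R / 2)
       / ((2 : R) `^ ((m0 k + n0 k)%:R / 2)
          + (2 : R) `^ (((M k - m0 k) + (N k - n0 k))%:R / 2))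
       * (lam k / sigma k) * psi_gap (M k) (N k) (m0 k) (n0 k) (A k) (B k))
     @ \oo --> +oo) ->
  ((fun k => (2 : R) `^ ((M k + N k)%:R / 4) * (lam k / sigma k)
       * psi_gap (M k) (N k) (m0 k) (n0 k) (A k) (B k) ^+ 2) @ \oo --> +oo) ->
  (* conditions on kappa *)
  (forall k, 2 * ln 2 <= kappa k) ->
  (forall e : R, 0 < e -> \forall k \near \oo,
     `|kappa k| <= e * `|(2 ^ (M k + N k))%:R
        * ln (1 + (lam k / sigma k) ^+ 2
                   * psi_gap (M k) (N k) (m0 k) (n0 k) (A k) (B k) ^+ 2)
        / ((2 ^ (m0 k + n0 k))%N + (2 ^ ((M k - m0 k) + (N k - n0 k)))%N)%:R|) ->
  (* conclusion *)
  let Y k w : nat -> nat -> R := fun x y =>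
    lam k * kron (2 ^ (M k - m0 k))%N (2 ^ (N k - n0 k))%N (A k) (B k) x y
    + sigma k * (2 : R) `^ (- ((M k + N k)%:R / 2)) * E k w x y in
  let EIC k (m n : nat) : \bar R :=
    (\int[P]_w (IC (M k) (N k) (kappa k) m n (Y k w))%:E)%E in
  exists eps : nat -> R, eps @ \oo --> 0 /\
    \forall k \near \oo,
      ((\big[Order.min/+oo]_(m < (M k).+1)
          \big[Order.min/+oo]_(n < (N k).+1 | wrong (M k) (N k) (m0 k) (n0 k) (m : nat, n : nat))
             EIC k m n) - EIC k (m0 k) (n0 k)
       >= ((2 ^ (M k + N k))%:R
           * ln (1 + (lam k / sigma k) ^+ 2
                     * psi_gap (M k) (N k) (m0 k) (n0 k) (A k) (B k) ^+ 2)
           * (1 + eps k))%:E)%E.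
Proof.
move=> MN_oo le0 lam0 sigma0 A1 B1 A1_row A1_col mE nE indE _ A3 kap_ge kap_o Y EIC.
pose D k : R := (2 ^ (M k + N k))%:R.
pose h k := Num.sqrt (D k).
pose psi k := psi_gap (M k) (N k) (m0 k) (n0 k) (A k) (B k).
pose s k := lam k / sigma k.
pose t k := s k ^+ 2 * psi k ^+ 2.
pose L k := ln (1 + t k).
pose eta k := (h k)^-1 + s k / Num.sqrt (h k) / (1 + t k).
pose S k : R := ((2 ^ (m0 k + n0 k))%N + (2 ^ ((M k - m0 k) + (N k - n0 k)))%N)%:R.
pose C : R := 16 * (1024 * 297).
pose om k := Num.sqrt (h k) * s k * psi k ^+ 2.
pose r k := (om k)^-1 + 2 / om k ^+ 2 + 2 / h k.
(* All losses after division by [D k]: the wrong-configuration error, the true-configuration error,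
   and the penalty paid at the true configuration. *)
pose loss k := C * (eta k * (1 + L k * eta k)) + 2000 / h k + kappa k * S k / D k.
have D0 k : 0 < D k by rewrite ltr0n expn_gt0.
have h0 k : 0 < h k by rewrite sqrtr_gt0.
have s0 k : 0 < s k by rewrite divr_gt0.
have S0 k : 0 < S k by rewrite ltr0n addn_gt0 expn_gt0.
have C0 : 0 < C by rewrite /C; lra.
have psi01 k : 0 <= psi k <= 1.
  have [mM nN] := le0 k.
  by rewrite sqrtr_ge0 (psi_gap_le1 mM nN (A k) (B k)).
have om_oo a : \forall k \near \oo, a <= om k.
  have := A3 => /cvgryPge/(_ a); apply: filterS => k.
  by rewrite powR2_quarter.
have h_oo a : \forall k \near \oo, a <= h k.
  have := MN_oo (Num.truncn (a ^+ 2)).+1; apply: filterS => k ck.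
  apply: (le_trans (ler_norm a)).
  rewrite -(@ler_pXn2r _ 2) ?nnegrE ?(ltW (h0 k))// sqr_sqrtr ?(ltW (D0 k))//.
  rewrite real_normK ?num_real//; apply: (le_trans (ltW (truncnS_gt _))).
  rewrite ler_nat (leq_trans ck)//; exact: ltnW (ltn_expl _ _).
have r_small e : 0 < e -> \forall k \near \oo, 0 < om k /\ r k <= e.
  move=> e0; have e5 : 0 < 5 / e by rewrite divr_gt0.
  have := om_oo (Num.max 1 (5 / e)); have := h_oo (5 / e).
  apply: filterS2 => k hk; rewrite ge_max => /andP[om1 omk].
  have om0 : 0 < om k by lra.
  split => //.
  have omV : (om k)^-1 <= e / 5.
    by rewrite -[e / 5]invrK lef_pV2 ?posrE ?invr_gt0 ?divr_gt0// invf_div.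
  have hV : (h k)^-1 <= e / 5.
    by rewrite -[e / 5]invrK lef_pV2 ?posrE ?invr_gt0 ?divr_gt0// invf_div.
  have : (om k ^+ 2)^-1 <= (om k)^-1.
    by rewrite lef_pV2 ?posrE ?exprn_gt0// expr2 ler_pMl.
  by rewrite /r; lra.
have loss_small e : 0 < e -> \forall k \near \oo, [/\ 0 < L k, 0 <= loss k & loss k <= L k * e].
  move=> e0.
  (* The three losses are at most [2 * C], [2000] and [1] times [L k * dl]; the cap [1] bounds
     [eta * eta] by [dl]. *)
  pose dl := Num.min 1 (e / (2 * C + 2001)).
  have c0 : 0 < 2 * C + 2001 by lra.
  have dl0 : 0 < dl by rewrite lt_min ltr01 divr_gt0.
  have := r_small dl dl0; have := kap_o dl dl0.
  apply: filterS2 => k kapk [om0 rk].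
  have [L0 eta0 e1 e2 e3] := signal_rates (D k) (s k) (psi k) (D0 k) (s0 k) (psi01 k) om0.
  rewrite -/(t k) -/(L k) -/(h k) -/(om k) -/(r k) in L0 e1 e3.
  rewrite -/(h k) -/(om k) -/(r k) -/(t k) -/(eta k) in eta0 e1 e2.
  have kp : 0 <= kappa k.
    by apply: le_trans (kap_ge k); rewrite mulr_ge0// ln_ge0// ler1n.
  split => //.
    have a1 : 0 <= C * (eta k * (1 + L k * eta k)).
      rewrite (mulr_ge0 (ltW C0))// mulr_ge0 ?(ltW eta0)//.
      by rewrite addr_ge0// mulr_ge0 ?(ltW eta0) ?(ltW L0).
    have a2 : 0 <= 2000 * (h k)^-1 by have := h0 k; rewrite -invr_gt0; lra.
    have a3 : 0 <= kappa k * S k / D k.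
      by rewrite divr_ge0 ?(ltW (D0 k))// mulr_ge0 ?(ltW (S0 k)).
    by rewrite /loss; lra.
  have dl1 : dl <= 1 by rewrite ge_min lexx.
  have dle : (2 * C + 2001) * dl <= e.
    by rewrite mulrC -ler_pdivlMr// ge_min lexx orbT.
  have k1 : kappa k * S k / D k <= L k * dl.
    move: kapk; rewrite -/(D k) -/(s k) -/(psi k) -/(t k) -/(L k) -/(S k).
    rewrite ger0_norm// ger0_norm ?divr_ge0 ?mulr_ge0 ?(ltW (D0 k)) ?(ltW (S0 k)) ?(ltW L0)//.
    rewrite ler_pdivrMr// mulrA ler_pdivlMr//; lra.
  have k2 : eta k * (1 + L k * eta k) <= L k * (2 * dl).
    have a1 : eta k <= L k * dl by apply: (le_trans e1); rewrite ler_pM2l.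
    have a2 : eta k <= dl by exact: le_trans rk.
    have a3 : eta k * eta k <= dl.
      by apply: (@le_trans _ _ (1 * dl)); [rewrite ler_pM ?(ltW eta0)//; lra|rewrite mul1r].
    have : L k * (eta k * eta k) <= L k * dl by rewrite ler_pM2l.
    have -> : eta k * (1 + L k * eta k) = eta k + L k * (eta k * eta k) by ring.
    by lra.
  have k3 : (h k)^-1 <= L k * dl by apply: (le_trans e3); rewrite ler_pM2l.
  have k4 : C * (eta k * (1 + L k * eta k)) <= C * (L k * (2 * dl)) by rewrite ler_pM2l.
  apply: (@le_trans _ _ (L k * ((2 * C + 2001) * dl))); last by rewrite ler_pM2l.
  rewrite /loss; lra.
(* A quotient that is at least 1 has a nonzero numerator whatever its denominator, the value [0]
   included. *)
have row_gt0 : \forall k \near \oo, (0 < m0 k + n0 k)%N.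
  have := A1_row => /cvgryPge/(_ 1); apply: filterS => k.
  by case: (m0 k + n0 k)%N => //; rewrite mul0r ler10.
have col_gt0 : \forall k \near \oo, (0 < (M k - m0 k) + (N k - n0 k))%N.
  have := A1_col => /cvgryPge/(_ 1); apply: filterS => k.
  by case: ((M k - m0 k) + (N k - n0 k))%N => //; rewrite mul0r ler10.
exists (fun k => - (loss k / L k)); split.
  apply/cvgr0Pnorm_le => e e0; have := loss_small e e0; apply: filterS => k [L0 l0 lk].
  by rewrite normrN ger0_norm ?divr_ge0 ?(ltW L0)// ler_pdivrMr// mulrC.
have := loss_small 1 ltr01; have := row_gt0; have := col_gt0.
apply: filterS3 => k col0 row0 [L0 _ _]; have [mM nN] := le0 k.
rewrite -/(D k) -/(s k) -/(psi k) -/(t k) -/(L k).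
pose lo := D k * (ln (sigma k ^+ 2) + L k - C * (eta k * (1 + L k * eta k))).
pose hi := D k * (ln (sigma k ^+ 2) + 2000 / h k) + kappa k * S k.
have -> : D k * L k * (1 + - (loss k / L k)) = lo - hi.
  rewrite /lo /hi /loss; field; rewrite !gt_eqF//.
rewrite EFinB; apply: leeB.
  (* The default [+oo] of an empty minimum satisfies any lower bound. *)
  apply: le_bigmin => [|m _]; first exact: leey.
  apply: le_bigmin => [|n W]; first exact: leey.
  have /andP[/and4P[/= mM' nN' _ _] _] := W.
  exact: (mean_IC_wrong_ge mM nN (A k) (B k) (A1 k) (B1 k)
    (lam k) (sigma k) (kappa k) (E k) (lam0 k) (sigma0 k) (mE k) (nE k) (indE k) mM' nN' W (kap_ge k)).
have mn_lt : (m0 k + n0 k < M k + N k)%N by lia.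
have := mean_IC_true_le mM nN (A k) (B k) (A1 k) (B1 k)
    (lam k) (sigma k) (kappa k) (E k) (lam0 k) (sigma0 k) (mE k) (nE k) (indE k) row0 mn_lt.
have -> : (2 ^ (M k + N k - m0 k - n0 k) = 2 ^ ((M k - m0 k) + (N k - n0 k)))%N.
  by congr (2 ^ _)%N; lia.
by [].
Qed.
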